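(* Assume $d\ge 3$ and let $q$ be real with $1<q<\frac{d}{d-2}$. Then there are constants $c_1^-(q,d)>0$ and $c_1^+(q,d)>0$ such that for every $\xi\ge 1$ and all $n$ large enough, $$\exp\left(-c_1^-(q,d)\, \xi^{\frac{2}{d}\cdot\frac{1}{q-1}}\,n^{1-\frac{2}{d}}\right)\le P\left( \|l_n\|_q^q-E[\|l_n\|_q^q]\ge \xi n\right)\le \exp\left(-c_1^+(q,d)\, \xi^{\frac{2}{d}\cdot\frac{1}{q-1}}\,n^{1-\frac{2}{d}}\right).$$ Moreover, for every $\xi\ge 1$, $$\limsup_{A\to\infty}\ \limsup_{n\to\infty}\ \frac{1}{n^{1-\frac{2}{d}}}\log P\left(\sum_{z\in \mathbb{Z}^d}\mathbf{1}_{\{l_n(z)>A\}}\,l_n(z)^q\ge \xi n\right)=-\infty.$$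
   Context: $\{S(n),\ n\in\mathbb{N}\}$ is the simple (nearest-neighbour, symmetric) random walk on $\mathbb{Z}^d$ started at the origin, with law $P$ and expectation $E$. Its local times are $l_n(z)=\sum_{k=0}^{n-1}\mathbf{1}_{\{S(k)=z\}}$ for $z\in\mathbb{Z}^d$, and $\|l_n\|_q^q=\sum_{z\in\mathbb{Z}^d} l_n(z)^q$. Convention: $\log 0=-\infty$. *)

(* Defs.v *)
From HB Require Import structures.
From mathcomp Require Import all_boot all_order all_algebra finmap.
From mathcomp Require Import all_classical all_reals all_analysis.

Set Implicit Arguments.
Unset Strict Implicit.
Unset Printing Implicit Defensive.

Import Order.TTheory GRing.Theory Num.Theory.
Import numFieldNormedType.Exports.

Local Open Scope classical_set_scope.
Local Open Scope ring_scope.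

(* The lattice Z^d is 'rV[int]_d with its discrete sigma-algebra: every subset
   of Z^d is measurable. *)

Section random_walk.
Context {R : realType} {disp : measure_display} {T : measurableType disp}.
Variables (P : probability T R) (d : nat).

Definition lattice_rv (X : T -> 'rV[int]_d) : Prop :=
  forall B : set 'rV[int]_d, measurable (X @^-1` B).

Definition mutually_independent (X : nat -> T -> 'rV[int]_d) : Prop :=
  forall (J : {fset nat}) (B : nat -> set 'rV[int]_d),
    P (\bigcap_(k in [set` J]) (X k @^-1` B k)) =
    (\prod_(k <- J) P (X k @^-1` B k))%E.

Definition increment (S : nat -> T -> 'rV[int]_d) (k : nat) (w : T) :
  'rV[int]_d := S k.+1 w - S k w.

Definition nearest_neighbour (e : 'rV[int]_d) : Prop :=
  \sum_(i < d) `|e ord0 i| = 1.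

(* The origin has 2d nearest neighbours, so the last clause exhausts the mass
   of the law of each increment. *)
Definition simple_random_walk (S : nat -> T -> 'rV[int]_d) : Prop :=
  [/\ forall w, S 0%N w = 0,
      forall k, lattice_rv (increment S k),
      mutually_independent (increment S) &
      forall k e, nearest_neighbour e ->
        P (increment S k @^-1` [set e]) = ((2 * d%:R)^-1)%:E].

End random_walk.

Section local_times.
Context {R : realType} {T : Type} {d : nat}.
Variable S : nat -> T -> 'rV[int]_d.

Definition local_time (n : nat) (z : 'rV[int]_d) (w : T) : nat :=
  (\sum_(k < n) (S k w == z))%N.

(* The sums over Z^d below are finitely supported when q != 0: at most n sites
   have l_n(z) > 0, and 0 `^ q = 0. *)
Definition local_time_norm (q : R) (n : nat) (w : T) : R :=
  \sum_(z \in [set: 'rV[int]_d]) (local_time n z w)%:R `^ q.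

Definition high_local_time_norm (q A : R) (n : nat) (w : T) : R :=
  \sum_(z \in [set: 'rV[int]_d])
    (A < (local_time n z w)%:R)%R%:R * (local_time n z w)%:R `^ q.

End local_times.

(* Main.v *)
Require Import Defs.
From HB Require Import structures.
From mathcomp Require Import all_boot all_order all_algebra finmap.
From mathcomp Require Import all_classical all_reals all_analysis measurable_realfun.
From mathcomp Require Import zify ring lra.

Set Implicit Arguments.
Unset Strict Implicit.
Unset Printing Implicit Defensive.

Import Order.TTheory GRing.Theory Num.Theory.
Import numFieldNormedType.Exports.

Local Open Scope classical_set_scope.
Local Open Scope ring_scope.

(** A path of [n] steps is a word in the [2d] signed coordinate directions, so
    probabilities are averages [Ex n] over words.

    Upper bounds.  Fix [gam] with [q - 1 < gam < 2 / (d - 2)] and call level [j]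
    failed when the excess [sum_z (l_n(z) - a 4^j)_+] is larger than
    [4^(-gam j) n].  If no level fails, summing over dyadic levels bounds
    [sum_z l_n(z)^q] by [C a^(q-1) n], and the part of the sum carried by sites
    with large local time by an arbitrarily small multiple of [n].  At the first
    failing level the walk spends an atypical time in a set of heavy sites which
    is itself small.  At low levels such a set is covered by few boxes, has low
    density on a scale [h], and Khas'minskii's exponential moment bound applies
    at a cost [n / h^2] that exceeds the entropy of the choice of the boxes.  At
    high levels a heavy set of [v] sites contains about [v^(1-2/d)] sites with a
    bounded sum of Green functions, and one takes a union bound over these
    sites.  Either way a failure costs [exp(- c a^(2/d) n^(1-2/d))].  For bounded
    [xi] one truncates the local times, compares the walk with independent
    blocks by controlling revisits between blocks, and uses a Chernoff bound.

    Lower bound.  The product of cosines is an eigenfunction of the walk killed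
    outside a box of radius [r], so that the walk stays there with probability at
    least [exp(- 4 n / r^2)].  Confinement forces [sum_z l_n(z)^q] to be at least
    of order [n (n / r^d)^(q-1)] by convexity. *)

(** * Averages over step words *)

(** With [s = 4^j], a heavy set at level [j] has at most about [n / (a s^(1+gam))] sites, and [h^2]
    is, up to slack, that volume to the power [2/d]. The cost [s^(-gam) n / h^2] is then
    [a^(2/d) n^(1-2/d)] times [s^(2/d - gam (1-2/d))]: the condition [gam < 2/(d-2)] keeps it from
    shrinking with the level, while [q - 1 < gam] makes the sum of [s^(q-1) s^(-gam)] over the
    levels converge. Such a [gam] exists exactly when [q < d/(d-2)]. The obstacle is that the heavy
    set is produced by the very walk that visits it. Two devices break this dependence. Visits are
    split by a time lag of at least [h^2], so that the heavy set of the past is fixed while the walk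
    forgets its position. And the set is replaced by a list of points, over which a union bound
    costs a multiple of [log n] per point. At low levels the list has at most [s^gam / theta1]
    points, affordable for [s <= n^(1/36)]; beyond that, each listed site carries more than
    [n^(1/36)] visits, which alone beats [log n]. The exponent 36 only leaves room: [1 - 2/d >= 1/3]
    gives [n^(1-2/d) >= n^(12/36)]. *)

Section word_expectation.
Variables (R : realType) (d : nat).

Definition step : Type := ('I_d * bool)%type.

Definition vec (s : step) : 'rV[int]_d :=
  \row_i (if s.1 == i then (-1) ^+ s.2 else 0).

Definition avg (F : step -> R) : R := (2 * d%:R)^-1 * \sum_s F s.

(** The first letter is averaged outermost, so that conditioning on a prefix is plain nesting, as in
    [Ex_cat], and measure theory enters only when words are matched with the walk. *)
Fixpoint Ex (n : nat) (f : seq step -> R) : R :=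
  if n is m.+1 then avg (fun s => Ex m (fun w => f (s :: w))) else f [::].

Definition Pr (n : nat) (A : pred (seq step)) : R := Ex n (fun w => (A w)%:R).

Lemma eq_avg F G : F =1 G -> avg F = avg G.
Proof. by move=> FG; rewrite /avg; congr *%R; apply: eq_bigr => s _; exact: FG. Qed.

Lemma le_avg F G : (forall s, F s <= G s) -> avg F <= avg G.
Proof.
move=> FG; rewrite /avg ler_wpM2l ?invr_ge0 ?mulr_ge0 //.
by apply: ler_sum => s _; exact: FG.
Qed.

Lemma avgD F G : avg (fun s => F s + G s) = avg F + avg G.
Proof. by rewrite /avg big_split mulrDr. Qed.

Lemma avgZ c F : avg (fun s => c * F s) = c * avg F.
Proof. by rewrite /avg -mulr_sumr mulrCA. Qed.

Lemma avg_cst c : (0 < d)%N -> avg (fun _ => c) = c.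
Proof.
move=> d0; rewrite /avg sumr_const card_prod card_ord card_bool -[c *+ _]mulr_natl.
by rewrite natrM [d%:R * _]mulrC mulrA mulVf ?mul1r // mulf_neq0 ?pnatr_eq0 -?lt0n.
Qed.

Lemma eq_Ex n f g : (forall w, size w = n -> f w = g w) -> Ex n f = Ex n g.
Proof.
elim: n f g => [|n IH] f g fg /=; first exact: fg.
by apply: eq_avg => s; apply: IH => w sw; apply: fg; rewrite /= sw.
Qed.

Lemma le_Ex n f g : (forall w, size w = n -> f w <= g w) -> Ex n f <= Ex n g.
Proof.
elim: n f g => [|n IH] f g fg /=; first exact: fg.
by apply: le_avg => s; apply: IH => w sw; apply: fg; rewrite /= sw.
Qed.

Lemma ExD n f g : Ex n (fun w => f w + g w) = Ex n f + Ex n g.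
Proof.
elim: n f g => [//|n IH] f g /=.
by rewrite -avgD; apply: eq_avg => s; exact: IH.
Qed.

Lemma ExZ n c f : Ex n (fun w => c * f w) = c * Ex n f.
Proof.
elim: n f => [//|n IH] f /=.
by rewrite -avgZ; apply: eq_avg => s; exact: IH.
Qed.

Lemma Ex_cat m n f :
  Ex (m + n) f = Ex m (fun u => Ex n (fun v => f (u ++ v))).
Proof.
by elim: m f => [//|m IH] f /=; apply: eq_avg => s; rewrite IH.
Qed.

Hypothesis d0 : (0 < d)%N.

Lemma Ex_cst n c : Ex n (fun _ => c) = c.
Proof.
elim: n => [//|n IH] /=.
by rewrite -[RHS](avg_cst c d0); apply: eq_avg => s; exact: IH.
Qed.

Lemma Ex_ge0 n f : (forall w, size w = n -> 0 <= f w) -> 0 <= Ex n f.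
Proof. by move=> f0; rewrite -(Ex_cst n 0); exact: le_Ex. Qed.

Lemma Ex_le_cst n f c : (forall w, size w = n -> f w <= c) -> Ex n f <= c.
Proof. by move=> f0; rewrite -(Ex_cst n c); exact: le_Ex. Qed.

Lemma Ex_sum n (I : Type) (r : seq I) (F : I -> seq step -> R) :
  Ex n (fun w => \sum_(i <- r) F i w) = \sum_(i <- r) Ex n (F i).
Proof.
elim: r => [|i r IH].
  by rewrite big_nil -[RHS](Ex_cst n); apply: eq_Ex => w _; rewrite big_nil.
rewrite big_cons -IH -ExD; apply: eq_Ex => w _; exact: big_cons.
Qed.

Lemma Ex_take n m f : (m <= n)%N -> Ex n (fun w => f (take m w)) = Ex m f.
Proof.
move=> mn; rewrite -(subnKC mn) Ex_cat; apply: eq_Ex => u su.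
rewrite -[RHS](Ex_cst (n - m)); apply: eq_Ex => v _.
by rewrite -su take_size_cat.
Qed.

Lemma le_Pr n (A B : pred (seq step)) :
  (forall w, size w = n -> A w -> B w) -> Pr n A <= Pr n B.
Proof.
move=> AB; apply: le_Ex => w /AB; rewrite ler_nat.
by case: (A w) => // /(_ isT) ->.
Qed.

Lemma Pr_ge0 n A : 0 <= Pr n A.
Proof. by apply: Ex_ge0 => w _; case: (A w); rewrite ?ler01. Qed.

Lemma Pr_or n A B : Pr n (fun w => A w || B w) <= Pr n A + Pr n B.
Proof.
rewrite /Pr -ExD; apply: le_Ex => w _; rewrite -natrD ler_nat.
by case: (A w); case: (B w).
Qed.

Lemma Pr_has n (I : Type) (r : seq I) (A : I -> pred (seq step)) :
  Pr n (fun w => has (A^~ w) r) <= \sum_(i <- r) Pr n (A i).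
Proof.
rewrite /Pr -Ex_sum; apply: le_Ex => w _.
elim: r => [|i r IH]; first by rewrite big_nil.
rewrite big_cons /=; case: (A i w) => /=; last by rewrite add0r.
by rewrite lerDl; apply: sumr_ge0 => j _; rewrite ler0n.
Qed.

Lemma Pr_expR n f x :
  Pr n (fun w => x <= f w) <= expR (- x) * Ex n (fun w => expR (f w)).
Proof.
rewrite -ExZ; apply: le_Ex => w _; rewrite -expRD.
case: (lerP x (f w)) => [xf|_]; last exact: expR_ge0.
by rewrite -[1%:R]expR0 ler_expR; lra.
Qed.

End word_expectation.

Section real_inequalities.
Variable R : realType.
Implicit Types x y : R.

Lemma expR_le_inv x : x < 1 -> expR x <= (1 - x)^-1.
Proof.
move=> x1; rewrite -[expR x]invrK -expRN lef_pV2 ?posrE ?expR_gt0 ?subr_gt0 //.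
by have := expR_ge1Dx (- x).
Qed.

Lemma expR_le1D2x x : 0 <= x <= 1 / 2 -> expR x <= 1 + 2 * x.
Proof.
move=> x12; apply: (le_trans (expR_le_inv _)); first by lra.
by rewrite -div1r ler_pdivrMr; nra.
Qed.

Lemma expR_le_quad x : x <= 1 / 2 -> expR x <= 1 + x + 2 * x ^+ 2.
Proof.
move=> x12; apply: (le_trans (expR_le_inv _)); first by lra.
rewrite -div1r ler_pdivrMr; last by lra.
by have := sqr_ge0 x; rewrite expr2; nra.
Qed.

End real_inequalities.

(** * Block sums along the walk and Khas'minskii's exponential bound *)

Section chains.
Variables (R : realType) (d : nat).
Local Notation word := (seq (step d)).

(** The first argument of [F] is the whole path before the block. The conditional expectation of a
    summand given the past is thus [Ex B (F p)], which is how adapted sums are centred below. *)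
Fixpoint cs (B K : nat) (F : word -> word -> R) (p w : word) : R :=
  if K is K'.+1
  then F p (take B w) + cs B K' F (p ++ take B w) (drop B w) else 0.

Lemma csE B K F p w : cs B K F p w =
  \sum_(0 <= i < K) F (p ++ take (i * B) w) (take B (drop (i * B) w)).
Proof.
elim: K p w => [|K IH] p w; first by rewrite big_nil.
rewrite big_nat_recl //= mul0n take0 cats0 drop0 IH; congr (_ + _).
apply: eq_bigr => i _; rewrite drop_drop -catA mulSn addnC; congr (F (p ++ _) _).
by rewrite takeD.
Qed.

Lemma Ex_csS B K (g : R -> R) F p :
  (forall x y, g (x + y) = g x * g y) ->
  Ex (K.+1 * B) (fun w => g (cs B K.+1 F p w)) =
  Ex B (fun b => g (F p b) * Ex (K * B) (fun w => g (cs B K F (p ++ b) w))).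
Proof.
move=> gD; rewrite mulSn Ex_cat; apply: eq_Ex => u su; rewrite -ExZ.
apply: eq_Ex => v _ /=.
by rewrite -su take_size_cat // drop_size_cat // gD.
Qed.

Hypothesis d0 : (0 < d)%N.

(* Each block, conditionally on its past, has exponential moment at most 1. *)
Lemma Ex_expR_cs_le1 B K F p :
  (forall q, Ex B (fun b => expR (F q b)) <= 1) ->
  Ex (K * B) (fun w => expR (cs B K F p w)) <= 1.
Proof.
move=> F1; elim: K p => [|K IH] p; first by rewrite mul0n /= expR0.
rewrite Ex_csS; last exact: expRD.
apply: le_trans (F1 p); apply: le_Ex => b _.
by rewrite ger_pMr ?expR_gt0.
Qed.

(** On [[0, 1/2]], [exp y <= 1 + 2 y], so the mean of [exp y] is at most [1 + 2 E y <= exp (2 E y)].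
    Doubling the mean is harmless for quantities that only have to be small. *)
Lemma Ex_expR_center B (y : word -> R) :
  (forall b, 0 <= y b <= 1 / 2) ->
  Ex B (fun b => expR (y b - 2 * Ex B y)) <= 1.
Proof.
move=> y12; rewrite (eq_Ex (g := fun b => expR (- (2 * Ex B y)) * expR (y b))).
  rewrite ExZ expRN mulrC ler_pdivrMr ?expR_gt0 // mul1r.
  apply: le_trans (expR_ge1Dx _).
  apply: (@le_trans _ _ (Ex B (fun b => 1 + 2 * y b))).
    by apply: le_Ex => b _; exact: expR_le1D2x.
  by rewrite ExD ExZ Ex_cst.
by move=> b _; rewrite -expRD addrC.
Qed.

(** A second-order expansion keeps the mean with factor one, at the price [2 s^2]. Concentration
    just above the true mean requires this sharper centring. *)
Lemma Ex_expR_center2 B (y : word -> R) (s : R) :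
  (forall b, 0 <= y b <= 1) -> 0 <= s <= 1 / 2 ->
  Ex B (fun b => expR (s * y b - (s * Ex B y + 2 * s ^+ 2))) <= 1.
Proof.
move=> y1 s12.
rewrite (eq_Ex (g := fun b => expR (- (s * Ex B y + 2 * s ^+ 2)) * expR (s * y b))).
  rewrite ExZ expRN mulrC ler_pdivrMr ?expR_gt0 // mul1r.
  apply: le_trans (expR_ge1Dx _).
  apply: (@le_trans _ _ (Ex B (fun b => 1 + (s * y b + 2 * s ^+ 2)))); last first.
    by rewrite !ExD ExZ !Ex_cst.
  apply: le_Ex => b _.
  apply: (le_trans (expR_le_quad _)); first by have := y1 b; nra.
  rewrite addrA lerD2l ler_pM2l // exprMn ler_piMr ?sqr_ge0 //.
  by have /andP[y0 yle1] := y1 b; rewrite expr_le1.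
by move=> b _; rewrite -expRD addrC.
Qed.

Definition pos (w : word) : 'rV[int]_d := \sum_(s <- w) vec s.

Lemma pos_nil : pos [::] = 0. Proof. exact: big_nil. Qed.
Lemma pos_cons s w : pos (s :: w) = vec s + pos w.
Proof. exact: big_cons. Qed.
Lemma pos_cat v w : pos (v ++ w) = pos v + pos w.
Proof. exact: big_cat. Qed.

(* [B = 1] gives the occupation sums of the walk itself. *)
Definition green (f : 'rV[int]_d -> R) B K p : R :=
  \sum_(0 <= i < K) Ex (i * B) (fun w => f (pos (p ++ w))).

Lemma greenS f B K p :
  green f B K.+1 p = f (pos p) + Ex B (fun b => green f B K (p ++ b)).
Proof.
rewrite /green big_nat_recl //= cats0; congr (_ + _).
rewrite Ex_sum //; apply: eq_bigr => i _.
rewrite mulSn Ex_cat; apply: eq_Ex => b _; apply: eq_Ex => w _.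
by rewrite catA.
Qed.

(** Where [f] vanishes the first factor is 1. Elsewhere the remaining expectation is at most 2 and
    [exp (lam f) <= 1 + 2 lam f], so that a step adds at most [4 lam f], exactly the increment of
    the right-hand side. The Green bound is therefore assumed on the support of [f] only, which
    [sparse_visits] exploits when the walk starts off the set. *)
Lemma khasminskii f B K p (lam : R) :
  (forall x, 0 <= f x <= 1) -> 0 <= lam <= 1 / 2 ->
  (forall q k, (k <= K)%N -> f (pos q) != 0 -> 4 * lam * green f B k q <= 1) ->
  Ex (K * B) (fun w => expR (cs B K (fun q _ => lam * f (pos q)) p w)) <=
  1 + 4 * lam * green f B K p.
Proof.
move=> f01 lam12; elim: K p => [|K IH] p G1.
  by rewrite mul0n /= expR0 /green big_nil mulr0 addr0.
rewrite Ex_csS; last exact: expRD.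
rewrite ExZ; set E := Ex B _.
have EG : E <= 1 + 4 * lam * Ex B (fun b => green f B K (p ++ b)).
  rewrite -ExZ; apply: (@le_trans _ _ (Ex B (fun b => 1 + 4 * lam * green f B K (p ++ b)))).
    by apply: le_Ex => b _; apply: IH => q k kK; exact: G1 (leqW kK).
  by rewrite ExD Ex_cst.
have GS := greenS f B K p.
have f1 := f01 (pos p).
have [f0|fn0] := eqVneq (f (pos p)) 0.
  by rewrite f0 mulr0 expR0 mul1r GS f0 add0r.
have E2 : E <= 2.
  apply: (le_trans EG); have := G1 p K.+1 (leqnn _) fn0; rewrite GS; nra.
have E0 : 0 <= E.
  by apply: Ex_ge0 => // b _; apply: Ex_ge0 => // w _; exact: expR_ge0.
have e1 : expR (lam * f (pos p)) <= 1 + 2 * (lam * f (pos p)).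
  by apply: expR_le1D2x; nra.
apply: (le_trans (ler_wpM2r E0 e1)); rewrite GS.
suff : lam * f (pos p) * E <= lam * f (pos p) * 2 by nra.
by rewrite ler_wpM2l //; nra.
Qed.

End chains.

(** * Heat kernel bound *)

Section one_dimensional_kernel.
Variable R : realType.

(** The [k]-step transition probability of the simple walk on the integers, from 0 to [y]. *)
Fixpoint kernel1 (k : nat) (y : int) : R :=
  if k is k'.+1 then (kernel1 k' (y - 1) + kernel1 k' (y + 1)) / 2
  else (y == 0)%:R.

(** The index [j] counts up-steps. In the first alternative it may exceed [k], where the binomial
    coefficient is 0; the second alternative means wrong parity or [y < -k]. *)
Lemma kernel1_bin k (y : int) :
  (exists2 j : nat, y = j%:Z * 2 - k%:Z & kernel1 k y = 'C(k, j)%:R / 2 ^+ k) \/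
  (kernel1 k y = 0 /\ forall j : nat, y <> j%:Z * 2 - k%:Z).
Proof.
elim: k y => [|k IH] y /=.
  have [->|y0] := eqVneq y 0; first by left; exists 0%N; rewrite ?bin0 ?divr1.
  case: (boolP [exists j : 'I_(`|y|%N.+1), y == (j : nat)%:Z * 2]).
    move=> /existsP[j /eqP yj]; left; exists j; first by rewrite subr0.
    have: (0 < j)%N by lia.
    by case: (nat_of_ord j) => // j' _; rewrite bin0n /= mul0r.
  move=> /existsPn yj; right; split=> // j; rewrite subr0 => yE.
  have jy : (j < `|y|%N.+1)%N by lia.
  by have /eqP := yj (Ordinal jy); exact.
case: (IH (y + 1)) => [[j yE ->]|[-> ny]].
  left; exists j; first by lia.
  case: j yE => [|j] yE.
    case: (IH (y - 1)) => [[j' yE' _]|[-> _]]; first by lia.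
    by rewrite add0r !bin0 exprS; field; rewrite expf_neq0.
  case: (IH (y - 1)) => [[j' yE' ->]|[_ /(_ j)]]; last by lia.
  have -> : j' = j by lia.
  by rewrite binS natrD exprS; field; rewrite expf_neq0.
right; case: (IH (y - 1)) => [[j' yE' _]|[-> _]].
  by case: (ny j'.+1); lia.
by rewrite addr0 mul0r; split=> // j yE; case: (ny j); lia.
Qed.

Lemma kernel1_ge0 k y : 0 <= kernel1 k y.
Proof.
by case: (kernel1_bin k y) => [[j _ ->]|[-> _]].
Qed.

Lemma leq_bin_next n j : (j.*2 < n)%N -> ('C(n, j) <= 'C(n, j.+1))%N.
Proof.
move=> jn; have jn' : (0 < n - j)%N by lia.
rewrite -(leq_pmul2l jn') -mul_bin_left leq_mul2r; apply/orP; right; lia.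
Qed.

Lemma leq_bin_half n j : ('C(n, j) <= 'C(n, n./2))%N.
Proof.
wlog jn : j / (j <= n./2)%N => [H|].
  case: (leqP j n./2) => [/H//|nj]; case: (leqP j n) => [jn|/bin_small ->//].
  rewrite -bin_sub //; apply: H; lia.
elim: {j}(n./2 - j)%N {-2}j (erefl (n./2 - j)%N) jn => [|m IH] j mE jn.
  by have -> : j = n./2 by lia.
apply: leq_trans (leq_bin_next _) (IH j.+1 _ _); lia.
Qed.

(** The squared ratio of consecutive central coefficients is [4 (2m+1)^2 / (m+1)^2], so the
    induction step reduces to [(2m+1)(2m+3) <= 4 (m+1)^2]; the weight [2m+1] is chosen for this. *)
Lemma central_bin_sq m : ('C(m.*2, m) ^ 2 * m.*2.+1 <= 16 ^ m)%N.
Proof.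
elim: m => [//|m IH].
have E : (m.+1 * 'C(m.+1.*2, m.+1) = 2 * m.*2.+1 * 'C(m.*2, m))%N.
  rewrite doubleS.
  have E4 : ('C(m.*2.+1, m.+1) = 'C(m.*2.+1, m))%N.
    by rewrite -bin_sub; [congr ('C(_, _)); lia|lia].
  by rewrite binS -E4 addnn -mul2n mulnCA -(mul_bin_diag m.*2.+1 m) mulnA.
have m0 : (0 < m.+1 ^ 2)%N by rewrite expn_gt0.
rewrite -(leq_pmul2l m0) mulnA -expnMn E !expnMn.
have -> : (m.+1.*2.+1 = m.*2 + 3)%N by lia.
have : (m.*2.+1 * (m.*2 + 3) <= 4 * m.+1 ^ 2)%N by rewrite -mul2n; nia.
rewrite [(16 ^ m.+1)%N]expnS => H.
have := leq_mul (leq_mul (leqnn 4) H) IH; congr leq; rewrite /expn /=; ring.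
Qed.

Lemma bin_half_sq k : ('C(k, k./2) ^ 2 * k.+1 <= 4 ^ k)%N.
Proof.
have C m := central_bin_sq m.
have E16 m : (16 ^ m = 4 ^ m.*2)%N by rewrite -mul2n expnM.
case: (boolP (odd k)) => [ok|ek]; last first.
  have := C k./2; rewrite E16; have -> : k./2.*2 = k by lia.
  by [].
set m := k./2; have -> : k = m.*2.+1 by rewrite /m; lia.
have E1 := mul_bin_diag m.*2.+1 m; rewrite /= in E1.
have E4 : ('C(m.*2.+1, m.+1) = 'C(m.*2.+1, m))%N.
  by rewrite -bin_sub; [congr ('C(_, _)); lia|lia].
have m0 : (0 < m.+1 ^ 2)%N by rewrite expn_gt0.
rewrite -(leq_pmul2l m0) mulnA -expnMn -{1}E4 -E1 expnMn.
rewrite [(4 ^ m.*2.+1)%N]expnS -E16.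
have H : (m.*2.+1 * m.*2.+2 <= 4 * m.+1 ^ 2)%N by rewrite -mul2n; nia.
have := leq_mul H (C m); congr leq; rewrite /expn /=; ring.
Qed.

Lemma kernel1_le k y : kernel1 k y <= (Num.sqrt k.+1%:R)^-1.
Proof.
have s0 : 0 < Num.sqrt k.+1%:R :> R by rewrite sqrtr_gt0.
case: (kernel1_bin k y) => [[j _ ->]|[-> _]]; last by rewrite invr_ge0 ltW.
rewrite ler_pdivrMr ?exprn_gt0 // [leRHS]mulrC ler_pdivlMr //.
rewrite -(@ler_pXn2r _ 2) // ?nnegrE ?exprn_ge0 ?mulr_ge0 ?sqrtr_ge0 //.
rewrite exprMn sqr_sqrtr // -exprM mulnC exprM -!natrX -natrM ler_nat.
apply: leq_trans (bin_half_sq k).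
by rewrite leq_mul2r leq_exp2r // leq_bin_half orbT.
Qed.

End one_dimensional_kernel.

Section heat_kernel.
Variables (R : realType) (d : nat).
Hypothesis d0 : (0 < d)%N.

Lemma avg_coord (F : step d -> R) :
  avg F = d%:R^-1 * \sum_i (2^-1 * (F (i, true) + F (i, false))).
Proof.
rewrite /avg [2 * _]mulrC invfM -mulrA; congr (_ * _).
rewrite -mulr_sumr; congr (_ * _).
rewrite (eq_bigr (fun p => F (p.1, p.2))); last by case.
rewrite -(pair_bigA _ (fun i b => F (i, b))) /=.
by apply: eq_bigr => i _; rewrite big_bool.
Qed.

(** Weierstrass's product inequality; the bounds on the product itself are carried along for the
    induction. *)
Lemma le_prod_1B (I : Type) (r : seq I) (x : I -> R) :
  (forall i, 0 <= x i <= 1) ->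
  0 <= \prod_(i <- r) (1 - x i) <= 1 /\
  1 - \sum_(i <- r) x i <= \prod_(i <- r) (1 - x i).
Proof.
move=> x01; elim: r => [|i r [IH1 IH2]].
  by rewrite !big_nil subr0 lexx ler01.
rewrite !big_cons; have := x01 i.
move: (\prod_(j <- r) _) (\sum_(j <- r) _) IH1 IH2 => P S; nra.
Qed.

(** A step of the walk advances the clock [m i] of one uniformly chosen coordinate by 1. On average
    this lowers the product at least as much as advancing every clock by [1/(4d)]: the first gains
    the factor [1 - 1/(2(m i + 1))], the second at most [1 - dl/(m l + dl)] per coordinate, and for
    [m >= 1] the sums of these gains compare. No count of the steps in each direction is
    required. *)
Lemma avg_prod_invsqrt (m : 'I_d -> R) : (forall i, 1 <= m i) ->
  d%:R^-1 * \sum_i \prod_l (Num.sqrt (m l + (i == l)%:R))^-1 <=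
  \prod_l (Num.sqrt (m l + (4 * d%:R)^-1))^-1.
Proof.
move=> m1; set dl := (4 * d%:R)^-1.
have dR : 0 < d%:R :> R by rewrite ltr0n.
have dl0 : 0 < dl by rewrite invr_gt0 mulr_gt0.
have m0 l : 0 < m l by apply: lt_le_trans (m1 l).
have md0 l : 0 < m l + dl by rewrite addr_gt0.
pose P := \prod_l (Num.sqrt (m l))^-1.
have P0 : 0 <= P by apply: prodr_ge0 => l _; rewrite invr_ge0 sqrtr_ge0.
have term i : \prod_l (Num.sqrt (m l + (i == l)%:R))^-1 <=
    P * (1 - (2 * (m i + 1))^-1).
  rewrite (bigD1 i) //= eqxx (eq_bigr (fun l => (Num.sqrt (m l))^-1)); last first.
    by move=> l li; rewrite eq_sym (negPf li) addr0.
  rewrite /P [\prod_l _](bigD1 i) //= -mulrA [leRHS]mulrCA mulrC.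
  rewrite ler_wpM2l //; first by apply: prodr_ge0 => l _; rewrite invr_ge0 sqrtr_ge0.
  have s0 : 0 < Num.sqrt (m i) by rewrite sqrtr_gt0.
  have s1 : 0 < Num.sqrt (m i + 1) by rewrite sqrtr_gt0 addr_gt0.
  rewrite ler_pdivlMl // ler_pdivrMr //.
  have m10 : 0 < m i + 1 by rewrite addr_gt0.
  have -> : 1 - (2 * (m i + 1))^-1 = (2 * m i + 1) / (2 * (m i + 1)).
    by field; rewrite gt_eqF.
  have mi := m0 i.
  have c0 : 0 <= (2 * m i + 1) / (2 * (m i + 1)) by rewrite divr_ge0 //; lra.
  have cs0 := mulr_ge0 c0 (ltW s1).
  rewrite -(@ler_pXn2r _ 2) // ?nnegrE ?sqrtr_ge0 // exprMn.
  rewrite !sqr_sqrtr ?(ltW m10) ?(ltW mi) // expr_div_n.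
  rewrite mulrAC ler_pdivlMr ?exprn_gt0 ?mulr_gt0 // !expr2.
  have := m0 i; nra.
have x01 l : 0 <= dl / (m l + dl) <= 1.
  rewrite divr_ge0 ?(ltW dl0) ?(ltW (md0 l)) //= ler_pdivrMr // mul1r.
  by have := m0 l; lra.
have [_ pB] := le_prod_1B (index_enum _) x01.
apply: (le_trans (y := P * \prod_l (1 - dl / (m l + dl)))); last first.
  rewrite /P -big_split /=; apply: ler_prod => l _.
  have -> : 1 - dl / (m l + dl) = m l / (m l + dl) by field; rewrite gt_eqF.
  have s0 : 0 < Num.sqrt (m l) by rewrite sqrtr_gt0.
  have s1 : 0 < Num.sqrt (m l + dl) by rewrite sqrtr_gt0.
  apply/andP; split.
    by rewrite mulr_ge0 ?divr_ge0 ?invr_ge0 ?sqrtr_ge0 ?(ltW (m0 l)) ?(ltW (md0 l)).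
  set a := Num.sqrt (m l) in s0 *; set b := Num.sqrt (m l + dl) in s1 *.
  have -> : m l / (m l + dl) = a ^+ 2 / b ^+ 2.
    by rewrite !sqr_sqrtr ?(ltW (m0 l)) ?(ltW (md0 l)).
  have -> : a^-1 * (a ^+ 2 / b ^+ 2) = a / b / b by field; rewrite !gt_eqF.
  rewrite -[leRHS]mul1r ler_pM2r ?invr_gt0 // ler_pdivrMr // mul1r.
  by rewrite ler_wsqrtr // lerDl ltW.
apply: (le_trans (y := P * (1 - \sum_l dl / (m l + dl)))); last first.
  by rewrite ler_wpM2l // ; exact: pB.
rewrite ler_pdivrMl //.
apply: (le_trans (ler_sum _ (fun i _ => term i))).
rewrite -[leLHS]mulr_sumr [leRHS]mulrCA ler_wpM2l //.
rewrite sumrB sumr_const card_ord mulrBr mulr1 lerD2l lerN2.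
rewrite [leLHS]mulr_sumr; apply: ler_sum => l _.
have -> : d%:R * (dl / (m l + dl)) = (4 * (m l + dl))^-1.
  by rewrite /dl; field; rewrite !gt_eqF //= addr_gt0 // ?mulr_gt0.
rewrite lef_pV2 ?posrE ?mulr_gt0 ?addr_gt0 //.
by have := m1 l; have := dl0; nra.
Qed.

(** The orders [k l] are general because averaging over the two signs of a first step along [i]
    convolves the [i]-th kernel once more and leaves the others alone. With all orders 0 the product
    is the indicator of a point. *)
Lemma Ex_prod_kernel1 n (k : 'I_d -> nat) (x : 'rV[int]_d) :
  Ex n (fun w => \prod_l kernel1 R (k l) ((x + pos w) ord0 l)) <=
  \prod_l (Num.sqrt ((k l).+1%:R + n%:R * (4 * d%:R)^-1))^-1.
Proof.
elim: n k x => [|n IH] k x /=.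
  apply: ler_prod => l _; rewrite kernel1_ge0 /= mul0r addr0.
  exact: kernel1_le.
have dR : 0 < d%:R :> R by rewrite ltr0n.
pose G i := Ex n (fun w =>
  \prod_l kernel1 R (k l + (i == l))%N ((x + pos w) ord0 l)).
have -> : avg (fun s => Ex n (fun w =>
    \prod_l kernel1 R (k l) ((x + pos (s :: w)) ord0 l))) =
    d%:R^-1 * \sum_i G i.
  rewrite avg_coord; congr (_ * _).
  apply: eq_bigr => i _; rewrite -ExD -ExZ /G.
  apply: eq_Ex => w _.
  rewrite (bigD1 i) //= [\prod_l _ in X in _ + X](bigD1 i) //=.
  rewrite [RHS](bigD1 i) //= eqxx addn1 /=.
  have vecE b : (x + pos ((i, b) :: w)) ord0 i =
      (x + pos w) ord0 i + (-1) ^+ b.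
    by rewrite pos_cons !mxE /= eqxx addrAC addrA.
  have off b : \prod_(l < d | l != i) kernel1 R (k l)
       ((x + pos ((i, b) :: w)) ord0 l) =
      \prod_(l < d | l != i) kernel1 R (k l + (i == l))
       ((x + pos w) ord0 l).
    apply: eq_bigr => l li; rewrite eq_sym (negPf li) addn0 pos_cons !mxE /=.
    by rewrite eq_sym (negPf li) add0r.
  rewrite !off !vecE /= expr1 expr0 -mulrDl mulrA; congr (_ * _).
  by rewrite mulrC.
apply: (le_trans (y := d%:R^-1 * \sum_i \prod_l (Num.sqrt
     ((k l).+1%:R + n%:R * (4 * d%:R)^-1 + (i == l)%:R))^-1)).
  rewrite ler_wpM2l ?invr_ge0 // ler_sum // => i _; apply: (le_trans (IH _ _)).
  rewrite le_eqVlt; apply/orP; left; apply/eqP; apply: eq_bigr => l _.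
  by rewrite -addSn natrD addrAC.
have m1 l : 1 <= (k l).+1%:R + n%:R * (4 * d%:R)^-1 :> R.
  by apply: (le_trans (y := (k l).+1%:R)); rewrite ?ler1n // lerDl divr_ge0 // mulr_ge0.
apply: (le_trans (avg_prod_invsqrt m1)).
rewrite le_eqVlt; apply/orP; left; apply/eqP; apply: eq_bigr => l _.
by rewrite -addrA -[n.+1%:R]natr1 (mulrDl n%:R 1) mul1r.
Qed.

Definition kap : R := Num.sqrt (4 * d%:R) ^+ d.

Lemma kap_ge1 : 1 <= kap.
Proof.
apply: exprn_ege1; rewrite -[leLHS]sqrtr1 ler_wsqrtr //.
by have : 1 <= d%:R :> R; [rewrite ler1n | move=> ?; lra].
Qed.

Lemma heat_kernel n (y : 'rV[int]_d) :
  Pr R n (fun w => pos w == y) <= kap / Num.sqrt n.+1%:R ^+ d.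
Proof.
have dR : 0 < d%:R :> R by rewrite ltr0n.
rewrite /Pr (eq_Ex (g := fun w =>
   \prod_l kernel1 R 0 ((- y + pos w) ord0 l))); last first.
  move=> w _ /=; have [->|ne] := eqVneq (pos w) y.
    by rewrite big1 // => l _; rewrite addNr mxE.
  have [l /eqP nl] : exists l, (- y + pos w) ord0 l != 0.
    apply/existsP; apply: contraR ne => /existsPn H.
    apply/eqP/rowP => l; have := H l; rewrite negbK !mxE => /eqP E.
    by apply/eqP; rewrite -subr_eq0 addrC E.
  by rewrite (bigD1 l) //= (negPf (introN eqP nl)) mul0r.
apply: (le_trans (Ex_prod_kernel1 _ (fun=> 0%N) _)).
rewrite prodr_const card_ord /kap -exprVn -exprMn.
have s0 : 0 < Num.sqrt (1 + n%:R * (4 * d%:R)^-1) :> R.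
  by rewrite sqrtr_gt0 ltr_pwDl // mulr_ge0 // invr_ge0 mulr_ge0.
apply: lerXn2r; rewrite ?nnegrE ?mulr_ge0 ?invr_ge0 ?sqrtr_ge0 //.
have s1 : 0 < Num.sqrt n.+1%:R :> R by rewrite sqrtr_gt0.
rewrite ler_pdivlMr // mulrC ler_pdivrMr // -sqrtrM ?mulr_ge0 // ler_wsqrtr //.
rewrite mulrDr mulr1 mulrCA mulfV ?mulr1; last by rewrite gt_eqF // mulr_gt0.
rewrite -natr1 [leRHS]addrC lerD2l.
by have : 1 <= d%:R :> R; [rewrite ler1n | move=> ?; lra].
Qed.

End heat_kernel.

(** * Green functions *)

Section green_bounds.
Variables (R : realType) (d : nat).
Hypothesis d3 : (3 <= d)%N.
Local Notation kap := (kap R d).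
Local Notation point := 'rV[int]_d.
Let d0 : (0 < d)%N. Proof. exact: leq_trans d3. Qed.

Lemma Ex_le_heat n (f : point -> R) c (U : seq point) p : 0 <= c ->
  (forall x, f x <= c * (count_mem x U)%:R) ->
  Ex n (fun w => f (pos (p ++ w))) <=
  c * (size U)%:R * (kap / Num.sqrt n.+1%:R ^+ d).
Proof.
move=> c0 fU.
apply: (le_trans (y := Ex n (fun w => c * \sum_(u <- U) (pos w == u - pos p)%:R))).
  apply: le_Ex => w _; apply: (le_trans (fU _)); rewrite ler_wpM2l //.
  rewrite -sum1_count natr_sum big_mkcond /= ler_sum // => u _.
  by rewrite [pos w == _]eq_sym subr_eq pos_cat addrC; case: (u == _).
rewrite ExZ -mulrA ler_wpM2l // Ex_sum //.
apply: (le_trans (y := \sum_(u <- U) kap / Num.sqrt n.+1%:R ^+ d)).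
  by apply: ler_sum => u _; exact: heat_kernel.
by rewrite big_const_seq count_predT iter_addr_0 mulr_natl.
Qed.

(** A telescoping bound, once sharpened by minus twice the inverse root of the last index.
    Convergence at the exponent 3/2 is how transience enters. *)
Lemma sum_invsqrt3 K :
  \sum_(1 <= i < K) (Num.sqrt (i%:R : R))^-1 ^+ 3 <= 3.
Proof.
case: K => [|[|K]]; try by rewrite big_geq.
suff H : \sum_(1 <= i < K.+2) (Num.sqrt (i%:R : R))^-1 ^+ 3 <=
    3 - 2 / Num.sqrt K.+1%:R.
  apply: (le_trans H); rewrite gerBl divr_ge0 ?sqrtr_ge0 //.
elim: K => [|K IH].
  rewrite big_nat1 sqrtr1 invr1 expr1n; lra.
rewrite big_nat_recr //=; apply: (le_trans (lerD IH (lexx _))).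
set a := Num.sqrt K.+1%:R; set b := Num.sqrt K.+2%:R.
have a0 : 0 < a :> R by rewrite sqrtr_gt0.
have b0 : 0 < b :> R by rewrite sqrtr_gt0.
have ab : b ^+ 2 = a ^+ 2 + 1 by rewrite !sqr_sqrtr // natr1.
have aleb : a <= b by rewrite ler_wsqrtr // ler_nat.
rewrite -subr_ge0.
have -> : 3 - 2 / b - (3 - 2 / a + b^-1 ^+ 3) =
    (2 * b ^+ 2 * (b - a) - a) / (a * b ^+ 3).
  by field; rewrite !gt_eqF.
rewrite divr_ge0 ?mulr_ge0 ?exprn_ge0 ?(ltW a0) ?(ltW b0) //.
rewrite subr_ge0 -(ler_pM2r (addr_gt0 a0 b0)).
have -> : 2 * b ^+ 2 * (b - a) * (a + b) = 2 * b ^+ 2 * (b ^+ 2 - a ^+ 2) by ring.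
rewrite ab addrAC subrr add0r mulr1.
rewrite !expr2; have := mulr_gt0 a0 b0; nra.
Qed.

Lemma sqrt_natM (a b : nat) : Num.sqrt ((a * b ^ 2)%N%:R : R) =
  Num.sqrt a%:R * b%:R.
Proof. by rewrite natrM natrX sqrtrM // sqrtr_sqr ger0_norm. Qed.

(** After [i] blocks of at least [h^2] steps the heat kernel is at most [kap / (h sqrt i)^d]. A mass
    of at most [h^d] cancels the power of [h], and the rest is summed as [i^(-3/2)]. The bound is
    free of the scale, so that a single [lam0] serves all scales. *)
Lemma green_skeleton (f : point -> R) c U h B K p : (0 < h)%N ->
  (h ^ 2 <= B)%N -> (forall x, f x <= 1) -> 0 <= c ->
  (forall x, f x <= c * (count_mem x U)%:R) ->
  c * (size U)%:R <= (h ^ d)%:R ->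
  green f B K p <= 1 + 3 * kap.
Proof.
move=> h0 hB f1 c0 fU cU.
have k1 := kap_ge1 R d0; have k0 : 0 <= kap by apply: le_trans k1.
rewrite /green; case: K => [|K]; first by rewrite big_nil addr_ge0 ?mulr_ge0.
rewrite big_nat_recl // lerD //; first by apply: Ex_le_cst => // w _.
apply: (le_trans (y := \sum_(0 <= i < K) kap * (Num.sqrt (i.+1%:R : R))^-1 ^+ 3)).
  apply: ler_sum => i _; apply: (le_trans (Ex_le_heat _ _ c0 fU)).
  apply: (le_trans (ler_wpM2r _ cU)); first by rewrite divr_ge0 ?exprn_ge0 ?sqrtr_ge0.
  rewrite mulrCA ler_wpM2l // natrX -expr_div_n.
  have s0 : 0 < Num.sqrt i.+1%:R :> R by rewrite sqrtr_gt0.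
  have sB : Num.sqrt (i.+1%:R : R) * h%:R <= Num.sqrt (i.+1 * B).+1%:R.
    rewrite -sqrt_natM ler_wsqrtr // ler_nat.
    by apply: leq_trans (leqnSn _); rewrite leq_mul2l hB orbT.
  have hR : 0 < h%:R :> R by rewrite ltr0n.
  have q1 : h%:R / Num.sqrt (i.+1 * B).+1%:R <= (Num.sqrt (i.+1%:R : R))^-1.
    by rewrite ler_pdivrMr ?sqrtr_gt0 // ler_pdivlMl.
  apply: (le_trans (y := (Num.sqrt (i.+1%:R : R))^-1 ^+ d)).
    by apply: lerXn2r; rewrite ?nnegrE ?divr_ge0 ?invr_ge0 ?sqrtr_ge0.
  apply: ler_wiXn2l d3; first by rewrite invr_ge0 sqrtr_ge0.
  by rewrite invf_le1 // -[leLHS]sqrtr1 ler_wsqrtr // ler1n.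
rewrite -mulr_sumr mulrC ler_wpM2r //.
have := sum_invsqrt3 K.+1; rewrite big_add1; exact.
Qed.

Lemma sum_nat_blocks (V : nmodType) (F : nat -> V) B K :
  \sum_(0 <= i < K * B) F i = \sum_(0 <= i < K) \sum_(0 <= m < B) F (i * B + m)%N.
Proof.
elim: K => [|K IH]; first by rewrite mul0n !big_geq.
rewrite big_nat_recr //= -IH mulSn addnC.
rewrite (@big_cat_nat _ _ _ (K * B)) ?leq_addr //=; congr (_ + _).
by rewrite -{1}[(K * B)%N]add0n big_addn addnC addnK; apply: eq_bigr => i _; rewrite addnC.
Qed.

Lemma green_nonneg_widen (f : point -> R) B K K' p : (K <= K')%N ->
  (forall x, 0 <= f x) -> green f B K p <= green f B K' p.
Proof.
move=> KK f0; rewrite /green (@big_cat_nat _ _ _ K 0 K') //=.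
by rewrite lerDl sumr_ge0 // => i _; apply: Ex_ge0.
Qed.

(** Times are sorted by their residue modulo [h^2]: each of the [h^2] classes is a skeleton entered
    after [r] free steps and contributes at most [1 + 3 kap]. *)
Lemma green_set (U : seq point) h K p : (0 < h)%N -> uniq U ->
  (size U <= h ^ d)%N ->
  green (fun x => (x \in U)%:R) 1 K p <= (h ^ 2)%:R * (1 + 3 * kap) :> R.
Proof.
move=> h0 uU sU; set f := fun x => _.
have h20 : (0 < h ^ 2)%N by rewrite expn_gt0 h0.
apply: (le_trans (@green_nonneg_widen f 1 K (K * h ^ 2) p _ _)).
- by rewrite leq_pmulr.
- by move=> x; rewrite /f.
rewrite /green sum_nat_blocks exchange_big /=.
apply: (le_trans (y := \sum_(0 <= r < h ^ 2) (1 + 3 * kap))); last first.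
  by rewrite big_const_nat subn0 iter_addr_0 [leRHS]mulr_natl.
apply: ler_sum => r _.
rewrite (eq_bigr (fun i => Ex r (fun u => Ex (i * h ^ 2) (fun w =>
   f (pos ((p ++ u) ++ w)))))); last first.
  move=> i _; rewrite muln1 addnC Ex_cat; apply: eq_Ex => u _.
  by apply: eq_Ex => w _; rewrite catA.
rewrite -Ex_sum //; apply: Ex_le_cst => // u _.
apply: (@green_skeleton f 1 U h (h ^ 2) K (p ++ u)) => //.
- by move=> x; rewrite /f; case: (x \in U).
- by move=> x; rewrite /f mul1r ler_nat count_uniq_mem.
- by rewrite mul1r ler_nat.
Qed.

Definition inbox (r : nat) (x : point) : bool := [forall i, (`|x ord0 i| <= r)%N].

Definition box (r : nat) : seq point :=
  [seq \row_i ((f i : nat)%:Z - r%:Z) | f : {ffun 'I_d -> 'I_(2 * r).+1}].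

Lemma size_box r : size (box r) = ((2 * r).+1 ^ d)%N.
Proof. by rewrite size_map -cardE card_ffun !card_ord. Qed.

Lemma mem_box r x : inbox r x -> x \in box r.
Proof.
clear d0 d3; move=> /forallP xr; apply/mapP.
exists [ffun i => inord (absz (x ord0 i + r%:Z))]; first by rewrite mem_enum.
apply/rowP => i; rewrite !mxE ffunE inordK; last by have := xr i; lia.
by rewrite -[x 0 i]/(x ord0 i); have := xr i; lia.
Qed.

Lemma Ex_expR_coord n (i : 'I_d) (lam : R) : `|lam| <= 1 / 2 ->
  Ex n (fun w => expR (lam * (pos w ord0 i)%:~R)) <= expR (2 * lam ^+ 2 * n%:R).
Proof.
rewrite ler_norml => /andP[l1 l2]; elim: n => [|n IH].
  by rewrite /= pos_nil mxE !mulr0 lexx.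
rewrite /= -[n.+1%:R]natr1 (mulrDr (2 * lam ^+ 2)) mulr1 [in leRHS]addrC expRD.
pose E := Ex n (fun w => expR (lam * (pos w ord0 i)%:~R)).
have E0 : 0 <= E by apply: Ex_ge0 => // w _; exact: expR_ge0.
rewrite (@eq_avg _ _ _ (fun s => E * expR (lam * (vec s ord0 i)%:~R))); last first.
  move=> s; rewrite mulrC -ExZ; apply: eq_Ex => w _.
  by rewrite pos_cons mxE intrD mulrDr expRD.
rewrite avgZ mulrC; apply: ler_pM => //.
  by rewrite -[0](@avg_cst R d 0) //; apply: le_avg => s; exact: expR_ge0.
apply: (le_trans (y := avg (fun _ : step d => 1 + 2 * lam ^+ 2))); last first.
  by rewrite avg_cst // expR_ge1Dx.
rewrite !avg_coord // ler_wpM2l ?invr_ge0 // ler_sum // => j _.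
rewrite ler_wpM2l ?invr_ge0 // !mxE /=; case: (j == i) => /=; last first.
  by rewrite mulr0 expR0; have := sqr_ge0 lam; lra.
rewrite expr0 expr1 mulrN1 mulr1.
have lp := expR_le_quad l2; have lm : - lam <= 1 / 2 by lra.
by have := expR_le_quad lm; rewrite sqrrN; lra.
Qed.

(** Chernoff's bound with parameter [1/(2h)]: over at most [2 h^2] steps the exponential moment
    stays below [expR 1], and the [2 d] signed directions give the prefactor. *)
Lemma Pr_outbox n h r : (0 < h)%N -> (n <= 2 * h ^ 2)%N ->
  Pr R n (fun w => ~~ inbox r (pos w)) <=
  2 * d%:R * expR (1 - r%:R / (2 * h%:R)).
Proof.
move=> h0 nh; have hR : 0 < h%:R :> R by rewrite ltr0n.
pose lam (b : bool) : R := (-1) ^+ b / (2 * h%:R).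
have lam1 b : `|lam b| <= 1 / 2.
  rewrite /lam normrM normrX normrN1 expr1n mul1r ger0_norm; last first.
    by rewrite invr_ge0 mulr_ge0.
  rewrite invfM -[leRHS]mulr1 mul1r ler_wpM2l ?invr_ge0 // invf_le1 // ler1n //.
apply: (le_trans (y := Pr R n (fun w => has (fun s : step d =>
    r%:R / (2 * h%:R) <= lam s.2 * (pos w ord0 s.1)%:~R) (index_enum _)))).
  apply: le_Pr => // w _ /forallPn[i]; rewrite -ltnNge => ir.
  apply/hasP; exists (i, (pos w ord0 i < 0)) => //=; first exact: mem_index_enum.
  rewrite /lam mulrAC ler_wpM2r ?invr_ge0 ?mulr_ge0 //.
  move: ir; case: ltrP => [xn|xp] ir.
    rewrite expr1 mulN1r -intrN -[r%:R]/((r%:Z)%:~R) ler_int; lia.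
  rewrite expr0 mul1r -[r%:R]/((r%:Z)%:~R) ler_int; lia.
pose A (s : step d) (w : seq (step d)) :=
  r%:R / (2 * h%:R) <= lam s.2 * (pos w ord0 s.1)%:~R.
apply: (le_trans (@Pr_has R d d0 n _ (index_enum _) A)).
apply: (le_trans (y := \sum_(s : step d) expR (1 - r%:R / (2 * h%:R)))).
  apply: ler_sum => s _; apply: (le_trans (Pr_expR _ _ _)) => //.
  rewrite addrC expRD ler_wpM2l ?expR_ge0 //.
  apply: (le_trans (Ex_expR_coord n s.1 (lam1 s.2))); rewrite ler_expR.
  rewrite /lam expr_div_n sqrr_sign mul1r exprMn.
  have -> : 2 * (2 ^+ 2 * h%:R ^+ 2)^-1 * n%:R = n%:R / (2 * h%:R ^+ 2) :> R.
    by field; rewrite gt_eqF.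
  rewrite ler_pdivrMr ?mulr_gt0 ?exprn_gt0 // mul1r -natrX -natrM ler_nat //.
rewrite sumr_const card_prod card_ord card_bool -[leLHS]mulr_natl natrM.
by rewrite [d%:R * _]mulrC.
Qed.

End green_bounds.

(** * Occupation functionals *)

Section trails.
Variable d : nat.
Local Notation point := 'rV[int]_d.
Local Notation word := (seq (step d)).

(** The endpoint of the path is left out, in accordance with the sum over [k < n] in
    [local_time]. *)
Fixpoint trail (x : point) (w : word) : seq point :=
  if w is s :: w' then x :: trail (x + vec s) w' else [::].

Lemma size_trail x w : size (trail x w) = size w.
Proof. by elim: w x => [//|s w IH] x /=; rewrite IH. Qed.

Lemma trail_cat x v w : trail x (v ++ w) = trail x v ++ trail (x + pos v) w.
Proof.
elim: v x => [|s v IH] x /=; first by rewrite pos_nil addr0.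
by rewrite IH pos_cons addrA.
Qed.

Lemma trail_shift x w : trail x w = [seq x + z | z <- trail 0 w].
Proof.
elim: w x => [//|s w IH] x /=; rewrite addr0 add0r (IH (x + _)) (IH (vec s)).
by rewrite -map_comp; congr (_ :: _); apply: eq_map => z /=; rewrite addrA.
Qed.

Lemma trail_take x m w : trail x (take m w) = take m (trail x w).
Proof.
elim: w x m => [|s w IH] x [|m] //=; by rewrite IH.
Qed.

Lemma trail_drop m w : trail (pos (take m w)) (drop m w) = drop m (trail 0 w).
Proof.
rewrite -[w in RHS](cat_take_drop m) trail_cat add0r drop_cat size_trail.
case: ltnP => mw; last first.
  have [E|lt] := leqP (size w) m; last by rewrite size_takel ?subnn ?drop0 // ltnW.
  by rewrite drop_oversize //= drop_nil.
by rewrite [drop m (trail _ _)]drop_oversize // size_trail size_take_min geq_minl.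
Qed.

Lemma inbox_trail w z : z \in trail 0 w -> inbox (size w) z.
Proof.
suff H x r : inbox r x -> z \in trail x w -> inbox (r + size w) z.
  by apply: (H 0 0%N); apply/forallP => i; rewrite mxE.
elim: w x r => [//|s w IH] x r xr /=; rewrite in_cons => /predU1P[->|].
  by apply/forallP => i; have /forallP/(_ i) := xr; lia.
rewrite addnS -addSn; apply: IH; apply/forallP => i.
have := forallP xr i; rewrite !mxE.
case: (s.1 == i).
  by case: s.2; rewrite /= ?expr1 ?expr0; lia.
by rewrite addr0 => /leqW.
Qed.

End trails.

Section occupation.
Variables (R : realType) (T : choiceType).
Implicit Types (s : seq T) (phi : nat -> R).

Definition occ phi s : R := \sum_(z <- undup s) phi (count_mem z s).

Lemma occ_wide phi s Z : phi 0%N = 0 -> uniq Z -> {subset s <= Z} ->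
  occ phi s = \sum_(z <- Z) phi (count_mem z s).
Proof.
move=> phi0 uZ sZ; rewrite /occ [RHS](bigID (mem s)) /=.
rewrite [X in _ = _ + X]big1 ?addr0; last first.
  by move=> z zs; rewrite (count_memPn zs).
rewrite -[RHS]big_filter; apply: perm_big; apply: uniq_perm.
- exact: undup_uniq.
- exact: filter_uniq.
by move=> z; rewrite mem_undup mem_filter; case: (boolP (z \in s)) => // /sZ ->.
Qed.

Lemma occ_cons phi x s : phi 0%N = 0 -> occ phi (x :: s) =
  phi (count_mem x s).+1 - phi (count_mem x s) + occ phi s.
Proof.
move=> phi0; set Z := undup (x :: s).
have uZ : uniq Z by exact: undup_uniq.
have sZ : {subset s <= Z} by move=> z zs; rewrite mem_undup in_cons zs orbT.
have xZ : x \in Z by rewrite mem_undup mem_head.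
rewrite (occ_wide phi0 uZ sZ) {1}/occ -/Z.
rewrite !(perm_big _ (perm_to_rem xZ)) /= !big_cons /= eqxx add1n.
have -> : \sum_(z <- rem x Z) phi ((x == z) + count_mem z s)%N =
          \sum_(z <- rem x Z) phi (count_mem z s).
  rewrite !big_seq; apply: eq_bigr => z; rewrite mem_rem_uniq // inE.
  by case/andP => zx _; rewrite eq_sym (negPf zx).
by rewrite addrA subrK.
Qed.

Lemma occ_perm phi s s' : perm_eq s s' -> occ phi s = occ phi s'.
Proof.
move=> ss'; rewrite /occ (perm_big _ (perm_undup (perm_mem ss'))).
by apply: eq_bigr => z _; congr phi; exact/permP.
Qed.

Lemma occ_rcons phi s x : phi 0%N = 0 -> occ phi (rcons s x) =
  phi (count_mem x s).+1 - phi (count_mem x s) + occ phi s.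
Proof. by move=> phi0; rewrite (occ_perm _ (permEl (perm_rcons _ _))) occ_cons. Qed.

Lemma occ_past phi s x0 : phi 0%N = 0 -> occ phi s =
  \sum_(0 <= k < size s)
    (phi (count_mem (nth x0 s k) (take k s)).+1 -
     phi (count_mem (nth x0 s k) (take k s))).
Proof.
move=> phi0; elim/last_ind: s => [|s x IH]; first by rewrite /occ /= !big_nil.
rewrite occ_rcons // IH size_rcons big_nat_recr //= addrC; congr (_ + _).
  by rewrite nth_rcons ltnn eqxx -cats1 take_size_cat.
rewrite !big_nat; apply: eq_bigr => k /andP[_ ks].
by rewrite nth_rcons ks -cats1 take_cat ks.
Qed.

Lemma le_occ phi psi s : (forall l, phi l <= psi l) -> occ phi s <= occ psi s.
Proof. by move=> H; apply: ler_sum. Qed.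

Lemma occ_ge0 phi s : (forall l, 0 <= phi l) -> 0 <= occ phi s.
Proof. by move=> H; apply: sumr_ge0. Qed.

Lemma sum_count_size s Z : uniq Z -> {subset s <= Z} ->
  (\sum_(z <- Z) count_mem z s = size s)%N.
Proof.
move=> uZ; elim: s => [_|x s IH sZ]; first by rewrite big1.
rewrite /= big_split /= IH; last by move=> z zs; rewrite sZ // in_cons zs orbT.
rewrite (bigD1_seq x) ?sZ ?mem_head //= eqxx big1 ?addn0 //.
by move=> z zx; rewrite eq_sym (negPf zx).
Qed.

Definition excess t s : R := occ (fun l => (l - t)%N%:R) s.

Definition heavy u s : seq T := [seq z <- undup s | (u <= count_mem z s)%N].

(** For [(l - t)_+] the increment is an indicator. The excess becomes a count of times at which the
    walk stands on a site already seen [t] times, and such a count can be conditioned on the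
    past. *)
Lemma excess_past t s x0 : excess t s =
  \sum_(0 <= k < size s) (t <= count_mem (nth x0 s k) (take k s))%N%:R.
Proof.
rewrite /excess (occ_past _ x0) ?sub0n //; apply: eq_bigr => k _.
move: (count_mem _ _) => c; case: (leqP t c) => tc.
  by rewrite -natrB ?leq_sub2r //; congr (_%:R); lia.
have -> : (c.+1 - t = 0)%N by lia.
have -> : (c - t = 0)%N by lia.
by rewrite subrr.
Qed.

Lemma excess_le_size t s : excess t s <= (size s)%:R.
Proof.
apply: (le_trans (y := \sum_(z <- undup s) (count_mem z s)%:R)).
  by apply: ler_sum => z _; rewrite ler_nat leq_subr.
by rewrite -natr_sum sum_count_size ?undup_uniq // => z; rewrite mem_undup.
Qed.

Lemma heavy_excess t u s : (t <= u)%N ->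
  ((u - t) * size (heavy u s))%N%:R <= excess t s.
Proof.
move=> tu; rewrite size_filter -sum1_count big_distrr /= natr_sum big_mkcond.
apply: ler_sum => z _; case: ifP => // uz.
by rewrite muln1 ler_nat leq_sub2r.
Qed.

Lemma heavy_uniq u s : uniq (heavy u s).
Proof. by rewrite filter_uniq ?undup_uniq. Qed.

Lemma mem_heavy u s z : (0 < u)%N ->
  (z \in heavy u s) = (u <= count_mem z s)%N.
Proof.
move=> u0; rewrite mem_filter mem_undup; case: (boolP (z \in s)) => zs.
  by rewrite andbT.
by rewrite andbF (count_memPn zs) leqn0; case: u u0.
Qed.

Lemma leq_count_take z m s : (count_mem z (take m s) <= count_mem z s)%N.
Proof. by rewrite -[s in leqRHS](cat_take_drop m) count_cat leq_addr. Qed.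

Lemma heavy_take u m s : (0 < u)%N ->
  {subset heavy u (take m s) <= heavy u s}.
Proof.
by move=> u0 z; rewrite !mem_heavy // => /leq_trans; apply; exact: leq_count_take.
Qed.

(** The past is cut at the start of the block before the one containing [k], hence between [B] and
    [2 B] steps earlier. Sites heavy before the cut form a set that is fixed during at least [B]
    further steps. In the first block the truncated predecessor puts the cut at time 0. *)
Definition visits_old B u s x0 : R := \sum_(0 <= k < size s)
  (u <= count_mem (nth x0 s k) (take ((k %/ B).-1 * B) s))%N%:R.

Definition visits_new B u s x0 : R := \sum_(0 <= k < size s)
  (u <= count_mem (nth x0 s k) (drop ((k %/ B).-1 * B) (take k s)))%N%:R.

(** Of [2 u] earlier visits, at least [u] lie on one side of the cut. *)
Lemma excess_old_new B u s x0 :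
  excess (2 * u) s <= visits_old B u s x0 + visits_new B u s x0.
Proof.
rewrite (excess_past _ _ x0) -big_split /=; apply: ler_sum => k _.
rewrite -natrD ler_nat.
set m := ((k %/ B).-1 * B)%N; set z := nth x0 s k.
have mk : (m <= k)%N.
  by apply: leq_trans (leq_trunc_div k B); rewrite leq_mul2r leq_pred orbT.
have -> : count_mem z (take k s) =
    (count_mem z (take m s) + count_mem z (drop m (take k s)))%N.
  by rewrite -[in LHS](cat_take_drop m (take k s)) count_cat take_takel.
move: (count_mem z (take m s)) (count_mem z (drop m _)) => a b.
by case: (leqP (2 * u) (a + b)); case: (leqP u a); case: (leqP u b); lia.
Qed.

End occupation.

(** * Time split into two interlaced chains of double blocks *)

Section two_chains.
Variables (R : realType) (d : nat).
Local Notation point := 'rV[int]_d.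
Local Notation word := (seq (step d)).

(* The last half of a block of length [2 * B], against the path before it. *)
Definition old_frac B u (q b : word) : R :=
  (count (fun z => u <= count_mem z (trail 0%R q))%N
    (drop B (trail (pos q) b)))%:R / (2 * B)%:R.

(** The divisor keeps the value at most 1/2 on blocks of length [2 B], as [Ex_expR_center]
    requires. *)
Definition new_frac B u (q b : word) : R :=
  excess R u (trail (pos q) b) / (4 * B)%:R.

Lemma sum_nat_shift (X : nat -> R) a b :
  \sum_(a <= k < a + b) X k = \sum_(0 <= m < b) X (a + m)%N.
Proof.
by rewrite -{1}[a]add0n big_addn addKn; apply: eq_bigr => i _; rewrite addnC.
Qed.

(** Only the second half of a double block is far enough from its start. The double blocks starting
    at 0 thus serve one half of the time and those shifted by [B] the other; within each family the
    blocks are disjoint, so that exponential moments can be taken block after block. *)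
Lemma sum_two_chains (X : nat -> R) B K :
  \sum_(0 <= k < B + K * (2 * B)) X k = \sum_(0 <= k < B) X k +
  (\sum_(0 <= i < K) \sum_(0 <= m < B) X (i * (2 * B) + B + m)%N +
   \sum_(0 <= i < K) \sum_(0 <= m < B) X (B + i * (2 * B) + B + m)%N).
Proof.
elim: K => [|K IH]; first by rewrite mul0n addn0 ![\sum_(0 <= i < 0) _]big_geq // !addr0.
have split2 (a : nat) : \sum_(0 <= k < a + 2 * B) X k = \sum_(0 <= k < a) X k +
    (\sum_(0 <= m < B) X (a + m)%N + \sum_(0 <= m < B) X (a + B + m)%N).
  rewrite mul2n -addnn addnA (@big_cat_nat _ _ _ (a + B)) ?leq_addr //=.
  rewrite (@big_cat_nat _ _ _ a) ?leq_addr //= -addrA; congr (_ + (_ + _)).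
    exact: sum_nat_shift.
  exact: sum_nat_shift.
rewrite mulSn addnCA addnC split2 IH !big_nat_recr //=.
rewrite [(B + K * (2 * B))%N]addnC.
move: (\sum_(0 <= k < B) X k) (\sum_(0 <= i < K) _) (\sum_(0 <= i < K) _).
move: (\sum_(0 <= m < B) _) (\sum_(0 <= m < B) _) => a b x y z; lra.
Qed.

Lemma count_sum (T : Type) (P : pred T) s x0 :
  (count P s)%:R = \sum_(0 <= m < size s) (P (nth x0 s m))%:R :> R.
Proof.
rewrite -sum1_count natr_sum big_mkcond /= (big_nth x0).
by apply: eq_bigr => m _; case: (P _).
Qed.

Lemma block_start B c i m : (m < B)%N ->
  (((c * B + i * (2 * B) + B + m) %/ B).-1 * B = c * B + i * (2 * B))%N.
Proof.
move=> mB; have B0 : (0 < B)%N by apply: leq_ltn_trans mB.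
have -> : (c * B + i * (2 * B) + B + m = (c + 2 * i).+1 * B + m)%N by lia.
by rewrite divnMDl // divn_small // addn0 /=; lia.
Qed.

Lemma trail_block c B i (w : word) :
  let q := take c w ++ take i (drop c w) in
  trail 0 q = take (c + i) (trail 0 w) /\
  trail (pos q) (take B (drop i (drop c w))) =
    take B (drop (c + i) (trail 0 w)).
Proof.
have -> : take c w ++ take i (drop c w) = take (c + i) w by rewrite takeD.
rewrite /= trail_take; split=> //.
by rewrite drop_drop addnC trail_take trail_drop.
Qed.

Lemma nth_block (s : seq point) a B j : (j < B)%N ->
  nth 0 (take B (drop a s)) j = nth 0 s (a + j).
Proof. by move=> jB; rewrite nth_take // nth_drop. Qed.

Lemma old_chain c B K u (w : word) : (0 < B)%N ->
  (c * B + K * (2 * B) <= size w)%N ->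
  \sum_(0 <= i < K) \sum_(0 <= m < B)
    (u <= count_mem (nth 0%R (trail 0%R w) (c * B + i * (2 * B) + B + m))
       (take (((c * B + i * (2 * B) + B + m) %/ B).-1 * B) (trail 0%R w)))%N%:R =
  (2 * B)%:R * cs (2 * B) K (old_frac B u) (take (c * B) w) (drop (c * B) w).
Proof.
move=> B0 sw; rewrite csE mulr_sumr !big_nat; apply: eq_bigr => i /andP[_ iK].
have [E1 E2] := trail_block (c * B) (2 * B) (i * (2 * B)) w.
rewrite /old_frac E1 E2 mulrC divfK; last by rewrite pnatr_eq0; lia.
set s := trail 0 w.
have szb : size (drop B (take (2 * B) (drop (c * B + i * (2 * B)) s))) = B.
  rewrite size_drop size_takel; first by lia.
  rewrite size_drop size_trail; have : (i.+1 * (2 * B) <= K * (2 * B))%N by rewrite leq_mul2r iK orbT.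
  lia.
rewrite (count_sum _ _ 0) szb !big_nat; apply: eq_bigr => m /andP[_ mB].
rewrite block_start // nth_drop nth_block ?addnA //.
by rewrite mul2n -addnn ltn_add2l.
Qed.

Lemma new_chain c B K u (w : word) : (0 < B)%N ->
  (c * B + K * (2 * B) <= size w)%N ->
  \sum_(0 <= i < K) \sum_(0 <= m < B)
    (u <= count_mem (nth 0%R (trail 0%R w) (c * B + i * (2 * B) + B + m))
       (drop (((c * B + i * (2 * B) + B + m) %/ B).-1 * B)
          (take (c * B + i * (2 * B) + B + m) (trail 0%R w))))%N%:R <=
  (4 * B)%:R * cs (2 * B) K (new_frac B u) (take (c * B) w) (drop (c * B) w).
Proof.
move=> B0 sw; rewrite csE mulr_sumr !big_nat; apply: ler_sum => i /andP[_ iK].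
have [E1 E2] := trail_block (c * B) (2 * B) (i * (2 * B)) w.
rewrite /new_frac E2 mulrC divfK; last by rewrite pnatr_eq0; lia.
set s := trail 0 w; set a := (c * B + i * (2 * B))%N.
have szb : size (take (2 * B) (drop a s)) = (B + B)%N.
  rewrite size_takel; first by lia.
  rewrite size_drop size_trail; have : (i.+1 * (2 * B) <= K * (2 * B))%N by rewrite leq_mul2r iK orbT.
  rewrite /a; lia.
rewrite (excess_past _ _ _ 0) szb [leRHS](@big_cat_nat _ _ _ B) ?leq_addr //=.
rewrite -[leLHS]add0r lerD //; first by apply: sumr_ge0 => k _; exact: ler0n.
rewrite [leRHS]sum_nat_shift !big_nat; apply: ler_sum => m /andP[_ mB].
rewrite block_start // -/a nth_block; last by rewrite mul2n -addnn ltn_add2l.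
have -> : drop a (take (a + B + m) s) = take (B + m) (drop a s).
  by rewrite take_drop; congr (drop _ (take _ _)); lia.
by rewrite take_takel ?addnA //; lia.
Qed.

Lemma visits_two_chains B u (w : word) K : (0 < B)%N ->
  (B + K * (2 * B) <= size w)%N ->
  let x := (B + (size w - (B + K * (2 * B))))%N%:R in
  visits_old R B u (trail 0 w) 0 <= x +
    (2 * B)%:R * (cs (2 * B) K (old_frac B u) [::] w +
                  cs (2 * B) K (old_frac B u) (take B w) (drop B w)) /\
  visits_new R B u (trail 0 w) 0 <= x +
    (4 * B)%:R * (cs (2 * B) K (new_frac B u) [::] w +
                  cs (2 * B) K (new_frac B u) (take B w) (drop B w)).
Proof.
move=> B0 sw /=.
have gen (X : nat -> bool) a b :
    \sum_(0 <= i < K) \sum_(0 <= m < B) (X (i * (2 * B) + B + m)%N)%:R <= a ->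
    \sum_(0 <= i < K) \sum_(0 <= m < B) (X (B + i * (2 * B) + B + m)%N)%:R <= b ->
    \sum_(0 <= k < size w) (X k)%:R <=
    (B + (size w - (B + K * (2 * B))))%N%:R + (a + b) :> R.
  move=> Ha Hb; rewrite (@big_cat_nat _ _ _ (B + K * (2 * B))) //=.
  rewrite (sum_two_chains (fun k => (X k)%:R)) addrAC lerD //; last exact: lerD.
  rewrite natrD lerD //.
    apply: (le_trans (y := \sum_(0 <= k < B) 1)).
      by apply: ler_sum => k _; case: (X k).
    by rewrite big_const_nat subn0 iter_addr_0.
  apply: (le_trans (y := \sum_(B + K * (2 * B) <= k < size w) 1)).
    by apply: ler_sum => k _; case: (X k).
  by rewrite big_const_nat iter_addr_0.
rewrite /visits_old /visits_new size_trail !mulrDr; split.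
  apply: (gen (fun k => (u <= count_mem (nth 0%R (trail 0%R w) k)
      (take ((k %/ B).-1 * B) (trail 0%R w)))%N)).
    have := @old_chain 0 B K u w B0; rewrite mul0n take0 drop0 => <- //.
    by apply: leq_trans sw; rewrite leq_addl.
  by have := @old_chain 1 B K u w B0; rewrite mul1n => <-.
apply: (gen (fun k => (u <= count_mem (nth 0%R (trail 0%R w) k)
    (drop ((k %/ B).-1 * B) (take k (trail 0%R w))))%N)).
  have := @new_chain 0 B K u w B0; rewrite mul0n take0 drop0; apply.
  by apply: leq_trans sw; rewrite leq_addl.
by have := @new_chain 1 B K u w B0; rewrite mul1n; apply.
Qed.

End two_chains.

(** * Conditional means of occupation functionals *)

Section occupation_means.
Variables (R : realType) (d : nat).
Hypothesis d3 : (3 <= d)%N.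
Local Notation kap := (kap R d).
Local Notation point := 'rV[int]_d.
Local Notation word := (seq (step d)).
Let d0 : (0 < d)%N. Proof. exact: leq_trans d3. Qed.

Lemma nth_trail x (w : word) m : (m < size w)%N ->
  nth 0 (trail x w) m = x + pos (take m w).
Proof.
elim: w x m => [//|s w IH] x [|m] /= mw; first by rewrite pos_nil addr0.
by rewrite IH // pos_cons addrA.
Qed.

Lemma cs1_trail (g : point -> R) p (w : word) :
  cs 1 (size w) (fun q _ => g (pos q)) p w = \sum_(z <- trail (pos p) w) g z.
Proof.
elim: w p => [|s w IH] p /=; first by rewrite big_nil.
by rewrite big_cons take0 drop0 IH pos_cat pos_cons pos_nil addr0.
Qed.

(** Makes [4 lam0] times the scale-free Green bound equal to 1, the borderline of the hypothesis of
    [khasminskii]. *)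
Definition lam0 : R := (4 * (1 + 3 * kap))^-1.

Let k1 : 1 <= kap. Proof. exact: kap_ge1. Qed.

Lemma lam0_gt0 : 0 < lam0.
Proof. by rewrite invr_gt0; have := k1; lra. Qed.

Lemma lam0_le : lam0 <= 1 / 2.
Proof.
rewrite /lam0 -div1r ler_pdivrMr; first by have := k1; lra.
by have := k1; lra.
Qed.

Lemma lam0E : 4 * lam0 * (1 + 3 * kap) = 1.
Proof. by rewrite /lam0; field; apply: lt0r_neq0; have := k1; lra. Qed.

Lemma Ex_expR_visits (U : seq point) (lam : R) n p : 0 <= lam <= 1 / 2 ->
  (forall q k, (k <= n)%N -> pos q \in U ->
     4 * lam * green (fun x => (x \in U)%:R) 1 k q <= 1) ->
  Ex n (fun w => expR (lam * (count (mem U) (trail (pos p) w))%:R)) <=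
  1 + 4 * lam * green (fun x => (x \in U)%:R) 1 n p.
Proof.
move=> lam12 HU; set f := fun x : point => (x \in U)%:R : R.
rewrite (eq_Ex (g := fun w =>
    expR (cs 1 n (fun q _ => lam * f (pos q)) p w))); last first.
  move=> w <-; rewrite (cs1_trail (fun x => lam * f x)) -mulr_sumr; congr (expR (_ * _)).
  rewrite -sum1_count natr_sum big_mkcond; apply: eq_bigr => z _.
  by rewrite /f -[mem U z]/(z \in U); case: (z \in U).
rewrite -[X in Ex X]muln1; apply: khasminskii => //.
  by move=> x; rewrite /f; case: (x \in U); rewrite ?lexx ler01.
move=> q k kn; rewrite /f => fq; apply: HU kn _.
by case: (boolP (pos q \in U)) fq => //; rewrite eqxx.
Qed.

Lemma Ex_expR_returns n (x : point) :
  Ex n (fun w => expR (lam0 * (count_mem x (trail x w))%:R)) <= 2.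
Proof.
rewrite (eq_Ex (g := fun w => expR (lam0 *
   (count (mem [:: 0]) (trail (pos [::]) w))%:R))); last first.
  move=> w _; rewrite trail_shift count_map pos_nil; congr (expR (_ * _%:R)).
  by apply: eq_count => z /=; rewrite inE -{2}[x]addr0 (inj_eq (addrI x)).
have G k q : green (fun x => (x \in [:: 0 : point])%:R) 1 k q <= 1 + 3 * kap.
  by apply: (le_trans (green_set R d3 (h := 1) _ _ _ _ _)); rewrite ?exp1n ?mul1r.
have l0 := lam0_gt0; have l2 := lam0_le; have lE := lam0E.
have H k q : 4 * lam0 * green (fun x => (x \in [:: 0 : point])%:R) 1 k q <= 1.
  by rewrite -[leRHS]lE ler_wpM2l //; lra.
apply: (le_trans (@Ex_expR_visits [:: 0] lam0 n [::] _ _)).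
- by lra.
- by move=> q k _ _; exact: H.
by have := H n [::]; lra.
Qed.

(** Reading the path from its start, the first position adds [phi (c+1) - phi c] with [c] the number
    of later returns to it, and returns have exponential moment at most 2. Summing over the starting
    times gives the factor [n]. *)
Lemma Ex_occ phi C n (x : point) : phi 0%N = 0 -> 0 <= C ->
  (forall c, phi c.+1 - phi c <= C * expR (lam0 * c%:R)) ->
  Ex n (fun w => occ phi (trail x w)) <= n%:R * (2 * C).
Proof.
move=> phi0 C0 phiC; elim: n x => [|n IH] x /=.
  by rewrite /occ big_nil mul0r.
rewrite -natr1 mulrDl mul1r addrC.
apply: (le_trans (y := Ex n.+1 (fun w => C * expR (lam0 * (count_mem x (trail x w))%:R)) +
   avg (fun s => Ex n (fun w => occ phi (trail (x + vec s) w))))); last first.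
  rewrite ExZ lerD //; first by rewrite mulrC ler_wpM2r // Ex_expR_returns.
  by rewrite -[leRHS](@avg_cst R d _ d0); apply: le_avg => s; exact: IH.
rewrite /= -avgD; apply: le_avg => s; rewrite -ExD; apply: le_Ex => w _.
rewrite occ_cons // lerD2r /= eqxx; apply: (le_trans (phiC _)).
by rewrite ler_wpM2l // ler_expR ler_wpM2l ?(ltW lam0_gt0) // ler_nat leq_addl.
Qed.

Lemma Ex_excess t n (x : point) :
  Ex n (fun w => excess R t (trail x w)) <= n%:R * (2 * expR (- (lam0 * t%:R))).
Proof.
apply: Ex_occ; rewrite ?sub0n ?expR_ge0 // => c.
rewrite -expRD; case: (leqP t c) => tc.
  rewrite -natrB ?leq_sub2r //; have -> : (c.+1 - t - (c - t) = 1)%N by lia.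
  rewrite -[1%:R]expR0 ler_expR addrC -mulrBr mulr_ge0 ?(ltW lam0_gt0) //.
  by rewrite subr_ge0 ler_nat.
have -> : (c.+1 - t = 0)%N by lia.
have -> : (c - t = 0)%N by lia.
by rewrite subrr expR_ge0.
Qed.

Lemma new_frac_bound B u q (b : word) : (0 < B)%N -> size b = (2 * B)%N ->
  0 <= new_frac R B u q b <= 1 / 2.
Proof.
move=> B0 sb; have BR : 0 < (4 * B)%:R :> R by rewrite ltr0n; lia.
rewrite /new_frac divr_ge0 ?occ_ge0 //= ler_pdivrMr //.
apply: (le_trans (excess_le_size _ _ _)); rewrite size_trail sb.
by rewrite mul1r natrM [in leRHS]natrM; lra.
Qed.

Lemma Ex_new_frac B u (q : word) : (0 < B)%N ->
  Ex (2 * B) (new_frac R B u q) <= expR (- (lam0 * u%:R)).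
Proof.
move=> B0; have BR : 0 < B%:R :> R by rewrite ltr0n.
rewrite /new_frac (eq_Ex (g := fun b => (4 * B)%:R^-1 * excess R u (trail (pos q) b)));
  last by move=> b _; rewrite mulrC.
rewrite ExZ ler_pdivrMl ?ltr0n; last by lia.
apply: (le_trans (Ex_excess _ _ _)); rewrite !natrM.
by rewrite le_eqVlt; apply/orP; left; apply/eqP; ring.
Qed.

Definition near_count (r : nat) (W : seq point) (x : point) : nat :=
  count (fun z => inbox r (z - x)) W.

Lemma old_frac_bound B u q (b : word) : (0 < B)%N -> size b = (2 * B)%N ->
  0 <= old_frac R B u q b <= 1 / 2.
Proof.
move=> B0 sb; have BR : 0 < (2 * B)%:R :> R by rewrite ltr0n; lia.
rewrite /old_frac divr_ge0 //= ler_pdivrMr // natrM mulrA mulfVK // mul1r ler_nat.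
apply: leq_trans (count_size _ _) _.
by rewrite size_drop size_trail sb; lia.
Qed.

(** Either the walk has left the box of radius [r] around its start, or it stands on one of the
    points of [W] in that box, each of which has probability at most [kap / h^d] after [h^2] steps
    or more. *)
Lemma Pr_near (W : seq point) h r m (p : word) : uniq W -> (0 < h)%N ->
  (h ^ 2 <= m)%N -> (m <= 2 * h ^ 2)%N ->
  Pr R m (fun w => pos (p ++ w) \in W) <=
  2 * d%:R * expR (1 - r%:R / (2 * h%:R)) +
  kap * (near_count r W (pos p))%:R / (h ^ d)%:R.
Proof.
move=> uW h0 hm m2; set W' := [seq z <- W | inbox r (z - pos p)].
apply: (le_trans (y := Pr R m (fun w => ~~ inbox r (pos w) || (pos (p ++ w) \in W')))).
  apply: le_Pr => // w _ pW; case: (boolP (inbox r _)) => //= iw.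
  by rewrite mem_filter pW andbT pos_cat [pos p + _]addrC addrK iw.
apply: (le_trans (Pr_or _ _ (fun w => ~~ inbox r (pos w))
  (fun w => pos (p ++ w) \in W'))); apply: lerD; first exact: Pr_outbox.
apply: (le_trans (y := 1 * (size W')%:R * (kap / Num.sqrt m.+1%:R ^+ d))).
  apply: (@Ex_le_heat R d d3 m (fun x => (x \in W')%:R) 1 W' p) => // x.
  by rewrite mul1r ler_nat count_uniq_mem ?filter_uniq.
rewrite mul1r size_filter mulrCA -mulrA ler_wpM2l ?(le_trans ler01 k1) //.
rewrite ler_wpM2l // lef_pV2 ?posrE ?exprn_gt0 ?sqrtr_gt0 // ?ltr0n ?expn_gt0 ?h0 //.
rewrite natrX; apply: lerXn2r; rewrite ?nnegrE ?sqrtr_ge0 //.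
rewrite -[leLHS]ger0_norm // -sqrtr_sqr ler_wsqrtr // -natrX ler_nat.
exact: leq_trans hm _.
Qed.

Lemma Ex_old_frac h r u (q : word) : (0 < u)%N -> (0 < h)%N ->
  Ex (2 * h ^ 2) (old_frac R (h ^ 2) u q) <=
  (2 * d%:R * expR (1 - r%:R / (2 * h%:R)) +
   kap * (near_count r (heavy u (trail 0 q)) (pos q))%:R / (h ^ d)%:R) / 2.
Proof.
move=> u0 h0; set B := (h ^ 2)%N; set W := heavy u _; set X := (_ + _)%R.
have B0 : (0 < B)%N by rewrite expn_gt0 h0.
have BR : 0 < B%:R :> R by rewrite ltr0n.
rewrite (eq_Ex (g := fun b => (2 * B)%:R^-1 *
   \sum_(0 <= m < B) (pos (q ++ take (B + m) b) \in W)%:R)); last first.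
  move=> b sb; rewrite /old_frac mulrC; congr (_ * _).
  have sd : size (drop B (trail (pos q) b)) = B.
    by rewrite size_drop size_trail sb; lia.
  rewrite (count_sum _ _ _ 0) sd !big_nat; apply: eq_bigr => m /andP[_ mB].
  rewrite nth_drop nth_trail; last by rewrite sb mul2n -addnn ltn_add2l.
  by rewrite pos_cat /W mem_heavy.
have B2 : 0 < (2 * B)%:R :> R by rewrite ltr0n; lia.
rewrite ExZ Ex_sum // ler_pdivrMl //.
apply: (le_trans (y := \sum_(0 <= m < B) X)); last first.
  rewrite big_const_nat subn0 iter_addr_0 -[leLHS]mulr_natl natrM.
  by rewrite le_eqVlt; apply/orP; left; apply/eqP; field.
rewrite !big_nat; apply: ler_sum => m /andP[_ mB].
have mB2 : (B + m <= 2 * B)%N by rewrite mul2n -addnn leq_add2l ltnW.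
rewrite (@Ex_take R d d0 _ _ (fun v => (pos (q ++ v) \in W)%:R) mB2).
apply: Pr_near => //; first exact: heavy_uniq.
exact: leq_addr.
Qed.

End occupation_means.

(** * Covering heavy sets by boxes *)

Section batches.
Variable d : nat.
Local Notation point := 'rV[int]_d.

Lemma near_count_perm r (V W : seq point) x :
  perm_eq V W -> near_count r V x = near_count r W x.
Proof. by move/permP; apply. Qed.

(* Greedily remove batches of [g] points lying in a common box; the first point
   of each batch is listed in [L]. *)
Lemma batches (W : seq point) g r : (0 < g)%N ->
  exists L : seq point, [/\ {subset L <= W}, (g * size L <= size W)%N &
    forall x, (near_count r W x <= g + g * near_count (3 * r) L x)%N].
Proof.
move=> g0; have [n] := ubnP (size W); elim: n W => // n IH W Wn.
have [[x gx]|nx] := pselect (exists x, (g <= near_count r W x)%N); last first.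
  exists [::]; rewrite muln0; split=> // x; rewrite addn0.
  by case: (leqP (near_count r W x) g) => // /ltnW gx; case: nx; exists x.
pose P (z : point) := inbox r (z - x).
pose A := [seq z <- W | P z].
have sA : (g <= size A)%N by rewrite size_filter.
pose W' := drop g A ++ [seq z <- W | ~~ P z].
have pW : perm_eq (take g A ++ W') W.
  by rewrite /W' catA cat_take_drop; apply/permPl/perm_filterC.
have sW : (size W = g + size W')%N.
  by rewrite -(perm_size pW) size_cat size_takel.
have [L [LW gL HL]] := IH W' ltac:(lia).
case EA : (take g A) => [|c b]; first by have := size_takel sA; rewrite EA /=; lia.
have cA : c \in A by rewrite (mem_take (n0 := g)) // EA mem_head.
exists (c :: L); split.
- move=> z; rewrite in_cons => /predU1P[->|zL].
    by move: cA; rewrite mem_filter => /andP[].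
  by rewrite -(perm_mem pW) mem_cat LW // orbT.
- by rewrite /= mulnS sW leq_add2l.
move=> y; rewrite -(near_count_perm r y pW) /near_count count_cat -/(near_count r W' y).
have := HL y.
pose a := count (fun z => inbox r (z - y)) (take g A).
have cg : (a <= g)%N by apply: leq_trans (count_size _ _) _; rewrite size_takel.
rewrite /near_count /= -/a; set k := count _ L; set k' := count _ W'.
case: (boolP (has (fun z => inbox r (z - y)) (take g A))) => [/hasP[z zA zy]|].
  (* Both [c] and [z] lie within [r] of the common centre [x], and [z] within [r] of [y]; this is
     where the radius triples. *)
  suff -> : inbox (3 * r) (c - y).
    by rewrite mulnDr muln1; move: (g * k)%N cg => gk; clear; lia.
  have zA' : z \in A by apply: mem_take zA.
  move: cA zA'; rewrite !mem_filter /P => /andP[/forallP cx _] /andP[/forallP zx _].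
  apply/forallP => i; have := cx i; have := zx i; have := forallP zy i.
  rewrite !mxE; move: (z ord0 i) (y ord0 i) (x ord0 i) (c ord0 i).
  by clear; lia.
rewrite has_count -leqNgt leqn0 -/a => /eqP ->; rewrite mulnDr => Hk.
by apply: leq_trans Hk _; rewrite leq_add2l leq_addl.
Qed.

Fixpoint lists (T : Type) M (Z : seq T) : seq (seq T) :=
  if M is M'.+1 then [seq x :: l | x <- Z, l <- lists M' Z] else [:: [::]].

Lemma size_lists (T : Type) M (Z : seq T) : size (lists M Z) = (size Z ^ M)%N.
Proof. by elim: M => [//|M IH] /=; rewrite size_allpairs IH expnS. Qed.

Lemma mem_lists (T : eqType) M (Z L : seq T) :
  size L = M -> {subset L <= Z} -> L \in lists M Z.
Proof.
elim: M L => [|M IH] [|x L] //= [sL] LZ; apply/allpairsP; exists (x, L) => /=.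
split=> //; first by rewrite LZ ?mem_head.
by apply: IH => // z zL; rewrite LZ // in_cons zL orbT.
Qed.

End batches.

(** * Visits to sites that were already heavy in the past *)

Section old_visits.
Variables (R : realType) (d : nat).
Hypothesis d3 : (3 <= d)%N.
Local Notation kap := (kap R d).
Local Notation lam0 := (lam0 R d).
Local Notation point := 'rV[int]_d.
Local Notation word := (seq (step d)).
Let d0 : (0 < d)%N. Proof. exact: leq_trans d3. Qed.
Let k1 : 1 <= kap. Proof. exact: kap_ge1. Qed.

(** The cap is for [khasminskii], which needs values in [[0, 1]]. It loses nothing, since the
    conditional means to be bounded are at most 1/2. *)
Definition near_frac (theta : R) r (L : seq point) (x : point) : R :=
  Num.min 1 (2 * kap * theta * (near_count (3 * r) L x)%:R).

Lemma near_frac_count theta r L x : 0 <= theta -> near_frac theta r L x <=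
  2 * kap * theta * (count_mem x [seq c - b | c <- L, b <- box d (3 * r)])%:R.
Proof.
move=> t0; apply: (le_trans (y := 2 * kap * theta * (near_count (3 * r) L x)%:R)).
  by rewrite ge_min lexx orbT.
rewrite ler_wpM2l ?mulr_ge0 ?(le_trans ler01 k1) // ler_nat.
elim: L => [//|c L IH]; rewrite allpairs_cons count_cat /near_count /=.
apply: leq_add => //; case: (boolP (inbox _ _)) => // /mem_box cx.
rewrite -has_count; apply/hasP; exists x => //; last exact: eqxx.
by apply/mapP; exists (c - x) => //; rewrite opprB addrC subrK.
Qed.

(** The boxes around [L] have total mass [2 kap theta |L| (6r+1)^d]. Once this is at most [h^d],
    [green_skeleton] applies and the exponential moment is bounded whatever the number of blocks. *)
Lemma Ex_expR_near theta r L h B K p : 0 <= theta -> (0 < h)%N ->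
  (h ^ 2 <= B)%N ->
  2 * kap * theta * (size L * (6 * r).+1 ^ d)%N%:R <= (h ^ d)%:R ->
  Ex (K * B) (fun w =>
    expR (cs B K (fun q _ => lam0 * near_frac theta r L (pos q)) p w)) <= 2.
Proof.
move=> t0 h0 hB mass.
have k0 : 0 <= kap by apply: le_trans k1.
have f01 x : 0 <= near_frac theta r L x <= 1.
  by rewrite le_min ge_min lexx ler01 /= !mulr_ge0.
have G k q : green (near_frac theta r L) B k q <= 1 + 3 * kap.
  apply: (@green_skeleton R d d3 _ (2 * kap * theta)
    [seq c - b | c <- L, b <- box d (3 * r)] h) => //.
  - by move=> x; have /andP[] := f01 x.
  - by rewrite !mulr_ge0.
  - by move=> x; exact: near_frac_count.
  - rewrite size_allpairs size_box (_ : 2 * (3 * r) = 6 * r)%N //; lia.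
have l0 := @lam0_gt0 R d d3; have l1 := @lam0_le R d d3; have lE := @lam0E R d d3.
have H k q : 4 * lam0 * green (near_frac theta r L) B k q <= 1.
  by rewrite -[leRHS]lE ler_wpM2l //; lra.
apply: (le_trans (@khasminskii R d d0 _ _ _ _ _ f01 _ _)).
- by lra.
- by move=> q k _ _; exact: H.
by have := H K p; lra.
Qed.

(* Given the past, the mean of [old_frac] is at most [theta] plus the density
   of the heavy set near the current position. Up to a further [theta], that
   density is determined by a list [L] of at most [M] points, so that a union
   bound over [L] costs only a polynomial factor. *)
Lemma old_visits_tail theta h r u g M V K (p : word) :
  0 < theta -> (0 < h)%N -> (0 < u)%N -> (0 < g)%N ->
  2 * d%:R * expR (1 - r%:R / (2 * h%:R)) <= theta ->
  g%:R <= 2 * theta * (h ^ d)%:R -> (V %/ g <= M)%N ->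
  2 * kap * theta * (M * (6 * r).+1 ^ d)%N%:R <= (h ^ d)%:R ->
  forall B n, B = (2 * h ^ 2)%N -> n = (size p + K * B)%N ->
  Pr R (K * B) (fun w => (size (heavy u (trail 0%R (p ++ w))) <= V)%N &&
    ((3 + 2 * kap) * theta * K%:R <= cs B K (old_frac R (h ^ 2) u) p w)) <=
  expR (- (theta * K%:R)) +
  ((2 * n).+1 ^ (d * M))%:R * (2 * expR (- (lam0 * theta * K%:R))).
Proof.
move=> t0 h0 u0 g0 tail gle VM mass B n BE nE.
have k0 : 0 <= kap by apply: le_trans k1.
have B0 : (0 < h ^ 2)%N by rewrite expn_gt0 h0.
have hd0 : 0 < (h ^ d)%:R :> R by rewrite ltr0n expn_gt0 h0.
have l0 := @lam0_gt0 R d d3.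
pose mu (q : word) := Ex B (old_frac R (h ^ 2) u q).
pose X (w : word) := cs B K (fun q b => old_frac R (h ^ 2) u q b - 2 * mu q) p w.
pose Y L (w : word) := cs B K (fun q _ => lam0 * near_frac theta r L (pos q)) p w.
pose LL := lists M (box d n).
apply: (le_trans (y := Pr R (K * B) (fun w => (theta * K%:R <= X w) ||
   has (fun L => lam0 * theta * K%:R <= Y L w) [seq L <- LL | size L == M]))).
  apply: le_Pr => // w sw /andP[sV big].
  case: (leP (theta * K%:R) (X w)) => //= Xs.
  have [L0 [L0W gL0 HL0]] := batches (heavy u (trail 0 (p ++ w))) r g0.
  have sL0 : (size L0 <= M)%N.
    by apply: leq_trans VM; rewrite leq_divRL // mulnC; apply: leq_trans gL0 sV.
  (* Padding with the origin gives all lists the same length [M] and can only raise the near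
     counts. *)
  pose L := L0 ++ nseq (M - size L0) 0.
  have sL : size L = M by rewrite size_cat size_nseq subnKC.
  apply/hasP; exists L.
    rewrite mem_filter sL eqxx mem_lists // => z; rewrite mem_cat => /orP[/L0W|].
      rewrite mem_heavy // => uz; apply: mem_box.
      have -> : n = size (p ++ w) by rewrite size_cat sw.
      apply: inbox_trail; rewrite -has_pred1 has_count; exact: leq_trans u0 uz.
    by rewrite mem_nseq => /andP[_ /eqP ->]; apply: mem_box; apply/forallP => i; rewrite mxE.
  (* Claimed for prefixes [q] of the actual path: [L] controls the heavy set of the whole path,
     which contains that of every prefix. *)
  have muL q : mu q <= ((1 + 2 * kap) * theta + near_frac theta r L (pos q)) / 2 \/
     ~~ prefix q (p ++ w).
    case: (boolP (prefix q (p ++ w))) => [pq|]; [left|by right].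
    have mu1 : mu q <= 1 / 2.
      by apply: Ex_le_cst => // b sb; rewrite BE in sb; case/andP: (old_frac_bound R d3 u q B0 sb).
    have kt0 := mulr_ge0 k0 (ltW t0).
    rewrite /near_frac minEle; case: ifP => _; first by nra.
    rewrite /mu BE.
    apply: (le_trans (Ex_old_frac R d3 r q u0 h0)).
    rewrite ler_wpM2r ?invr_ge0 //.
    have cnt : (near_count r (heavy u (trail 0 q)) (pos q) <=
        g + g * near_count (3 * r) L (pos q))%N.
      apply: leq_trans (leq_trans (HL0 (pos q)) _).
        rewrite /near_count -!size_filter; apply: uniq_leq_size.
          by rewrite filter_uniq ?heavy_uniq.
        move=> z; rewrite !(mem_filter (fun x => inbox r (x - pos q))) => /andP[-> zq] /=.
        move: zq; rewrite !mem_heavy // => /leq_trans; apply.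
        move: pq => /prefixP[w' ->]; rewrite trail_cat count_cat; exact: leq_addr.
      by rewrite leq_add2l leq_mul2l /near_count /L count_cat leq_addr orbT.
    have : kap * (near_count r (heavy u (trail 0 q)) (pos q))%:R / (h ^ d)%:R <=
        2 * kap * theta * (1 + (near_count (3 * r) L (pos q))%:R).
      rewrite ler_pdivrMr //.
      apply: (le_trans (y := kap * (g%:R * (1 + (near_count (3 * r) L (pos q))%:R)))).
        rewrite ler_wpM2l //; move: cnt; rewrite -(ler_nat R) natrD natrM; lra.
      have N0 : 0 <= 1 + (near_count (3 * r) L (pos q))%:R :> R by rewrite addr_ge0.
      by have := ler_wpM2l k0 (ler_wpM2r N0 gle); lra.
    lra.
  (* The constant [3 + 2 kap] is spent as 1 on the centred part, [1 + 2 kap] on the exit probability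
     and the batch remainder, and 1 on the density of the list. *)
  have XY : lam0 * cs B K (old_frac R (h ^ 2) u) p w <= lam0 * X w +
      lam0 * ((1 + 2 * kap) * theta) * K%:R + Y L w.
    rewrite /X /Y !csE !mulr_sumr.
    have -> : lam0 * ((1 + 2 * kap) * theta) * K%:R =
        \sum_(0 <= i < K) lam0 * ((1 + 2 * kap) * theta).
      by rewrite big_const_nat subn0 iter_addr_0 mulr_natr.
    rewrite -!big_split /=; apply: ler_sum => i _.
    have := muL (p ++ take (i * B) w).
    rewrite prefix_catr // prefix_take eqxx /=.
    by case=> // H; have := ler_wpM2l (ltW l0) H; lra.
  have := ler_wpM2l (ltW l0) (ltW Xs); have := ler_wpM2l (ltW l0) big; lra.
apply: (le_trans (Pr_or _ _ (fun w => theta * K%:R <= X w) _)); apply: lerD.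
  apply: (le_trans (Pr_expR _ _ _)) => //; rewrite ger_pMr ?expR_gt0 //.
  apply: Ex_expR_cs_le1 => // q.
  (* blocks have length exactly [B] under [Ex B] *)
  pose y b := if size b == B then old_frac R (h ^ 2) u q b else 0.
  have yE b : size b = B -> old_frac R (h ^ 2) u q b = y b.
    by move=> sb; rewrite /y sb eqxx.
  have y12 b : 0 <= y b <= 1 / 2.
    rewrite /y BE; case: eqP => [/(old_frac_bound R d3 u q B0) //|_]; lra.
  rewrite /mu (eq_Ex yE).
  rewrite (eq_Ex (g := fun b => expR (y b - 2 * Ex B y))); last by move=> b /yE ->.
  exact: Ex_expR_center.
apply: (le_trans (@Pr_has R d d0 _ _ [seq L <- LL | size L == M]
   (fun L w => lam0 * theta * K%:R <= Y L w))).
apply: (le_trans (y := \sum_(L <- [seq L <- LL | size L == M])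
   2 * expR (- (lam0 * theta * K%:R)))).
  rewrite !big_seq; apply: ler_sum => L; rewrite mem_filter => /andP[/eqP sL _].
  apply: (le_trans (Pr_expR _ _ _)) => //; rewrite mulrC ler_wpM2r ?expR_ge0 //.
  apply: (Ex_expR_near _ _ (ltW t0) h0); last by rewrite sL.
  by rewrite BE leq_pmull.
rewrite big_const_seq count_predT iter_addr_0 -[leLHS]mulr_natl ler_wpM2r //.
rewrite ler_nat size_filter; apply: leq_trans (count_size _ _) _.
by rewrite size_lists size_box -expnM.
Qed.

End old_visits.

Section level_tail.
Variables (R : realType) (d : nat).
Hypothesis d3 : (3 <= d)%N.
Local Notation kap := (kap R d).
Local Notation lam0 := (lam0 R d).
Local Notation point := 'rV[int]_d.
Local Notation word := (seq (step d)).
Let d0 : (0 < d)%N. Proof. exact: leq_trans d3. Qed.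
Let k1 : 1 <= kap. Proof. exact: kap_ge1. Qed.

Lemma cs_take B K (F : word -> word -> R) p w :
  cs B K F p (take (K * B) w) = cs B K F p w.
Proof.
elim: K p w => [//|K IH] p w /=; rewrite mulSn.
rewrite take_takel ?leq_addr //; congr (_ + _).
by rewrite addnC -take_drop IH.
Qed.

Lemma Pr_window (A : word -> pred word) c m n (e : R) : (c + m <= n)%N ->
  (forall p, size p = c -> Pr R m (A p) <= e) ->
  Pr R n (fun w : word => A (take c w) (take m (drop c w))) <= e.
Proof.
move=> cm Ae; have cn : (c <= n)%N by apply: leq_trans cm; exact: leq_addr.
rewrite /Pr -(subnKC cn) Ex_cat; apply: Ex_le_cst => // p sp.
rewrite (eq_Ex (g := fun v => (fun v' => (A p v')%:R) (take m v))); last first.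
  by move=> v _; rewrite -sp take_size_cat // drop_size_cat.
rewrite (@Ex_take R d d0 _ m (fun v => (A p v)%:R)); first exact: Ae.
by rewrite leq_subRL.
Qed.

Lemma heavy_take_size u m (s : seq point) : (0 < u)%N ->
  (size (heavy u (take m s)) <= size (heavy u s))%N.
Proof. by move=> u0; apply: uniq_leq_size (heavy_uniq _ _) (heavy_take u0). Qed.

Lemma chain_steps n B : (0 < B)%N -> (B <= n)%N ->
  let K := ((n - B) %/ (2 * B))%N in
  (B + K * (2 * B) <= n)%N /\ (B + (n - (B + K * (2 * B))) <= 3 * B)%N.
Proof.
move=> B0 Bn K; have B2 : (0 < 2 * B)%N by lia.
have := leq_trunc_div (n - B) (2 * B); have := ltn_ceil (n - B) B2.
rewrite -/K mulSn; move: (K * (2 * B))%N => k; lia.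
Qed.

Variables (theta : R) (h r u g M V n : nat).
Let B := (h ^ 2)%N.
Let K := ((n - B) %/ (2 * B))%N.
Hypotheses (t0 : 0 < theta) (h0 : (0 < h)%N) (u0 : (0 < u)%N) (Bn : (B <= n)%N).

Let B0 : (0 < B)%N. Proof. by rewrite expn_gt0 h0. Qed.

(** At most [3 B] steps lie outside the two chains, and each chain contributes at most
    [(3 + 2 kap) theta n] because [2 B K <= n]. *)
Lemma visits_old_tail : (0 < g)%N ->
  2 * d%:R * expR (1 - r%:R / (2 * h%:R)) <= theta ->
  g%:R <= 2 * theta * (h ^ d)%:R -> (V %/ g <= M)%N ->
  2 * kap * theta * (M * (6 * r).+1 ^ d)%N%:R <= (h ^ d)%:R ->
  Pr R n (fun w : word => (size (heavy u (trail 0%R w)) <= V)%N &&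
    ((3 * B)%:R + 2 * (3 + 2 * kap) * theta * n%:R <
     visits_old R B u (trail 0 w) 0)) <=
  2 * (expR (- (theta * K%:R)) +
       ((2 * n).+1 ^ (d * M))%:R * (2 * expR (- (lam0 * theta * K%:R)))).
Proof.
move=> g0 tail gle VM mass; set e := (expR _ + _)%R.
have [Kn rem] := chain_steps B0 Bn; rewrite -/K in Kn rem.
pose A (p w : word) := (size (heavy u (trail 0%R (p ++ w))) <= V)%N &&
  ((3 + 2 * kap) * theta * K%:R <= cs (2 * B) K (old_frac R B u) p w).
have Ae c p : (c + K * (2 * B) <= n)%N -> size p = c ->
    Pr R (K * (2 * B)) (A p) <= e.
  move=> cn sp.
  apply: (le_trans (old_visits_tail d3 t0 h0 u0 g0 tail gle VM mass erefl erefl)).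
  rewrite /e lerD2l ler_wpM2r ?mulr_ge0 ?expR_ge0 //.
  rewrite ler_nat; case: (d * M)%N => [//|e']; rewrite leq_exp2r //; lia.
apply: (le_trans (y := Pr R n (fun w : word =>
   A (take 0 w) (take (K * (2 * B)) (drop 0 w)) ||
   A (take B w) (take (K * (2 * B)) (drop B w))))).
  apply: le_Pr => // w sw /andP[sV big].
  have [le_old _] := @visits_two_chains R d B u w K B0 ltac:(by rewrite sw).
  rewrite sw /= in le_old; have {}le_old := lt_le_trans big le_old.
  have sA c : (c + K * (2 * B) <= n)%N ->
      (size (heavy u (trail 0 (take c w ++ take (K * (2 * B)) (drop c w)))) <= V)%N.
    move=> cn; rewrite -takeD trail_take.
    by apply: leq_trans sV; exact: heavy_take_size.
  rewrite /A !cs_take !sA //=; last first.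
    by apply: leq_trans Kn; rewrite leq_addl.
  rewrite take0 drop0 /= -[_ || _]negbK negb_or -!ltNge; apply/negP => /andP[lt1 lt2].
  have remR : (B + (n - (B + K * (2 * B))))%:R <= (3 * B)%:R :> R by rewrite ler_nat.
  have KB : K%:R * (2 * B)%:R <= n%:R :> R.
    by rewrite -natrM ler_nat; apply: leq_trans Kn; rewrite leq_addl.
  have BR : 0 < (2 * B)%:R :> R by rewrite natrM mulr_gt0 // ltr0n.
  have c0 : 0 <= (3 + 2 * kap) * theta by rewrite mulr_ge0 ?(ltW t0) //; have := k1; lra.

  have {}lt1 := ltW lt1; have {}lt2 := ltW lt2.
  have := ler_wpM2l (ltW BR) (lerD lt1 lt2); have := ler_wpM2l c0 KB.
  move: (cs _ _ _ _ _) (cs _ _ _ _ _) le_old => x y; lra.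
apply: (le_trans (Pr_or _ _ _ _)).
have e2 : 2 * e = e + e by ring.
rewrite e2; apply: lerD.
  apply: (Pr_window (c := 0)) => [|p sp]; first by apply: leq_trans Kn; rewrite leq_addl.
  by apply: (Ae 0%N) => //; apply: leq_trans Kn; rewrite leq_addl.
by apply: (Pr_window Kn) => p sp; exact: (Ae B).
Qed.

(** Counting restarts inside the block, so the conditional mean is at most [expR (- lam0 u)]
    whatever the past, and no entropy is paid. *)
Lemma visits_new_tail : expR (- (lam0 * u%:R)) <= theta ->
  Pr R n (fun w : word => (3 * B)%:R + 12 * theta * n%:R <
     visits_new R B u (trail 0 w) 0) <=
  2 * expR (- (theta * K%:R)).
Proof.
move=> eu; have [Kn rem] := chain_steps B0 Bn; rewrite -/K in Kn rem.
pose A (p w : word) := 3 * theta * K%:R <= cs (2 * B) K (new_frac R B u) p w.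
have Ae p : Pr R (K * (2 * B)) (A p) <= expR (- (theta * K%:R)).
  pose mu (q : word) := Ex (2 * B) (new_frac R B u q).
  apply: (le_trans (y := Pr R (K * (2 * B)) (fun w : word => theta * K%:R <=
     cs (2 * B) K (fun q b => new_frac R B u q b - 2 * mu q) p w))).
    apply: le_Pr => // w _; rewrite /A !csE => big.
    have : \sum_(0 <= i < K) 2 * mu (p ++ take (i * (2 * B)) w) <=
        \sum_(0 <= i < K) 2 * theta.
      apply: ler_sum => i _; rewrite ler_wpM2l //.
      by apply: le_trans eu; exact: Ex_new_frac.
    rewrite [leRHS]big_const_nat subn0 iter_addr_0 -mulr_natr sumrB; lra.
  apply: (le_trans (Pr_expR _ _ _)) => //; rewrite ger_pMr ?expR_gt0 //.
  apply: Ex_expR_cs_le1 => // q.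
  pose y b := if size b == (2 * B)%N then new_frac R B u q b else 0.
  have yE b : size b = (2 * B)%N -> new_frac R B u q b = y b.
    by move=> sb; rewrite /y sb eqxx.
  have y12 b : 0 <= y b <= 1 / 2.
    rewrite /y; case: eqP => [/(new_frac_bound R d3 u q B0) //|_]; lra.
  rewrite /mu (eq_Ex yE).
  rewrite (eq_Ex (g := fun b => expR (y b - 2 * Ex (2 * B) y))); last by move=> b /yE ->.
  exact: Ex_expR_center.
apply: (le_trans (y := Pr R n (fun w : word =>
   A (take 0 w) (take (K * (2 * B)) (drop 0 w)) ||
   A (take B w) (take (K * (2 * B)) (drop B w))))).
  apply: le_Pr => // w sw big.
  have [_ le_new] := @visits_two_chains R d B u w K B0 ltac:(by rewrite sw).
  rewrite sw /= in le_new; have {}le_new := lt_le_trans big le_new.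
  rewrite /A !cs_take take0 drop0 -[_ || _]negbK negb_or -!ltNge; apply/negP => /andP[lt1 lt2].
  have remR : (B + (n - (B + K * (2 * B))))%:R <= (3 * B)%:R :> R by rewrite ler_nat.
  have KB : K%:R * (2 * B)%:R <= n%:R :> R.
    by rewrite -natrM ler_nat; apply: leq_trans Kn; rewrite leq_addl.
  have BR : 0 < (4 * B)%:R :> R by rewrite natrM mulr_gt0 // ltr0n.
  have {}lt1 := ltW lt1; have {}lt2 := ltW lt2.
  have := ler_wpM2l (ltW BR) (lerD lt1 lt2); have := ler_wpM2l (ltW t0) KB.
  rewrite natrM in remR.
  move: (cs _ _ _ _ _) (cs _ _ _ _ _) le_new => x y; rewrite !(natrM _ _ B); move: (B%:R : R) BR remR => b BR remR; lra.
apply: (le_trans (Pr_or _ _ _ _)).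
have -> x : 2 * x = x + x :> R by ring.
apply: lerD.
  apply: (Pr_window (c := 0)) => [|p _]; last exact: Ae.
  by apply: leq_trans Kn; rewrite leq_addl.
by apply: (Pr_window Kn) => p _; exact: Ae.
Qed.

Lemma excess_tail : (0 < g)%N ->
  2 * d%:R * expR (1 - r%:R / (2 * h%:R)) <= theta ->
  g%:R <= 2 * theta * (h ^ d)%:R -> (V %/ g <= M)%N ->
  2 * kap * theta * (M * (6 * r).+1 ^ d)%N%:R <= (h ^ d)%:R ->
  expR (- (lam0 * u%:R)) <= theta ->
  Pr R n (fun w : word => (size (heavy u (trail 0%R w)) <= V)%N &&
    ((6 * B)%:R + (18 + 4 * kap) * theta * n%:R < excess R (2 * u) (trail 0 w))) <=
  8 * (((2 * n).+1 ^ (d * M))%:R * expR (- (lam0 * theta * K%:R))).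
Proof.
move=> g0 tail gle VM mass eu.
apply: (le_trans (y := Pr R n (fun w : word =>
  ((size (heavy u (trail 0%R w)) <= V)%N &&
   ((3 * B)%:R + 2 * (3 + 2 * kap) * theta * n%:R <
     visits_old R B u (trail 0 w) 0)) ||
  ((3 * B)%:R + 12 * theta * n%:R < visits_new R B u (trail 0 w) 0)))).
  apply: le_Pr => // w _ /andP[-> big] /=.
  have := lt_le_trans big (excess_old_new R B u (trail 0 w) 0).
  rewrite -[_ || _]negbK negb_or -!leNgt => H; apply/negP => /andP[H1 H2].
  move: H H1 H2; rewrite !natrM.
  move: (visits_old _ _ _ _ _) (visits_new _ _ _ _ _) => x y; lra.
apply: (le_trans (Pr_or _ _ _ _)).
apply: (le_trans (lerD (visits_old_tail g0 tail gle VM mass) (visits_new_tail eu))).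
have P1 : 1 <= ((2 * n).+1 ^ (d * M))%:R :> R by rewrite ler1n expn_gt0.
have l1 : lam0 <= 1 by have := @lam0_le R d d3; lra.
have e1 : expR (- (theta * K%:R)) <= expR (- (lam0 * theta * K%:R)).
  rewrite ler_expR lerN2 -mulrA ler_piMl // mulr_ge0 ?(ltW t0) //.
have := expR_ge0 (- (lam0 * theta * K%:R)) => e0.
have e2 : expR (- (lam0 * theta * K%:R)) <=
    ((2 * n).+1 ^ (d * M))%:R * expR (- (lam0 * theta * K%:R)).
  by rewrite ler_peMl.
lra.
Qed.

End level_tail.

(** * Failure of a level *)

Section scale_choice.
Variables (R : realType) (d : nat).
Hypothesis d3 : (3 <= d)%N.
Local Notation kap := (kap R d).
Local Notation lam0 := (lam0 R d).
Let d0 : (0 < d)%N. Proof. exact: leq_trans d3. Qed.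
Let k1 : 1 <= kap. Proof. exact: kap_ge1. Qed.

(** Here [x] bounds the number of heavy sites. With [h] about [14 kap rho x^(1/d)], a heavy set
    stays thin at scale [h] even after fattening to boxes of radius [3 r], where [r = rho h].
    Batches have about [theta h^d] points, the size at which their density reaches [theta]; hence at
    most [x / (theta h^d) <= 1 / theta] of them occur. *)
Lemma scale_choice (theta x : R) (rho : nat) :
  0 < theta <= 1 -> 1 <= theta * x -> (0 < rho)%N ->
  2 * d%:R * expR (1 - rho%:R / 2) <= theta ->
  exists h r g M : nat, [/\ (0 < h)%N, (0 < g)%N,
    2 * d%:R * expR (1 - r%:R / (2 * h%:R)) <= theta,
    g%:R <= 2 * theta * (h ^ d)%:R &
    [/\ (Num.truncn x %/ g <= M)%N,
    2 * kap * theta * (M * (6 * r).+1 ^ d)%N%:R <= (h ^ d)%:R,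
    theta * M%:R <= 1 &
    h%:R ^+ 2 <= (28 * kap * rho%:R) ^+ 2 * x `^ (2 / d%:R)]].
Proof.
move=> /andP[t0 t1] tx rho0 tail.
have x1 : 1 <= x.
  by rewrite leNgt; apply/negP => xlt; have := ltr_pM2l t0 x 1; rewrite xlt mulr1; lra.
have x0 : 0 <= x by lra.
have rR : 1 <= rho%:R :> R by rewrite ler1n.
have dR : 0 < d%:R :> R by rewrite ltr0n.
pose z := x `^ (1 / d%:R).
have z1 : 1 <= z by rewrite -(powRr0 x) ler_powR // divr_ge0.
have zd : z ^+ d = x.
  by rewrite -powR_mulrn ?powR_ge0 // -powRrM divfK ?gt_eqF // powRr1.
have z2 : z ^+ 2 = x `^ (2 / d%:R).
  by rewrite -powR_mulrn ?powR_ge0 // -powRrM mulrAC mul1r.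
pose y := 2 * kap * (7 * rho%:R) * z.
have c1 : 1 <= 7 * rho%:R :> R by lra.
have k2 : 1 <= 2 * kap by have := k1; lra.
have kc1 : 1 <= 2 * kap * (7 * rho%:R).
  exact: mulr_ege1.
have y1 : 1 <= y by exact: mulr_ege1.
pose h := (Num.truncn y).+1; have hy : y <= h%:R by apply/ltW/truncnS_gt.
have hy2 : h%:R <= 2 * y.
  have : (Num.truncn y)%:R <= y by rewrite truncn_le; lra.
  by rewrite /h -natr1; lra.
pose H : R := (h ^ d)%:R.
have HE : H = h%:R ^+ d by rewrite /H natrX.
have Hx : 2 * kap * (7 * rho%:R) ^+ d * x <= H.
  rewrite -zd HE; apply: (le_trans (y := y ^+ d)); last by apply: lerXn2r; rewrite ?nnegrE //; lra.
  rewrite /y !exprMn ler_wpM2r ?exprn_ge0 //; first by lra.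
  rewrite ler_wpM2r ?mulr_ge0 ?exprn_ge0 //.
  by rewrite -exprMn; exact: ler_eXnr.
have crd : 1 <= (7 * rho%:R) ^+ d :> R by exact: exprn_ege1.
have xH : x <= H.
  by apply: le_trans Hx; rewrite ler_peMl //; apply: mulr_ege1.
have tH : 1 <= theta * H by apply: (le_trans tx); rewrite ler_pM2l.
pose g := (Num.truncn (theta * H)).+1.
have gH : theta * H <= g%:R by apply/ltW/truncnS_gt.
have gH2 : g%:R <= 2 * theta * H.
  have : (Num.truncn (theta * H))%:R <= theta * H by rewrite truncn_le; lra.
  by rewrite /g -natr1; lra.
pose M := (Num.truncn x %/ g)%N.
have Mx : M%:R * (theta * H) <= x.
  apply: (le_trans (y := (M * g)%N%:R)); first by rewrite natrM ler_wpM2l.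
  by rewrite -truncn_ge_nat // leq_trunc_div.
have H0 : 0 < H by lra.
have tM : theta * M%:R <= 1.
  by rewrite -(ler_pM2r H0) mul1r mulrAC mulrC; apply: le_trans xH.
exists h, (rho * h)%N, g, M; split=> //.
- have -> : (rho * h)%N%:R / (2 * h%:R) = rho%:R / 2 :> R.
    by rewrite natrM; field; rewrite pnatr_eq0.
  by [].
split=> //.
- have r7 : ((6 * (rho * h)).+1 <= (7 * rho) * h)%N.
    have : (0 < rho * h)%N by rewrite muln_gt0 rho0.
    by rewrite -mulnA; move: (rho * h)%N => k; clear; lia.
  apply: (le_trans (y := 2 * kap * theta * (M%:R * ((7 * rho%:R) ^+ d * H)))).
    rewrite ler_wpM2l ?mulr_ge0 ?(ltW t0) //; first by have := k1; lra.
    rewrite natrM ler_wpM2l // HE -exprMn -!natrM -natrX ler_nat.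
    by rewrite leq_exp2r.
  have C0 : 0 <= 2 * kap * (7 * rho%:R) ^+ d by apply: mulr_ge0; lra.
  by have := ler_wpM2l C0 Mx; lra.
rewrite -z2; apply: (le_trans (y := (2 * y) ^+ 2)).
  by apply: lerXn2r; rewrite ?nnegrE //; lra.
rewrite /y le_eqVlt; apply/orP; left; apply/eqP; ring.
Qed.

(** From [M <= 1/theta] the choice of a list costs at most [(d/theta) ln (2n+1)]. The number of
    blocks is at least [n / (8 h^2)], and [8 <= expR 3]. *)
Lemma entropy_rate (theta : R) h M n : 0 < theta -> (0 < h)%N ->
  (4 * h ^ 2 <= n)%N -> theta * M%:R <= 1 ->
  8 * (((2 * n).+1 ^ (d * M))%:R *
    expR (- (lam0 * theta * ((n - h ^ 2) %/ (2 * h ^ 2))%N%:R))) <=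
  expR (3 + d%:R / theta * ln (2 * n).+1%:R -
        lam0 * theta * n%:R / (8 * h%:R ^+ 2)).
Proof.
move=> t0 h0 hn tM; have hR : 0 < h%:R :> R by rewrite ltr0n.
rewrite !expRD mulrA; apply: ler_pM; rewrite ?mulr_ge0 ?expR_ge0 //.
  apply: ler_pM => //.
    have e2 : 2 <= expR 1 :> R by have := expR_ge1Dx (1 : R).
    have e4 : 4 <= expR 1 * expR 1 :> R by nra.
    by nra.
  rewrite natrX -[X in X ^+ _](@lnK R) ?posrE ?ltr0n // -expRM_natl ler_expR.
  rewrite ler_wpM2r ?ln_ge0 ?ler1n // natrM ler_wpM2l //.
  by rewrite -div1r ler_pdivlMr // mulrC.
rewrite ler_expR lerN2 -mulrA ler_wpM2l ?mulr_ge0 ?(ltW (lam0_gt0 R d3)) ?(ltW t0) //.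
set K := (_ %/ _)%N; have h2 : (0 < h ^ 2)%N by rewrite expn_gt0 h0.
have := @ltn_ceil (n - h ^ 2) (2 * h ^ 2) ltac:(lia); rewrite -/K => ltK.
have {}ltK : (n <= 8 * h ^ 2 * K)%N.
  case: (posnP K) ltK => [->|K0]; first by rewrite mul1n; lia.
  have : (h ^ 2 <= h ^ 2 * K)%N by rewrite leq_pmulr.
  rewrite mulSn mulnCA (mulnC K) -mulnA; move: (h ^ 2)%N (h ^ 2 * K)%N hn.
  by clear; lia.
rewrite ler_pdivrMr ?mulr_gt0 ?exprn_gt0 // -natrX -!natrM ler_nat mulnC.
exact: ltK.
Qed.

End scale_choice.

(** * Levels below the threshold: covering and density *)

Section low_levels.
Variables (R : realType) (d : nat) (gam : R).
Hypothesis d3 : (3 <= d)%N.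
Hypotheses (gam0 : 0 < gam) (gamd : gam * (1 - 2 / d%:R) < 2 / d%:R).
Local Notation kap := (kap R d).
Local Notation lam0 := (lam0 R d).
Local Notation word := (seq (step d)).
Let d0 : (0 < d)%N. Proof. exact: leq_trans d3. Qed.
Let k1 : 1 <= kap. Proof. exact: kap_ge1. Qed.
Let l0 : 0 < lam0. Proof. exact: lam0_gt0. Qed.
Let d3R : 3 <= d%:R :> R. Proof. by rewrite ler_nat. Qed.
Let dR : 0 < d%:R :> R. Proof. by rewrite ltr0n. Qed.

(** Makes [(18 + 4 kap) theta1 s^(-gam)] half of the threshold [(4 s)^(-gam)] of the next level; the
    other half absorbs the boundary term [6 h^2]. *)
Definition theta1 : R := 4 `^ (- gam) / (2 * (18 + 4 * kap)).
(** Half the exponent by which the cost would grow with the level. The gain [s^(2 eta)] is spent on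
    boxes wider by [s^eta], which pushes the exit probability below [theta1 s^(-gam)]. *)
Definition eta : R := (2 / d%:R - gam * (1 - 2 / d%:R)) / 2.
Definition rho1 : R := 2 * (1 + ln (2 * d%:R / theta1)) + 2 * (gam / eta).
Definition width1 : R := (56 * kap * rho1) ^+ 2.
Definition rate1 : R := lam0 * theta1 / (16 * width1).

Lemma two_div_d : 0 < (2 : R) / d%:R <= 2 / 3.
Proof.
by rewrite divr_gt0 //= ler_pdivrMr //; have := d3R; lra.
Qed.

Lemma gam_le2 : gam <= 2.
Proof.
have /andP[D0 D1] := two_div_d; rewrite leNgt; apply/negP => g2.
by move: gamd D0 D1; move: (2 / d%:R) => D; nra.
Qed.

Lemma four_gam : 0 < (4 : R) `^ (- gam) <= 1.
Proof.
rewrite powR_gt0 //= -[leRHS](powRr0 4) ler_powR //; first lra.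
by rewrite oppr_le0 ltW.
Qed.

Lemma theta1_bounds : 0 < theta1 <= 1.
Proof.
have /andP[f0 f1] := four_gam; have := k1 => k.
rewrite /theta1 divr_gt0 //=; last by lra.
by rewrite ler_pdivrMr; lra.
Qed.

Lemma eta_gt0 : 0 < eta.
Proof. by rewrite /eta divr_gt0 // subr_gt0. Qed.

Lemma rho1_ge2 : 2 <= rho1.
Proof.
have /andP[t0 t1] := theta1_bounds.
have : 0 <= ln (2 * d%:R / theta1).
  by rewrite ln_ge0 // ler_pdivlMr //; have := d3R; lra.
have : 0 <= gam / eta by rewrite divr_ge0 ?ltW // eta_gt0.
by rewrite /rho1; lra.
Qed.

Lemma width1_gt0 : 0 < width1.
Proof.
have k0 : 0 < kap by apply: lt_le_trans k1.
have r0 : 0 < rho1 by apply: lt_le_trans rho1_ge2.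
by rewrite /width1 exprn_gt0 // mulr_gt0 // mulr_gt0.
Qed.

Lemma rate1_gt0 : 0 < rate1.
Proof.
have /andP[t0 _] := theta1_bounds.
apply: divr_gt0; first exact: mulr_gt0.
exact: mulr_gt0 width1_gt0.
Qed.

Lemma theta1E : theta1 = 4 `^ (- gam) / (2 * (18 + 4 * kap)).
Proof. by []. Qed.
Lemma etaE : eta = (2 / d%:R - gam * (1 - 2 / d%:R)) / 2.
Proof. by []. Qed.
Lemma rho1E : rho1 = 2 * (1 + ln (2 * d%:R / theta1)) + 2 * (gam / eta).
Proof. by []. Qed.
Lemma width1E : width1 = (56 * kap * rho1) ^+ 2.
Proof. by []. Qed.
Lemma rate1E : rate1 = lam0 * theta1 / (16 * width1).
Proof. by []. Qed.

Opaque theta1 eta rho1 width1 rate1.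

(** The width needed is logarithmic in [s]; the bound [ln (s^eta) <= s^eta] turns it into a multiple
    of [s^eta] and is the origin of [gam / eta] in [rho1]. *)
Lemma tail_rho (A G : R) (s rho : nat) : (0 < s)%N ->
  A = s%:R `^ eta -> G = s%:R `^ gam -> rho1 * A <= rho%:R ->
  2 * d%:R * expR (1 - rho%:R / 2) <= theta1 / G.
Proof.
move=> s0 AE GE rhoA; have sR : 1 <= s%:R :> R by rewrite ler1n.
have /andP[t0 t1] := theta1_bounds; have e0 := eta_gt0.
have A1 : 1 <= A by rewrite AE -[leLHS](powRr0 s%:R) ler_powR // ltW.
have s_gt0 : 0 < s%:R :> R by lra.
have lnA : gam * ln s%:R <= gam / eta * A.
  have -> : gam * ln s%:R = gam / eta * ln A.
    by rewrite AE ln_powR mulrA divfK // gt_eqF.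
  rewrite ler_wpM2l //; first by rewrite divr_ge0 ?ltW.
  by apply/ltW/ln_sublinear; lra.
have L0 : 0 <= ln (2 * d%:R / theta1).
  by rewrite ln_ge0 // ler_pdivlMr //; have := d3R; lra.
have -> : theta1 / G = 2 * d%:R * expR (- (ln (2 * d%:R / theta1) + gam * ln s%:R)).
  have q0 : 0 < 2 * d%:R / theta1 by apply: divr_gt0 t0; exact: mulr_gt0.
  rewrite opprD expRD expRN lnK ?posrE //.
  rewrite -mulNr -ln_powR lnK ?posrE ?powR_gt0 // powRN GE.
  have tn := lt0r_neq0 t0; have Gn := lt0r_neq0 (powR_gt0 gam s_gt0).
  have dn := lt0r_neq0 dR.
  by field; rewrite ?tn ?Gn ?dn.
rewrite ler_wpM2l ?mulr_ge0 // ler_expR.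
have : (1 + ln (2 * d%:R / theta1)) * 1 <= (1 + ln (2 * d%:R / theta1)) * A.
  by rewrite ler_wpM2l //; lra.
by move: rhoA; rewrite rho1E; lra.
Qed.

(** The exponents match because [(1 + gam) 2/d = gam + 2 eta]. Later [s^gam] cancels against
    [theta1 / s^gam] and the square of [s^eta] against the widened boxes, so that all low levels
    share one rate. *)
Lemma volume_powR (N a s : R) : 0 <= N -> 0 < a -> 0 < s ->
  (N / (a * s * s `^ gam)) `^ (2 / d%:R) =
  N `^ (2 / d%:R) / (a `^ (2 / d%:R) * s `^ gam * (s `^ eta) ^+ 2).
Proof.
move=> N0 a0 s0; have G0 := powR_gt0 gam s0.
have H u v : s `^ u * s `^ v = s `^ (u + v).
  by rewrite powRD // (lt0r_neq0 s0) implybT.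
have asG0 : 0 < a * s * s `^ gam by rewrite mulr_gt0 // mulr_gt0.
have xE : N = N / (a * s * s `^ gam) * (a * s * s `^ gam).
  by rewrite divfK // lt0r_neq0.
have x0 : 0 <= N / (a * s * s `^ gam) by rewrite divr_ge0 // ltW.
rewrite [in RHS]xE [in RHS]powRM // ?(ltW asG0) //.
have -> : (a * s * s `^ gam) `^ (2 / d%:R) =
    a `^ (2 / d%:R) * s `^ gam * (s `^ eta) ^+ 2.
  rewrite powRM ?(ltW G0) // ?mulr_ge0 ?(ltW a0) ?(ltW s0) //.
  rewrite powRM ?(ltW a0) ?(ltW s0) // -!mulrA; congr (_ * _).
  rewrite -(powR_mulrn 2 (powR_ge0 s eta)) -(powRrM s gam) -(powRrM s eta) !H.
  by congr (_ `^ _); rewrite etaE; field; exact: lt0r_neq0.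
rewrite mulfK // lt0r_neq0 // !mulr_gt0 ?exprn_gt0 ?powR_gt0 //.
Qed.

Lemma width_le (rho A Q al G : R) : 0 <= rho <= 2 * (rho1 * A) ->
  0 < A -> 0 < Q -> 0 < al -> 0 < G ->
  (28 * kap * rho) ^+ 2 * (Q / (al * G * A ^+ 2)) <= width1 * Q / (al * G).
Proof.
move=> /andP[r0 rA] A0 Q0 al0 G0.
have -> : width1 * Q / (al * G) =
    (28 * kap * (2 * (rho1 * A))) ^+ 2 * (Q / (al * G * A ^+ 2)).
  by rewrite width1E; field; rewrite !gt_eqF.
have k0 : 0 <= 28 * kap by have := k1; lra.
rewrite ler_wpM2r ?divr_ge0 ?mulr_ge0 ?exprn_ge0 ?(ltW Q0) ?(ltW al0) ?(ltW G0) ?(ltW A0) //.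
have rA0 := le_trans r0 rA.
apply: lerXn2r; rewrite ?nnegrE; [exact: mulr_ge0|exact: mulr_ge0|].
by rewrite ler_wpM2l.
Qed.

Lemma width_steps (H p P Q al G : R) :
  H <= width1 * Q / (al * G) -> 1 <= al -> 1 <= G -> p <= P -> 0 < Q ->
  12 * width1 <= 4 `^ (- gam) * p -> 12 * H <= 4 `^ (- gam) * (P * Q) / G.
Proof.
move=> HH al1 G1 pP Q0 wp; have /andP[f0 _] := four_gam; have w0 := width1_gt0.
have G0 : 0 < G by apply: lt_le_trans G1.
have al0 : 0 < al by apply: lt_le_trans al1.
apply: (le_trans (y := 12 * (width1 * Q / G))).
  rewrite ler_pM2l //; apply: (le_trans HH); rewrite ler_wpM2l //.
    by rewrite mulr_ge0 ?ltW.
  by rewrite lef_pV2 ?posrE ?mulr_gt0 // ler_peMl // ltW.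
have -> : 12 * (width1 * Q / G) = (12 * width1) * (Q / G) by ring.
have -> : 4 `^ (- gam) * (P * Q) / G = (4 `^ (- gam) * P) * (Q / G) by ring.
rewrite ler_wpM2r ?divr_ge0 ?(ltW Q0) ?(ltW G0) //.
by apply: (le_trans wp); rewrite ler_pM2l.
Qed.

(** The factor 2 leaves half of the rate to pay for the entropy. *)
Lemma rate_le (H P Q al G : R) :
  0 < H -> H <= width1 * Q / (al * G) -> 0 < al -> 0 < G -> 0 <= P -> 0 < Q ->
  2 * (rate1 * al * P) <= lam0 * (theta1 / G) * (P * Q) / (8 * H).
Proof.
move=> H0 HH al0 G0 P0 Q0; have w0 := width1_gt0; have r0 := rate1_gt0.
rewrite ler_pdivlMr ?mulr_gt0 //.
apply: (le_trans (y := 2 * (rate1 * al * P) * (8 * (width1 * Q / (al * G))))).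
  rewrite ler_wpM2l //; last by rewrite ler_pM2l.
  by rewrite mulr_ge0 // mulr_ge0 // mulr_ge0 // ltW.
rewrite rate1E le_eqVlt; apply/orP; left; apply/eqP.
by field; rewrite !gt_eqF.
Qed.

(** The entropy is of order [G p <= p^3], far below [P >= p^12]. The constant 38 comes from
    [ln (3 p^36) <= 2 + 36 p]. *)
Lemma entropy_le (n : nat) (p P G : R) : 1 <= p -> n%:R = p ^+ 36 ->
  3 + 38 * d%:R / theta1 <= rate1 * p -> 0 < G -> G <= p ^+ 2 -> p ^+ 12 <= P ->
  3 + d%:R / (theta1 / G) * ln (2 * n).+1%:R <= rate1 * P.
Proof.
move=> p1 nE ep G0 Gp Pp; have /andP[t0 t1] := theta1_bounds; have r0 := rate1_gt0.
have p0 : 0 < p by lra.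
have lnn : ln (2 * n).+1%:R <= 38 * p.
  apply: (le_trans (y := ln (3 * p ^+ 36))).
    rewrite ler_ln ?posrE ?mulr_gt0 ?exprn_gt0 // -nE -natrM ler_nat.
    have : (0 < n)%N by rewrite -(ltr_nat R) nE exprn_gt0.
    by clear; lia.
  rewrite lnM ?posrE ?exprn_gt0 // lnXn //.
  have : ln (3 : R) <= 2.
    have := @le_ln1Dx R 2 ltac:(lra); congr (_ <= _); congr ln; lra.
  have := ln_sublinear p0; rewrite -[_ *+ 36]mulr_natl; lra.
have -> : d%:R / (theta1 / G) = d%:R / theta1 * G.
  by field; rewrite !gt_eqF.
have k0 : 0 <= d%:R / theta1 by rewrite divr_ge0 ?ltW.
have p3 : 1 <= p ^+ 3 by rewrite exprn_ege1.
apply: (le_trans (y := rate1 * p * p ^+ 3)).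
  apply: (le_trans (y := (3 + 38 * d%:R / theta1) * p ^+ 3)); last first.
    by rewrite ler_wpM2r ?exprn_ge0 ?(ltW p0).
  apply: (le_trans (y := 3 * p ^+ 3 + d%:R / theta1 * p ^+ 2 * (38 * p))); last first.
    by rewrite le_eqVlt; apply/orP; left; apply/eqP; ring.
  apply: lerD; first by rewrite ler_peMr.
  apply: ler_pM; [exact: mulr_ge0 k0 (ltW G0)|by rewrite ln_ge0 ?ler1n| |exact: lnn].
  by rewrite ler_wpM2l.
rewrite -mulrA ler_wpM2l ?(ltW r0) // -exprS.
by apply: le_trans Pp; rewrite ler_weXn2l.
Qed.

Lemma theta_volume (a s n : nat) (p G : R) : (0 < a)%N -> (0 < s)%N ->
  s%:R <= p -> n%:R = p ^+ 36 -> a%:R <= theta1 * p -> 1 <= G -> G <= p ^+ 2 ->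
  1 <= theta1 / G * (n%:R / (a%:R * s%:R * G)).
Proof.
move=> a0 s0 sp nE ap G1 Gp; have /andP[t0 t1] := theta1_bounds.
have aR : 0 < a%:R :> R by rewrite ltr0n.
have sR : 1 <= s%:R :> R by rewrite ler1n.
have p1 : 1 <= p by apply: le_trans sp.
have G0 : 0 < G by apply: lt_le_trans G1.
have s0R : 0 < s%:R :> R by apply: lt_le_trans sR.
have -> : theta1 / G * (n%:R / (a%:R * s%:R * G)) =
    theta1 * n%:R / (a%:R * (s%:R * (G * G))).
  by field; rewrite !gt_eqF.
rewrite ler_pdivlMr ?mulr_gt0 // mul1r.
apply: (le_trans (y := (theta1 * p) * (p * (p ^+ 2 * p ^+ 2)))).
  apply: (ler_pM _ _ ap); rewrite ?mulr_ge0 ?(ltW G0) //.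
  apply: (ler_pM _ _ sp); rewrite ?mulr_ge0 ?(ltW G0) //.
  by apply: ler_pM => //; exact: ltW.
rewrite nE -mulrA ler_pM2l //.
by rewrite -exprD -!exprS ler_weXn2l.
Qed.

Lemma return_theta (a s : nat) : (0 < s)%N ->
  gam - ln theta1 <= lam0 * (2 * a%:R) ->
  expR (- (lam0 * (2 * (a * s))%N%:R)) <= theta1 / s%:R `^ gam.
Proof.
move=> s0 aC; have /andP[t0 t1] := theta1_bounds.
have sR : 1 <= s%:R :> R by rewrite ler1n.
have s0R : 0 < s%:R :> R by apply: lt_le_trans sR.
have G0 := powR_gt0 gam s0R.
have th0 : 0 < theta1 / s%:R `^ gam by rewrite divr_gt0.
rewrite -(@lnK R (_ / _)) ?posrE // ler_expR lnM ?posrE ?invr_gt0 //.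
rewrite lnV ?posrE // ln_powR.
have lns : ln (s%:R : R) <= s%:R by apply/ltW/ln_sublinear.
have lnt : ln theta1 <= 0 by rewrite -(@ln1 R) ler_ln ?posrE.
rewrite !natrM.
have := ler_wpM2r (ltW s0R) aC.
have := ler_wpM2l (ltW gam0) lns.
move: sR lnt; move: (ln theta1) (s%:R : R) (ln _) => L S l.
nra.
Qed.

(** As level [s] holds, at most [n / (a s^(1+gam))] sites receive [2 a s] visits, which bounds the
    volume; as level [4 s] fails, the event of [excess_tail] with [u = 2 a s] occurs. *)
Lemma low_level_fixed (a s n : nat) (p : R) : (0 < a)%N -> (0 < s)%N ->
  gam - ln theta1 <= lam0 * (2 * a%:R) ->
  s%:R <= p -> n%:R = p ^+ 36 ->
  a%:R <= theta1 * p -> 12 * width1 <= 4 `^ (- gam) * p ->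
  3 + 38 * d%:R / theta1 <= rate1 * p ->
  Pr R n (fun w : word =>
    ((4 * s)%N%:R `^ (- gam) * n%:R < excess R (4 * (a * s)) (trail 0 w)) &&
    (excess R (a * s) (trail 0 w) <= s%:R `^ (- gam) * n%:R)) <=
  expR (- (rate1 * a%:R `^ (2 / d%:R) * n%:R `^ (1 - 2 / d%:R))).
Proof.
move=> a0 s0 aC sp nE ap wp ep.
have /andP[t0 t1] := theta1_bounds; have e0 := eta_gt0.
have /andP[D0 D1] := two_div_d; have g2 := gam_le2; have C2 := rho1_ge2.
have w0 := width1_gt0; have r0 := rate1_gt0; have /andP[f0 f1] := four_gam.
have sR : 1 <= s%:R :> R by rewrite ler1n.
have aR : 1 <= a%:R :> R by rewrite ler1n.
have p1 : 1 <= p by apply: le_trans sp.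
have p0 : 0 < p by apply: lt_le_trans p1.
have n1 : 1 <= n%:R :> R by rewrite nE exprn_ege1.
have ngt0 : 0 < n%:R :> R by apply: lt_le_trans n1.
pose G : R := s%:R `^ gam; pose A : R := s%:R `^ eta.
pose P : R := n%:R `^ (1 - 2 / d%:R); pose Q : R := n%:R `^ (2 / d%:R).
pose al : R := a%:R `^ (2 / d%:R).
have G1 : 1 <= G by rewrite /G -[leLHS](powRr0 s%:R) ler_powR // ltW.
have A1 : 1 <= A by rewrite /A -[leLHS](powRr0 s%:R) ler_powR // ltW.
have al1 : 1 <= al by rewrite /al -[leLHS](powRr0 a%:R) ler_powR // ltW.
have G0 : 0 < G by apply: lt_le_trans G1.
have A0 : 0 < A by apply: lt_le_trans A1.
have al0 : 0 < al by apply: lt_le_trans al1.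
have Gp : G <= p ^+ 2.
  apply: (le_trans (y := s%:R ^+ 2)).
    by rewrite -powR_mulrn // ler_powR.
  by apply: lerXn2r; rewrite ?nnegrE // ltW.
have Q0 : 0 < Q by apply: powR_gt0.
have P0 : 0 < P by apply: powR_gt0.
have PQ : P * Q = n%:R.
  by rewrite -powRD ?subrK ?powRr1 // implybE (gt_eqF ngt0) orbT.
have Pp : p ^+ 12 <= P.
  have -> : p ^+ 12 = n%:R `^ (1 / 3).
    rewrite nE -!powR_mulrn ?(ltW p0) // -powRrM; congr (p `^ _).
    by lra.
  by rewrite ler_powR //; move: D1; lra.
have pP : p <= P by apply: le_trans Pp; rewrite ler_eXnr.
have sG : (4 * s)%N%:R `^ (- gam) = 4 `^ (- gam) / G :> R.
  by rewrite natrM powRM // [s%:R `^ _]powRN.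
have sN : s%:R `^ (- gam) = G^-1 :> R by rewrite powRN.
pose th := theta1 / G; pose x : R := n%:R / (a%:R * s%:R * G).
have th0 : 0 < th by apply: divr_gt0.
have th1 : th <= 1 by rewrite ler_pdivrMr // mul1r; apply: le_trans G1.
have asG0 : 0 < a%:R * s%:R * G.
  by rewrite mulr_gt0 // mulr_gt0 //; [apply: lt_le_trans aR|apply: lt_le_trans sR].
have thx : 1 <= th * x by exact: (theta_volume a0 s0 sp).
have x0 : 0 < x by rewrite divr_gt0.
have xd : x `^ (2 / d%:R) = Q / (al * G * A ^+ 2).
  by apply: volume_powR; [exact: ltW|rewrite ltr0n|rewrite ltr0n].
pose rho := (Num.truncn (rho1 * A)).+1.
have rhoA : rho1 * A <= rho%:R by apply/ltW/truncnS_gt.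
have rhoA2 : 0 <= (rho%:R : R) <= 2 * (rho1 * A).
  have CA : 2 * 1 <= rho1 * A by apply: ler_pM.
  have : (Num.truncn (rho1 * A))%:R <= rho1 * A.
    by rewrite truncn_le; apply: le_trans CA; rewrite mulr1.
  by rewrite ler0n /rho -natr1 /=; move: CA; lra.
have th01 : 0 < th <= 1 by rewrite th0.
have tl : 2 * d%:R * expR (1 - rho%:R / 2) <= th by exact: (tail_rho s0).
have [h [r [g [M [h0 g0 tail gle [VM mass tM h2]]]]]] :=
  scale_choice d3 th01 thx (ltn0Sn _ : (0 < rho)%N) tl.
have hR : 0 < h%:R :> R by rewrite ltr0n.
have hR2 : 0 < h%:R ^+ 2 :> R by rewrite exprn_gt0.
have {}h2 : h%:R ^+ 2 <= width1 * Q / (al * G).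
  by apply: (le_trans h2); rewrite xd; exact: width_le.
have h12 : 12 * h%:R ^+ 2 <= 4 `^ (- gam) * n%:R / G.
  by rewrite -PQ; exact: (width_steps h2 al1 G1 pP).
have h12n : 12 * h%:R ^+ 2 <= n%:R :> R.
  apply: (le_trans h12); rewrite ler_pdivrMr //.
  by rewrite mulrC ler_wpM2l ?(ltW ngt0) //; exact: le_trans G1.
have hn : (4 * h ^ 2 <= n)%N.
  rewrite -(ler_nat R) natrM natrX; apply: le_trans h12n.
  by rewrite ler_wpM2r ?(ltW hR2) // ler_nat.
have u0 : (0 < 2 * (a * s))%N by rewrite !muln_gt0 a0 s0.
have eu : expR (- (lam0 * (2 * (a * s))%N%:R)) <= th by exact: return_theta.
have Bn : (h ^ 2 <= n)%N by apply: leq_trans hn; rewrite leq_pmull.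
apply: (le_trans (y := Pr R n (fun w : word =>
   (size (heavy (2 * (a * s)) (trail 0%R w)) <= Num.truncn x)%N &&
    ((6 * h ^ 2)%N%:R + (18 + 4 * kap) * th * n%:R <
       excess R (2 * (2 * (a * s))) (trail 0 w))))).
  apply: le_Pr => // w _ /andP[big small]; apply/andP; split.
    rewrite truncn_ge_nat ?(ltW x0) // /x ler_pdivlMr //.
    have := le_trans (heavy_excess R (trail 0 w) (leq_pmull (a * s) (isT : 0 < 2)%N)) small.
    rewrite sN mulrC ler_pdivlMr // mul2n -addnn addnK !natrM => H; apply: le_trans H.
    by rewrite le_eqVlt; apply/orP; left; apply/eqP; ring.
  rewrite mulnA; apply: le_lt_trans big; rewrite sG natrM natrX /th theta1E.
  have k18 : 18 + 4 * kap != 0 by apply: lt0r_neq0; have := k1; lra.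
  have -> : (18 + 4 * kap) * (4 `^ (- gam) / (2 * (18 + 4 * kap)) / G) * n%:R =
      4 `^ (- gam) * n%:R / G / 2.
    by field; rewrite k18 (lt0r_neq0 G0).
  by rewrite [leRHS]mulrAC; move: h12; lra.
apply: (le_trans (excess_tail d3 th0 h0 u0 Bn g0 tail gle VM mass eu)).
apply: (le_trans (entropy_rate d3 th0 h0 hn tM)).
rewrite ler_expR -/al -/P.
have main := rate_le hR2 h2 al0 G0 (ltW P0) Q0; rewrite PQ in main.
have ent := entropy_le p1 nE ep G0 Gp Pp.
have ent2 : rate1 * P <= rate1 * al * P.
  by rewrite ler_wpM2r ?(ltW P0) // ler_peMr // ltW.
move: main ent ent2; rewrite -/th; lra.
Qed.

End low_levels.

Lemma count_mem_cons (T : eqType) (z : T) V s : z \notin V ->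
  count (mem (z :: V)) s = (count_mem z s + count (mem V) s)%N.
Proof.
move=> zV; elim: s => [//|x s IH] /=; rewrite IH in_cons.
case: eqP => [->|_] /=; last by rewrite addnCA.
by rewrite (negPf zV); lia.
Qed.

(** * Subsets with bounded sums of Green functions *)

Section sparse_sets.
Variables (R : realType) (d : nat).
Hypothesis d3 : (3 <= d)%N.
Local Notation kap := (kap R d).
Local Notation lam0 := (lam0 R d).
Local Notation point := 'rV[int]_d.
Local Notation word := (seq (step d)).
Let d0 : (0 < d)%N. Proof. exact: leq_trans d3. Qed.
Let k1 : 1 <= kap. Proof. exact: kap_ge1. Qed.
Variable n : nat.
Let c0 : R := 1 + 3 * kap.
Let c01 : 1 <= c0. Proof. by rewrite /c0 lerDl mulr_ge0 // (le_trans ler01 k1). Qed.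

Definition green_at (x : point) : R :=
  \sum_(0 <= i < n) Pr R i (fun w => pos w == x).

(** Adding the reflected term makes the interaction of two points symmetric by construction. *)
Definition green_sym (x : point) : R := green_at x + green_at (- x).

Lemma green_at_ge0 x : 0 <= green_at x.
Proof. by apply: sumr_ge0 => i _; exact: Pr_ge0. Qed.

Lemma green_sym_ge0 x : 0 <= green_sym x.
Proof. by rewrite addr_ge0 ?green_at_ge0. Qed.

Lemma green_symN x : green_sym (- x) = green_sym x.
Proof. by rewrite /green_sym opprK addrC. Qed.

Lemma sum_green_at (X : seq point) p : uniq X ->
  \sum_(x <- X) green_at (x - pos p) = green (fun x => (x \in X)%:R) 1 n p.
Proof.
move=> uX; rewrite /green_at exchange_big /=; apply: eq_bigr => i _.
rewrite /Pr -Ex_sum // muln1; apply: eq_Ex => w _; rewrite pos_cat.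
elim: X uX => [|x X IH] /=; first by rewrite big_nil.
move=> /andP[xX uX]; rewrite big_cons IH // in_cons.
have -> : (pos w == x - pos p) = (pos p + pos w == x).
  by rewrite eq_sym subr_eq eq_sym addrC.
case: eqP => [->|_] /=; last by rewrite add0r.
by rewrite (negPf xX) addr0.
Qed.

Lemma sum_green_le (X : seq point) h : (0 < h)%N -> uniq X ->
  (size X <= h ^ d)%N -> \sum_(x <- X) green_at x <= (h ^ 2)%:R * c0.
Proof.
move=> h0 uX sX; have := sum_green_at [::] uX; rewrite pos_nil => E.
rewrite (eq_bigr (fun x => green_at (x - 0))); last by move=> x _; rewrite subr0.
by rewrite E; exact: green_set.
Qed.

Lemma sum_green_sym_le (X : seq point) h y : (0 < h)%N -> uniq X ->
  (size X <= h ^ d)%N ->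
  \sum_(x <- X) green_sym (x - y) <= 2 * ((h ^ 2)%:R * c0).
Proof.
move=> h0 uX sX; rewrite big_split /= [2 * _]mulr_natl mulr2n; apply: lerD.
  rewrite -(big_map (fun x => x - y) predT green_at); apply: sum_green_le => //.
    by rewrite map_inj_uniq //; exact: addIr.
  by rewrite size_map.
rewrite -(big_map (fun x => - (x - y)) predT green_at); apply: sum_green_le => //.
  by rewrite map_inj_uniq // => u v /oppr_inj; exact: addIr.
by rewrite size_map.
Qed.

Lemma green_sym0 : green_sym 0 <= 2 * c0.
Proof.
have := @sum_green_sym_le [:: 0] 1 0 isT isT; rewrite exp1n => /(_ isT).
by rewrite big_seq1 subr0 mul1r.
Qed.

(** A point is tested only against those after it, so a list can be extended greedily at its head;
    symmetry of the interaction then controls the full double sum. *)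
Fixpoint spread (U : seq point) : bool :=
  if U is z :: U' then
    [&& z \notin U', \sum_(y <- U') green_sym (z - y) <= 1 & spread U']
  else true.

Lemma spread_uniq U : spread U -> uniq U.
Proof. by elim: U => [//|z U IH] /= /and3P[-> _ /IH]. Qed.

Lemma spread_maximal (A : seq point) : exists U, [/\ spread U, {subset U <= A} &
  forall z, z \in A -> z \notin U -> 1 <= \sum_(y <- U) green_sym (z - y)].
Proof.
suff H m U : (size A - size U <= m)%N -> spread U -> {subset U <= A} ->
    exists U, [/\ spread U, {subset U <= A} &
      forall z, z \in A -> z \notin U -> 1 <= \sum_(y <- U) green_sym (z - y)].
  by apply: (H (size A) [::]) => //; rewrite leq_subr.
elim: m U => [|m IH] U sm gU UA;
  have [/hasP[z zA /andP[zU zs]]|/hasPn nz] := boolP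
    (has (fun z => (z \notin U) && (\sum_(y <- U) green_sym (z - y) <= 1)) A).
- have := uniq_leq_size (_ : uniq (z :: U)) (_ : {subset z :: U <= A}).
  rewrite /= zU (spread_uniq gU) => /(_ isT) H.
  have : (size U < size A)%N.
    by apply: H => x; rewrite in_cons => /predU1P[->|/UA].
  by move: sm; lia.
- exists U; split=> // z zA zU; have := nz z zA; rewrite zU /= -ltNge; exact: ltW.
- apply: (IH (z :: U)) => //=; last 2 first.
  + by rewrite zU zs gU.
  + by move=> x; rewrite in_cons => /predU1P[->|/UA].
  by move: sm; lia.
- exists U; split=> // z zA zU; have := nz z zA; rewrite zU /= -ltNge; exact: ltW.
Qed.

(** The off-diagonal pairs are counted twice and give at most 2 per point, the diagonal [2 c0] per
    point. *)
Lemma spread_total U : spread U ->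
  \sum_(z <- U) \sum_(y <- U) green_sym (z - y) <= 4 * c0 * (size U)%:R.
Proof.
elim: U => [|z U IH] /=; first by rewrite big_nil mulr0.
move=> /and3P[_ zs /IH {}IH]; rewrite big_cons big_cons subrr.
have -> : \sum_(j <- U) \sum_(y <- z :: U) green_sym (j - y) =
    \sum_(j <- U) (green_sym (z - j) + \sum_(y <- U) green_sym (j - y)).
  by apply: eq_bigr => x _; rewrite big_cons -green_symN opprB.
rewrite [X in _ + X <= _]big_split /= -[(size U).+1%:R]natr1; move: green_sym0 zs IH c01.
move: (green_sym 0) (\sum_(y <- U) green_sym (z - y)) (\sum_(i <- U) _) (size U)%:R.
move=> a b c k; lra.
Qed.

Definition sparse (U : seq point) : bool :=
  uniq U && all (fun z => \sum_(y <- U) green_at (y - z) <= 8 * c0) U.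

Lemma sparse_subseq (U V : seq point) : subseq U V -> sparse V -> sparse U.
Proof.
move=> UV /andP[uV /allP sV]; apply/andP; split; first exact: subseq_uniq UV uV.
apply/allP => z zU; apply: le_trans (sV z (mem_subseq UV zU)).
have uU := subseq_uniq UV uV.
rewrite [leRHS](perm_big (U ++ [seq y <- V | y \notin U])).
  by rewrite big_cat /= lerDl sumr_ge0 // => y _; exact: green_at_ge0.
apply: uniq_perm => //; first rewrite cat_uniq uU filter_uniq // andbT.
  by apply/hasPn => y; rewrite mem_filter => /andP[].
move=> y; rewrite mem_cat mem_filter; case: (boolP (y \in U)) => //= yU.
exact: mem_subseq UV y yU.
Qed.

(* Half of a maximal spread subset is sparse, by Markov's inequality. *)
Lemma sparse_subset (A : seq point) h : (0 < h)%N -> uniq A ->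
  (size A <= h ^ d)%N ->
  exists U, [/\ sparse U, {subset U <= A} &
    (size A)%:R <= 6 * c0 * (h ^ 2)%:R * (size U)%:R].
Proof.
move=> h0 uA sA; have [W [gW WA maxW]] := spread_maximal A.
have uW := spread_uniq gW.
pose row z := \sum_(y <- W) green_sym (z - y).
pose U := [seq z <- W | row z <= 8 * c0].
(* By maximality every point of [A] outside [W] receives interaction at least 1 from [W], while a
   point of [W] gives at most [2 h^2 c0] to all of [A]; so [W] cannot be small. *)
have AW : (size A)%:R <= 3 * c0 * (h ^ 2)%:R * (size W)%:R.
  apply: (le_trans (y := \sum_(z <- A) ((z \in W)%:R + row z))).
    rewrite -sum1_size natr_sum big_seq [leRHS]big_seq; apply: ler_sum => z zA.
    case: (boolP (z \in W)) => zW; last by rewrite add0r; exact: maxW.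
    by rewrite lerDl sumr_ge0 // => y _; exact: green_sym_ge0.
  rewrite big_split /=.
  have E1 : \sum_(z <- A) (z \in W)%:R <= (size W)%:R :> R.
    rewrite -natr_sum ler_nat -big_mkcond sum1_count -size_filter.
    apply: uniq_leq_size; first exact: filter_uniq.
    by move=> z; rewrite mem_filter => /andP[].
  have E2 : \sum_(z <- A) row z <= 2 * ((h ^ 2)%:R * c0) * (size W)%:R.
    rewrite /row exchange_big /=.
    apply: (le_trans (y := \sum_(y <- W) 2 * ((h ^ 2)%:R * c0))).
      by apply: ler_sum => y _; exact: sum_green_sym_le.
    by rewrite big_const_seq count_predT iter_addr_0 mulr_natr.
  have h1 : 1 <= (h ^ 2)%:R :> R by rewrite ler1n expn_gt0 h0.
  have hc := mulr_ege1 c01 h1; have W0 : 0 <= (size W)%:R :> R by [].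
  move: E1 E2 hc W0; move: (\sum_(z <- A) _) (\sum_(z <- A) _) (size W)%:R.
  move: ((h ^ 2)%:R : R) => H a b m E1 E2 hc W0.
  apply: (le_trans (lerD E1 E2)); have := ler_wpM2r W0 hc; lra.
have rowE z : z \in W -> \sum_(y <- W) green_at (y - z) <= row z.
  move=> _; apply: ler_sum => y _; rewrite /green_sym opprB.
  by rewrite lerDr green_at_ge0.
have WU : (size W)%:R <= 2 * (size U)%:R :> R.
  have tot := spread_total gW.
  pose v : R := (count (fun z => ~~ (row z <= 8 * c0)) W)%:R.
  have WE : (size W)%:R = (size U)%:R + v by rewrite -natrD size_filter count_predC.
  have H : 8 * c0 * v <= 4 * c0 * (size W)%:R.
    apply: le_trans tot; rewrite /v -sum1_count natr_sum mulr_sumr big_mkcond.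
    apply: ler_sum => z _; rewrite -/(row z).
    case: (leP (row z) (8 * c0)) => [_|/ltW rz] /=; last by rewrite mulr1.
    by rewrite ?mulr0; apply: sumr_ge0 => y _; exact: green_sym_ge0.
  have c00 : 0 < 4 * c0 by rewrite mulr_gt0 // (lt_le_trans ltr01).
  have : v * 2 <= (size W)%:R by rewrite -(ler_pM2l c00); lra.
  by rewrite WE; lra.
exists U; split.
- have: subseq U W by exact: filter_subseq.
  move=> UW; have uU := subseq_uniq UW uW.
  rewrite /sparse uU; apply/allP => z zU.
  have zW := mem_subseq UW zU; move: zU; rewrite mem_filter => /andP[rz _].
  apply: le_trans rz; apply: le_trans (rowE z zW).
  rewrite /U big_filter big_mkcond; apply: ler_sum => y _.
  by case: ifP => // _; exact: green_at_ge0.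
- by move=> z; rewrite mem_filter => /andP[_ /WA].
apply: (le_trans AW).
have -> : 6 * c0 * (h ^ 2)%:R * (size U)%:R = 3 * c0 * (h ^ 2)%:R * (2 * (size U)%:R) by ring.
by rewrite ler_wpM2l // !mulr_ge0 // (le_trans ler01 c01).
Qed.

(** On [U] the Green sums are at most [8 c0], whence the parameter [lam0 / 8]. The walk starts at
    the origin, possibly off [U]; there each point is bounded separately, at the price of a factor
    linear in [size U]. *)
Lemma sparse_visits (U : seq point) : sparse U ->
  Ex n (fun w => expR (lam0 / 8 * (count (mem U) (trail 0 w))%:R)) <=
  1 + (size U)%:R.
Proof.
move=> /andP[uU /allP sU]; have lE := lam0E R d3; have l0 := lam0_gt0 R d3.
have l1 := lam0_le R d3.
have green_n q k : (k <= n)%N -> green (fun x => (x \in U)%:R) 1 k q <=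
    \sum_(x <- U) green_at (x - pos q) :> R.
  by move=> kn; rewrite sum_green_at //; apply: green_nonneg_widen.
have lc : lam0 * c0 = 1 / 4 by move: lE; rewrite -/c0; lra.
have H q k : (k <= n)%N -> pos q \in U ->
    4 * (lam0 / 8) * green (fun x => (x \in U)%:R) 1 k q <= 1.
  move=> kn qU; have := le_trans (green_n q k kn) (sU _ qU).
  by move=> /(ler_wpM2l (ltW l0)); lra.
have := @Ex_expR_visits R d d3 U (lam0 / 8) n [::] _ H; rewrite pos_nil => E.
apply: (le_trans (E _)); first by lra.
rewrite lerD2l; have := green_n [::] n (leqnn n); rewrite pos_nil => G.
have G2 : \sum_(x <- U) green_at (x - 0) <= 2 * c0 * (size U)%:R.
  apply: (le_trans (y := \sum_(x <- U) 2 * c0)).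
    apply: ler_sum => x _; rewrite subr0.
    have := @sum_green_le [:: x] 1 isT isT; rewrite exp1n big_seq1 mul1r => /(_ isT).
    by have := c01; lra.
  by rewrite big_const_seq count_predT iter_addr_0 mulr_natr.
have := ler_wpM2l (ltW l0) (le_trans G G2).
have -> : lam0 * (2 * c0 * (size U)%:R) = 2 * (lam0 * c0) * (size U)%:R by ring.
rewrite lc; have : 0 <= (size U)%:R :> R by [].
lra.
Qed.

(** With [h] about [|A|^(1/d)], the heavy set [A] contains a sparse set of at least
    [|A|^(1-2/d) / (24 c0)] points, where [24 = 6 * 2^2] as [h <= 2 y]. Exactly [m] of them are
    kept, so that the union bound runs over lists of fixed length. *)
Lemma high_count (v : R) (t m : nat) : 0 < v -> (0 < m)%N ->
  m%:R <= Num.max 1 (v `^ (1 - 2 / d%:R) / (24 * c0)) ->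
  Pr R n (fun w : word => v <= (size (heavy t.+1 (trail 0 w)))%:R) <=
  ((2 * n).+1 ^ (d * m))%:R * ((1 + m%:R) * expR (- (lam0 / 8 * (m * t.+1)%N%:R))).
Proof.
move=> v0 m0 mv; have l0 := lam0_gt0 R d3.
pose LL := [seq U <- lists m (box d n) | sparse U && (size U == m)].
apply: (le_trans (y := Pr R n (fun w => has (fun U =>
   lam0 / 8 * (m * t.+1)%N%:R <= lam0 / 8 * (count (mem U) (trail 0 w))%:R) LL))).
  apply: le_Pr => // w sw; set A := heavy _ _ => vA.
  have uA : uniq A by exact: heavy_uniq.
  have A0 : 1 <= (size A)%:R :> R.
    by rewrite ler1n -(ltr_nat R); apply: lt_le_trans v0 vA.
  pose y : R := (size A)%:R `^ (1 / d%:R).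
  have dR : 0 < d%:R :> R by rewrite ltr0n.
  have y1 : 1 <= y by rewrite -[leLHS](powRr0 (size A)%:R) ler_powR // divr_ge0.
  have yd : y ^+ d = (size A)%:R.
    by rewrite -powR_mulrn ?powR_ge0 // -powRrM divfK ?gt_eqF // powRr1.
  have y2 : y ^+ 2 = (size A)%:R `^ (2 / d%:R).
    by rewrite -powR_mulrn ?powR_ge0 // -powRrM mulrAC mul1r.
  pose h := (Num.truncn y).+1; have hy : y <= h%:R by apply/ltW/truncnS_gt.
  have hy2 : h%:R <= 2 * y.
    have : (Num.truncn y)%:R <= y by rewrite truncn_le (le_trans ler01).
    by rewrite /h -natr1; move: y1; lra.
  have sA : (size A <= h ^ d)%N.
    rewrite -(ler_nat R) natrX -yd; apply: lerXn2r; rewrite ?nnegrE //.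
    exact: le_trans y1.
  have [U [spU UA AU]] := sparse_subset (ltn0Sn _ : (0 < h)%N) uA sA.
  have mU : (m <= size U)%N.
    rewrite -(ler_nat R); apply: (le_trans mv); rewrite ge_max; apply/andP; split.
      rewrite ler1n lt0n; apply: contraTneq AU => ->; rewrite mulr0 -ltNge.
      exact: lt_le_trans A0.
    have c00 : 0 < 24 * c0 by rewrite mulr_gt0 // (lt_le_trans ltr01).
    rewrite ler_pdivrMr //; apply: (le_trans (y := (size A)%:R `^ (1 - 2 / d%:R))).
      apply: ge0_ler_powR; rewrite ?nnegrE ?(ltW v0) //.
      rewrite subr_ge0 ler_pdivrMr // mul1r ler_nat; exact: leq_trans d3.
    have An0 : (size A)%:R != 0 :> R by apply: lt0r_neq0; exact: lt_le_trans A0.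
    have yy : 0 < y ^+ 2 by rewrite exprn_gt0 // (lt_le_trans ltr01).
    rewrite powRB ?An0 ?implybT // powRr1 // -y2 ler_pdivrMr //.
    apply: (le_trans AU).
    have -> : (size U)%:R * (24 * c0) * y ^+ 2 = 6 * c0 * (2 * y) ^+ 2 * (size U)%:R.
      by ring.
    rewrite ler_wpM2r // ler_wpM2l ?natrX //.
      by rewrite mulr_ge0 // (le_trans ler01 c01).
    apply: lerXn2r; rewrite ?nnegrE //.
    exact: le_trans hy2.
  pose V := take m U; have VU : subseq V U by exact: take_subseq.
  have sV : size V = m by rewrite size_takel.
  apply/hasP; exists V.
    rewrite mem_filter sV eqxx (sparse_subseq VU spU) mem_lists // => z zV.
    apply: mem_box; have := UA z (mem_subseq VU zV).
    rewrite /A mem_heavy // => tz; rewrite -sw; apply: inbox_trail.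
    by rewrite -has_pred1 has_count; apply: leq_trans tz.
  rewrite ler_pM2l ?divr_gt0 // ler_nat.
  have -> : count (mem V) (trail 0 w) = (\sum_(z <- V) count_mem z (trail 0 w))%N.
    have /andP[uV _] := sparse_subseq VU spU.
    elim: (V) uV => [_|z V' IH]; first by rewrite big_nil; exact: count_pred0.
    by rewrite cons_uniq => /andP[zV' /IH E]; rewrite big_cons -E count_mem_cons.
  rewrite -sV -sum1_size big_distrl /= big_seq [leqRHS]big_seq.
  apply: leq_sum => z zV; have := UA z (mem_subseq VU zV).
  by rewrite /A mem_heavy // mul1n.
apply: (le_trans (@Pr_has R d d0 _ _ LL (fun U w => lam0 / 8 * (m * t.+1)%N%:R <=
   lam0 / 8 * (count (mem U) (trail 0 w))%:R))).
apply: (le_trans (y := \sum_(U <- LL)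
   (1 + m%:R) * expR (- (lam0 / 8 * (m * t.+1)%N%:R)))).
  rewrite !big_seq; apply: ler_sum => U; rewrite mem_filter.
  move=> /andP[/andP[spU /eqP sU] _].
  apply: (le_trans (Pr_expR _ _ _)) => //; rewrite mulrC ler_wpM2r ?expR_ge0 //.
  by rewrite -sU; exact: sparse_visits.
rewrite big_const_seq count_predT iter_addr_0 -[leLHS]mulr_natl ler_wpM2r //.
rewrite ler_nat size_filter; apply: leq_trans (count_size _ _) _.
by rewrite size_lists size_box -expnM.
Qed.

End sparse_sets.

(** * Levels above the threshold, and the search for a critical level *)

Section high_levels.
Variables (R : realType) (d : nat) (gam : R).
Hypothesis d3 : (3 <= d)%N.
Hypotheses (gam0 : 0 < gam) (gamd : gam * (1 - 2 / d%:R) < 2 / d%:R).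
Local Notation kap := (kap R d).
Local Notation lam0 := (lam0 R d).
Local Notation word := (seq (step d)).
Let d0 : (0 < d)%N. Proof. exact: leq_trans d3. Qed.
Let k1 : 1 <= kap. Proof. exact: kap_ge1. Qed.
Let l0 : 0 < lam0. Proof. exact: lam0_gt0. Qed.
Let d3R : 3 <= d%:R :> R. Proof. by rewrite ler_nat. Qed.
Let dR : 0 < d%:R :> R. Proof. by rewrite ltr0n. Qed.

(** From [t] to [4 t] the excess drops by a fraction [1 - 4^(-gam)] of the threshold, and each site
    accounts for at most [3 t] of the drop. *)
Definition share2 : R := (1 - 4 `^ (- gam)) / 3.
Definition rate2 : R := lam0 * share2 / (32 * (24 * (1 + 3 * kap))).

Lemma share2_bounds : 0 < share2 <= 1.
Proof.
have f1 : 4 `^ (- gam) < 1.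
  rewrite powRN invf_lt1 ?powR_gt0 // -[ltLHS](powRr0 4).
  rewrite -ltr_ln ?posrE ?powR_gt0 // !ln_powR mul0r mulr_gt0 //.
  by rewrite ln_gt0 //; lra.
have f0 : 0 < 4 `^ (- gam) by apply: powR_gt0.
by rewrite /share2; lra.
Qed.

Lemma rate2_gt0 : 0 < rate2.
Proof.
have /andP[s0 _] := share2_bounds; have c0 : 0 < 1 + 3 * kap by have := k1; lra.
apply: divr_gt0; first exact: mulr_gt0.
by rewrite mulr_gt0 // mulr_gt0.
Qed.

Lemma share2E : share2 = (1 - 4 `^ (- gam)) / 3. Proof. by []. Qed.
Lemma rate2E : rate2 = lam0 * share2 / (32 * (24 * (1 + 3 * kap))). Proof. by []. Qed.
Opaque share2 rate2.

Lemma ln_steps_sqrt (n : nat) (p : R) : 1 <= p -> n%:R = p ^+ 36 ->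
  ln (2 * n).+1%:R <= 74 * Num.sqrt p.
Proof.
move=> p1 nE; have p0 : 0 < p by lra.
have s1 : 1 <= Num.sqrt p by rewrite -[leLHS]sqrtr1 ler_wsqrtr.
have s0 : 0 < Num.sqrt p by lra.
apply: (le_trans (y := ln (3 * p ^+ 36))).
  rewrite ler_ln ?posrE ?mulr_gt0 ?exprn_gt0 // -nE -natrM ler_nat.
  have : (0 < n)%N by rewrite -(ltr_nat R) nE exprn_gt0.
  by clear; lia.
rewrite lnM ?posrE ?exprn_gt0 // lnXn //.
have : ln (3 : R) <= 2.
  have := @le_ln1Dx R 2 ltac:(lra); congr (_ <= _); congr ln; lra.
have -> : ln p = ln (Num.sqrt p) *+ 2 by rewrite -lnXn // sqr_sqrtr // ltW.
have := ln_sublinear s0; rewrite -mulrnA -[_ *+ (2 * 36)]mulr_natl; lra.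
Qed.

Lemma excess_gap t (s : seq 'rV[int]_d) : excess R t s - excess R (4 * t) s <=
  (3 * t)%N%:R * (size (heavy t.+1 s))%:R.
Proof.
rewrite /excess /occ -sumrB size_filter -sum1_count natr_sum mulr_sumr big_mkcond.
rewrite [leRHS]big_mkcond /=; apply: ler_sum => z _.
case: (ltnP t (count_mem z s)) => tc.
  rewrite mulr1 -natrB; last by lia.
  by rewrite ler_nat; lia.
have -> : (count_mem z s - t = 0)%N by lia.
have -> : (count_mem z s - 4 * t = 0)%N by lia.
by rewrite subrr.
Qed.

(** The exponent identity of the low levels gives a surplus [s^(2 eta) >= 1], which is dropped;
    [share2 <= 1] allows its power to be replaced by itself. *)
Lemma share_volume (N a s P Q al : R) : 0 < N -> 1 <= a -> 1 <= s ->
  P * Q = N -> Q = N `^ (2 / d%:R) -> al = a `^ (2 / d%:R) ->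
  share2 * (al * P) <=
  a * s * (share2 * (N / (a * s * s `^ gam))) `^ (1 - 2 / d%:R).
Proof.
move=> N0 a1 s1 PQ QE alE; have /andP[c0 c1] := share2_bounds.
have a0 : 0 < a by lra.
have s0 : 0 < s by lra.
have G0 := powR_gt0 gam s0; have A0 := powR_gt0 (eta d gam) s0.
have A1 : 1 <= s `^ eta d gam.
  by rewrite -[leLHS](powRr0 s) ler_powR // ltW //; exact: eta_gt0.
have D1 : 2 / d%:R <= 1 :> R by rewrite ler_pdivrMr //; have := d3R; lra.
have D0 : 0 < 2 / d%:R :> R by rewrite divr_gt0.
set x := N / (a * s * s `^ gam).
have x0 : 0 < x by rewrite divr_gt0 // mulr_gt0 // mulr_gt0.
have Q0 : 0 < Q by rewrite QE powR_gt0.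
have al0 : 0 < al by rewrite alE powR_gt0.
have P0 : 0 < P by rewrite -(pmulr_lgt0 _ Q0) PQ.
rewrite powRM ?(ltW c0) ?(ltW x0) //.
have xE : a * s * x `^ (1 - 2 / d%:R) = al * P * (s `^ eta d gam) ^+ 2.
  rewrite powRB ?(lt0r_neq0 x0) ?implybT // powRr1 ?(ltW x0) //.
  rewrite volume_powR ?(ltW N0) // -QE -alE /x -PQ.
  by field; rewrite !gt_eqF.
rewrite [leRHS]mulrCA xE; apply: ler_pM.
- exact: ltW.
- by rewrite mulr_ge0 // ltW.
- by apply: ger1_powR; [rewrite c0|lra].
by rewrite ler_peMr ?mulr_ge0 ?(ltW al0) ?(ltW P0) // exprn_ege1.
Qed.

Lemma high_rate (c0 lam m t mu L : R) : 0 < c0 -> 0 < lam -> 1 <= m -> 0 <= t ->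
  mu <= 2 * m -> L + 1 <= lam / 2 * t -> m * (L + 1 - lam * t) <= - (lam / 4 * (t * mu)).
Proof.
move=> c0p lam0p m1 t0 mum Lt.
have m0 : 0 <= m by lra.
have lt0 : 0 <= lam / 4 * t by rewrite mulr_ge0 // ltW // divr_gt0.
have := ler_wpM2l m0 Lt; have := ler_wpM2l lt0 mum; lra.
Qed.

(** Here [t = a s] is at least [n^(1/36)], so half of the exponent [lam0 t / 8] gained at each
    listed site pays for the entropy [d ln (2n+1)] of choosing it. *)
Lemma high_level_fixed (a s n : nat) (p : R) : (0 < a)%N -> (0 < s)%N ->
  1 <= p -> p <= s%:R -> n%:R = p ^+ 36 -> 1200 * d%:R <= lam0 * Num.sqrt p ->
  Pr R n (fun w : word =>
    (s%:R `^ (- gam) * n%:R < excess R (a * s) (trail 0 w)) &&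
    (excess R (4 * (a * s)) (trail 0 w) <= (4 * s)%N%:R `^ (- gam) * n%:R)) <=
  expR (- (rate2 * a%:R `^ (2 / d%:R) * n%:R `^ (1 - 2 / d%:R))).
Proof.
move=> a0 s0 p1 ps nE pl; set t := (a * s)%N.
have /andP[c0 c1] := share2_bounds.
have t0 : (0 < t)%N by rewrite muln_gt0 a0.
have aR : 1 <= a%:R :> R by rewrite ler1n.
have sR : 1 <= s%:R :> R by rewrite ler1n.
have s0R : 0 < s%:R :> R by apply: lt_le_trans sR.
have n0 : 0 < n%:R :> R by rewrite nE exprn_gt0 // (lt_le_trans ltr01).
have G0 := powR_gt0 gam s0R.
pose x : R := n%:R / (a%:R * s%:R * s%:R `^ gam).
pose v := share2 * x.
have x0 : 0 < x by rewrite divr_gt0 // mulr_gt0 // mulr_gt0 // ltr0n.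
have v0 : 0 < v by apply: mulr_gt0.
pose cc : R := 1 + 3 * kap.
have cc0 : 0 < cc by have := k1; rewrite /cc; lra.
pose mu := v `^ (1 - 2 / d%:R) / (24 * cc).
have mu0 : 0 <= mu by rewrite divr_ge0 ?powR_ge0 // mulr_ge0 // ltW.
pose m := maxn 1 (Num.truncn mu).
have m0 : (0 < m)%N by rewrite leq_maxl.
have m1 : 1 <= m%:R :> R by rewrite ler1n.
have mmu : m%:R <= Num.max 1 mu.
  rewrite /m le_max /maxn; case: ifP => _; last by rewrite lexx.
  by rewrite truncn_le mu0 orbT.
have mu2 : mu <= 2 * m%:R.
  have : mu <= (Num.truncn mu).+1%:R by apply/ltW/truncnS_gt.
  have : (Num.truncn mu)%:R <= m%:R :> R by rewrite ler_nat leq_maxr.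
  by rewrite -[(Num.truncn mu).+1%:R]natr1; move: m1; lra.
apply: (le_trans (y := Pr R n (fun w : word =>
    v <= (size (heavy t.+1 (trail 0 w)))%:R))).
  apply: le_Pr => // w _ /andP[big small].
  have gap := excess_gap t (trail 0 w).
  have tR : 0 < (3 * t)%N%:R :> R by rewrite ltr0n muln_gt0.
  rewrite -(ler_pM2l tR); apply: le_trans gap.
  apply: (le_trans (y := s%:R `^ (- gam) * n%:R - (4 * s)%N%:R `^ (- gam) * n%:R)); last first.
    by apply: lerD; [exact: ltW|rewrite lerN2].
  rewrite [(4 * s)%:R]natrM powRM // [s%:R `^ _]powRN /v /x share2E !natrM le_eqVlt.
  apply/orP; left; apply/eqP; field.
  by rewrite !gt_eqF // ltr0n.
apply: (le_trans (@high_count R d d3 n v t m v0 m0 mmu)).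
have lnn := ln_steps_sqrt p1 nE.
pose L := d%:R * ln (2 * n).+1%:R : R.
have ln0 : 0 <= ln (2 * n).+1%:R :> R by rewrite ln_ge0 // ler1n.
have s1 : 1 <= Num.sqrt p by rewrite -[leLHS]sqrtr1 ler_wsqrtr.
have tp : p <= t%:R by rewrite /t natrM; apply: le_trans ps _; rewrite ler_peMl.
have Lt : L + 1 <= lam0 / 8 / 2 * t%:R.
  have p0 : 0 <= p by apply: le_trans p1.
  have H : 1200 * d%:R * Num.sqrt p <= lam0 * p.
    by rewrite -[in leRHS](sqr_sqrtr p0) expr2 mulrA ler_wpM2r ?sqrtr_ge0.
  have H2 : lam0 * p <= lam0 * t%:R by rewrite ler_wpM2l // ltW.
  have H3 : L <= 74 * d%:R * Num.sqrt p.
    by rewrite /L -mulrA mulrCA ler_wpM2l // mulrC.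
  have H4 : 1 * 1 <= d%:R * Num.sqrt p by apply: ler_pM; rewrite ?ler1n.
  have -> : lam0 / 8 / 2 * t%:R = lam0 * t%:R / 16 by field.
  move: H H2 H3 H4; move: (lam0 * t%:R) (lam0 * p) L => u u' u''.
  rewrite mulr1 -!mulrA; move: (d%:R * Num.sqrt p) => y; lra.
apply: (le_trans (y := expR (m%:R * (L + 1 - lam0 / 8 * t%:R)))).
  have e1 : ((2 * n).+1 ^ (d * m))%:R = expR (m%:R * L) :> R.
    rewrite natrX -[X in X ^+ _](@lnK R) ?posrE ?ltr0n // -expRM_natl /L.
    by rewrite mulrA natrM [d%:R * _]mulrC.
  have e2 : 1 + m%:R <= expR (m%:R : R) by exact: expR_ge1Dx.
  rewrite e1 mulrBr mulrDr mulr1 -addrA !expRD.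
  rewrite ler_wpM2l ?expR_ge0 //; apply: ler_pM; rewrite ?expR_ge0 ?addr_ge0 //.
  rewrite ler_expR lerN2 natrM [leRHS]mulrCA ler_wpM2l // ler_wpM2l ?divr_ge0 ?(ltW l0) //.
  by rewrite ler_nat.
rewrite ler_expR; apply: (le_trans (high_rate cc0 _ m1 _ mu2 Lt)) => //.
  by rewrite divr_gt0.
rewrite lerN2.
have n1 : n%:R != 0 :> R by apply: lt0r_neq0.
have PQ : n%:R `^ (1 - 2 / d%:R) * n%:R `^ (2 / d%:R) = n%:R :> R.
  by rewrite -powRD ?subrK ?powRr1 // n1 implybT.
have := share_volume n0 aR sR PQ erefl erefl; rewrite -/x -/v => sv.
have -> : rate2 * a%:R `^ (2 / d%:R) * n%:R `^ (1 - 2 / d%:R) =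
   lam0 / (32 * (24 * cc)) * (share2 * (a%:R `^ (2 / d%:R) * n%:R `^ (1 - 2 / d%:R))).
  by rewrite rate2E /cc; ring.
have -> : lam0 / 8 / 4 * (t%:R * mu) =
   lam0 / (32 * (24 * cc)) * (a%:R * s%:R * v `^ (1 - 2 / d%:R)).
  by rewrite /mu /t natrM; field; rewrite gt_eqF.
by rewrite ler_wpM2l // divr_ge0 ?(ltW l0) // mulr_ge0 // mulr_ge0 // ltW.
Qed.

Definition fail (a n : nat) (w : word) (j : nat) : bool :=
  (4 ^ j)%N%:R `^ (- gam) * n%:R < excess R (a * 4 ^ j) (trail 0 w).

Lemma fail0 a n (w : word) : size w = n -> ~~ fail a n w 0.
Proof.
move=> sw; rewrite /fail expn0 powR1 mul1r -leNgt muln1.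
by apply: le_trans (excess_le_size _ _ _) _; rewrite size_trail sw.
Qed.

Lemma fail_large a n (w : word) j : (0 < a)%N -> size w = n -> (n <= j)%N ->
  ~~ fail a n w j.
Proof.
move=> a0 sw nj; rewrite /fail -leNgt /excess /occ big1 ?mulr_ge0 ?powR_ge0 //.
move=> z _; apply/eqP; rewrite pnatr_eq0 subn_eq0.
apply: leq_trans (count_size _ _) _; rewrite size_trail sw.
apply: leq_trans nj _; apply: leq_trans (ltnW (ltn_expl j (isT : 1 < 4)%N)) _.
by rewrite leq_pmull.
Qed.

(* Below the threshold the first failing level is preceded by a level that
   holds; above it, the last failing level is followed by one that holds. *)
Lemma first_failure a n (w : word) j : (0 < a)%N -> size w = n -> fail a n w j ->
  exists2 i, (i < n)%N &
    [&& ((4 ^ i) ^ 36 <= n)%N, fail a n w i.+1 & ~~ fail a n w i] ||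
    [&& (n < (4 ^ i) ^ 36)%N, fail a n w i & ~~ fail a n w i.+1].
Proof.
move=> a0 sw fj.
have bnd i : fail a n w i -> (i < n)%N.
  by rewrite ltnNge; apply: contraTN => ni; exact: fail_large.
have exf : exists i, fail a n w i by exists j.
have [J fJ maxJ] := ex_maxnP exf (fun i fi => ltnW (bnd i fi)).
case: (ltnP n ((4 ^ J) ^ 36)) => HJ.
  exists J; first exact: bnd.
  by rewrite HJ fJ /= orbC; apply/orP; left; apply/negP => fJ1; have := maxJ _ fJ1; rewrite ltnn.
have [i fi mini] := ex_minnP exf.
have iJ := mini J fJ.
case: i fi mini iJ => [|i] fi mini iJ; first by have := fail0 a sw; rewrite fi.
exists i; first by apply: leq_trans (bnd _ fi).
rewrite fi /= (leq_trans _ HJ) /=; last first.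
  by rewrite leq_exp2r // leq_exp2l // ltnW.
by apply/orP; left; apply/negP => fi'; have := mini _ fi'; rewrite ltnn.
Qed.

End high_levels.

(** * Union over all levels *)

Section level_tails.
Variables (R : realType) (d : nat) (gam : R).
Hypothesis d3 : (3 <= d)%N.
Hypotheses (gam0 : 0 < gam) (gamd : gam * (1 - 2 / d%:R) < 2 / d%:R).
Local Notation kap := (kap R d).
Local Notation lam0 := (lam0 R d).
Local Notation word := (seq (step d)).
Let d0 : (0 < d)%N. Proof. exact: leq_trans d3. Qed.

Lemma large_root36 (X : R) : exists n0 : nat, forall n, (n0 <= n)%N ->
  exists2 p : R, n%:R = p ^+ 36 & X <= p.
Proof.
exists (Num.truncn (Num.max 0 X ^+ 36)).+1 => n nX.
exists (n%:R `^ (1 / 36)).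
  by rewrite -powR_mulrn ?powR_ge0 // -powRrM divfK // powRr1.
have Y0 : 0 <= Num.max 0 X by rewrite le_max lexx.
apply: (le_trans (y := Num.max 0 X)); first by rewrite le_max lexx orbT.
have -> : Num.max 0 X = (Num.max 0 X ^+ 36) `^ (1 / 36).
  by rewrite -powR_mulrn // -powRrM mulrCA mulfV // mulr1 powRr1.
apply: ge0_ler_powR; rewrite ?nnegrE ?exprn_ge0 //.
apply: le_trans (_ : _ <= (Num.truncn (Num.max 0 X ^+ 36)).+1%:R) _.
  exact/ltW/truncnS_gt.
by rewrite ler_nat.
Qed.

Lemma union_levels (c Y p : R) (n : nat) : 1 <= p -> n%:R = p ^+ 36 ->
  148 <= c * p -> 0 < c -> p ^+ 12 <= Y ->
  n%:R * expR (- (c * Y)) <= expR (- (c / 2 * Y)).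
Proof.
move=> p1 nE cp c0 pY; have p0 : 0 < p by apply: lt_le_trans p1.
have lnn := ln_steps_sqrt p1 nE.
have sp : Num.sqrt p <= p.
  rewrite -[leRHS](ger0_norm (ltW p0)) -sqrtr_sqr ler_wsqrtr //.
  by rewrite expr2 ler_peMr // ltW.
have nn : n%:R <= expR (74 * p).
  apply: (le_trans (y := expR (ln (2 * n).+1%:R))).
    by rewrite lnK ?posrE ?ltr0n // ler_nat; lia.
  by rewrite ler_expR; apply: (le_trans lnn); rewrite ler_wpM2l.
apply: (le_trans (ler_wpM2r (expR_ge0 _) nn)).
rewrite -expRD ler_expR.
have pp : p ^+ 2 <= Y by apply: le_trans pY; rewrite ler_weXn2l.
have : 148 * p <= c * p * p by rewrite ler_wpM2r // ltW.
have := ler_wpM2l (ltW c0) pp; rewrite expr2 mulrA; lra.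
Qed.

(** The constant [c] does not depend on [a]; only [n0] does. This uniformity yields the power of
    [xi] in the upper bound and the arbitrarily large rate for truncated sums. *)
Lemma level_tails : exists c : R, 0 < c /\ exists a0 : nat, (0 < a0)%N /\
  forall a, (a0 <= a)%N -> exists n0 : nat, forall n, (n0 <= n)%N ->
  Pr R n (fun w : word => has (fail gam a n w) (iota 0 n)) <=
  expR (- (c * (a%:R `^ (2 / d%:R) * n%:R `^ (1 - 2 / d%:R)))).
Proof.
pose c := Num.min (rate1 d gam) (rate2 d gam).
have r1 := rate1_gt0 d3 gam0 gamd; have r2 := rate2_gt0 d3 gam0.
have l0 := lam0_gt0 R d3; have /andP[t0 t1] := theta1_bounds d3 gam0.
have w0 := width1_gt0 d3 gam0 gamd; have /andP[f0 f1] := four_gam gam0.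
have c0 : 0 < c by rewrite lt_min r1 r2.
exists (c / 2); split; first by rewrite divr_gt0.
exists (Num.truncn ((gam - ln (theta1 d gam)) / (2 * lam0))).+1; split => // a aa.
have a0 : (0 < a)%N by apply: leq_ltn_trans aa.
have aC : gam - ln (theta1 d gam) <= lam0 * (2 * a%:R).
  rewrite mulrCA mulrA mulrC -ler_pdivrMr ?mulr_gt0 //.
  apply: (le_trans (ltW (truncnS_gt _))); by rewrite ler_nat.
have [n0 Hn] := large_root36 (1 + a%:R / theta1 d gam + 12 * width1 d gam / 4 `^ (- gam) +
  (3 + 38 * d%:R / theta1 d gam) / rate1 d gam + (1200 * d%:R / lam0) ^+ 2 + 148 / c).
exists n0 => n /Hn[p nE].
have e1 : 0 <= a%:R / theta1 d gam by rewrite divr_ge0 // ltW.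
have e2 : 0 <= 12 * width1 d gam / 4 `^ (- gam).
  by rewrite divr_ge0 ?(ltW f0) // mulr_ge0 // ltW.
have e3 : 0 <= (3 + 38 * d%:R / theta1 d gam) / rate1 d gam.
  by rewrite divr_ge0 ?(ltW r1) // addr_ge0 // divr_ge0 ?(ltW t0) // mulr_ge0.
have e4 : 0 <= (1200 * d%:R / lam0) ^+ 2 by exact: sqr_ge0.
have e5 : 0 <= 148 / c by rewrite divr_ge0 // ltW.
move: e1 e2 e3 e4 e5.
set u1 := a%:R / _; set u2 := 12 * _ / _; set u3 := (3 + _) / _; set u4 := _ ^+ 2.
set u5 := 148 / c => e1 e2 e3 e4 e5 up.
have p1 : 1 <= p by apply: le_trans up; lra.
have up1 : u1 <= p by apply: le_trans up; lra.
have up2 : u2 <= p by apply: le_trans up; lra.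
have up3 : u3 <= p by apply: le_trans up; lra.
have up4 : u4 <= p by apply: le_trans up; lra.
have up5 : u5 <= p by apply: le_trans up; lra.
clear up e1 e2 e3 e4 e5.
have p0 : 0 < p by apply: lt_le_trans p1.
have div_le (x y : R) : 0 < y -> x / y <= p -> x <= y * p.
  by move=> y0; rewrite ler_pdivrMr // mulrC.
have {}up1 := div_le _ _ t0 up1; have {}up2 := div_le _ _ f0 up2.
have {}up3 := div_le _ _ r1 up3; have {}up5 := div_le _ _ c0 up5.
have {}up4 : 1200 * d%:R <= lam0 * Num.sqrt p.
  rewrite [leRHS]mulrC -ler_pdivrMr //.
  have E : 0 <= 1200 * d%:R / lam0.
    exact: divr_ge0 (mulr_ge0 (ler0n _ _) (ler0n _ _)) (ltW l0).
  by rewrite -(ger0_norm E) -sqrtr_sqr ler_wsqrtr.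
pose al : R := a%:R `^ (2 / d%:R); pose P : R := n%:R `^ (1 - 2 / d%:R).
rewrite -/al -/P.
have /andP[D0 D1] := two_div_d R d3.
have al1 : 1 <= al by rewrite /al -[leLHS](powRr0 a%:R) ler_powR ?ler1n // ltW.
have n1 : 1 <= n%:R :> R by rewrite nE exprn_ege1.
have P12 : p ^+ 12 <= P.
  have -> : p ^+ 12 = n%:R `^ (1 / 3).
    by rewrite nE -!powR_mulrn ?(ltW p0) // -powRrM; congr (p `^ _); lra.
  by rewrite ler_powR //; lra.
have P0 : 0 <= P by exact: powR_ge0.
have alP0 : 0 <= al * P by rewrite mulr_ge0 // powR_ge0.
have alP : p ^+ 12 <= al * P by apply: (le_trans P12); rewrite ler_peMl.
pose A (i : nat) (w : word) :=
  [&& ((4 ^ i) ^ 36 <= n)%N, fail gam a n w i.+1 & ~~ fail gam a n w i] ||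
  [&& (n < (4 ^ i) ^ 36)%N, fail gam a n w i & ~~ fail gam a n w i.+1].
apply: (le_trans (y := Pr R n (fun w : word => has (A^~ w) (iota 0 n)))).
  apply: le_Pr => // w sw /hasP[j _ fj]; have [i ilt Ai] := first_failure a0 sw fj.
  by apply/hasP; exists i => //; rewrite mem_iota.
apply: (le_trans (@Pr_has R d d0 n _ (iota 0 n) A)).
apply: (le_trans (y := \sum_(i <- iota 0 n) expR (- (c * (al * P))))); last first.
  rewrite big_const_seq count_predT size_iota iter_addr_0 -[leLHS]mulr_natl.
  exact: (union_levels p1 nE).
apply: ler_sum => i _.
have s0 : (0 < 4 ^ i)%N by rewrite expn_gt0.
have E4 : (4 ^ i.+1 = 4 * 4 ^ i)%N by rewrite expnS.
have E4a : (a * 4 ^ i.+1 = 4 * (a * 4 ^ i))%N by rewrite E4 mulnCA.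
have root (x y : R) : 0 <= x -> 0 <= y -> (x ^+ 36 <= y ^+ 36) = (x <= y).
  by move=> x0 y0; rewrite ler_pXn2r.
case: (leqP ((4 ^ i) ^ 36) n) => Hi.
  apply: (le_trans (y := expR (- (rate1 d gam * al * P)))); last first.
    by rewrite ler_expR lerN2 -mulrA ler_wpM2r // ge_min lexx.
  have sp : (4 ^ i)%N%:R <= p.
    by rewrite -root ?(ltW p0) // -nE -natrX ler_nat.
  have := low_level_fixed d3 gam0 gamd a0 s0 aC sp nE up1 up2 up3.
  apply: le_trans; apply: le_Pr => // w _.
  by rewrite /A Hi ltnNge Hi /= orbF /fail E4a E4 -leNgt.
apply: (le_trans (y := expR (- (rate2 d gam * al * P)))); last first.
  by rewrite ler_expR lerN2 -mulrA ler_wpM2r // ge_min lexx orbT.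
have sp : p <= (4 ^ i)%N%:R.
  by rewrite -root ?(ltW p0) // -nE -natrX ler_nat ltnW.
have := high_level_fixed d3 gam0 gamd a0 s0 p1 sp nE up4.
apply: le_trans; apply: le_Pr => // w _.
by rewrite /A leqNgt Hi /= /fail E4a E4 -leNgt.
Qed.

End level_tails.

(** * From levels to power sums of local times *)

Section power_sums.
Variables (R : realType) (d : nat) (gam q : R).
Hypothesis d3 : (3 <= d)%N.
Hypotheses (gam0 : 0 < gam) (gamd : gam * (1 - 2 / d%:R) < 2 / d%:R).
Hypotheses (q1 : 1 < q) (qgam : q - 1 < gam).
Local Notation word := (seq (step d)).

Definition qsum (s : seq 'rV[int]_d) : R := occ (fun l => l%:R `^ q) s.

Definition qhigh (A : R) (s : seq 'rV[int]_d) : R :=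
  occ (fun l => (A < l%:R)%R%:R * l%:R `^ q) s.

Definition ratio : R := 4 `^ (q - 1 - gam).
Definition level_const : R := 2 * 8 `^ (q - 1) / (1 - ratio).

Lemma ratio_bounds : 0 < ratio < 1.
Proof.
rewrite powR_gt0 //= -[ltRHS](powRr0 4) /ratio -ltr_ln ?posrE ?powR_gt0 //.
by rewrite !ln_powR ltr_pM2r ?ln_gt0 //; have := qgam; lra.
Qed.

Lemma level_const_gt0 : 0 < level_const.
Proof.
have /andP[r0 r1] := ratio_bounds.
by rewrite /level_const divr_gt0 ?subr_gt0 // mulr_gt0 // powR_gt0.
Qed.

Lemma natX_powR (j : nat) (x : R) : (4 ^ j)%N%:R `^ x = (4 `^ x) ^+ j.
Proof. by rewrite natrX -(powR_mulrn j (ler0n R 4)) -(powR_mulrn j (powR_ge0 4 x)) powRAC. Qed.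

(** A single level dominates: if [2 a 4^j <= l < 8 a 4^j], then [l <= 2 (l - a 4^j)] and
    [l^(q-1) <= (8 a 4^j)^(q-1)]. *)
Lemma pow_level (a l n J : nat) : (0 < a)%N -> (l <= n)%N ->
  (2 * a * 4 ^ J < l)%N ->
  l%:R `^ q <= \sum_(J <= j < n)
     2 * (8 * (a * 4 ^ j)%N%:R) `^ (q - 1) * (l - a * 4 ^ j)%N%:R.
Proof.
move=> a0 ln Jl; pose j := trunc_log 4 (l %/ (2 * a)).
have a2 : (0 < 2 * a)%N by rewrite muln_gt0.
have la : (4 ^ J <= l %/ (2 * a))%N by rewrite leq_divRL // mulnC ltnW.
have l0 : (0 < l %/ (2 * a))%N by apply: leq_trans la; rewrite expn_gt0.
have Jj : (J <= j)%N by apply: trunc_log_max.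
have jl : (2 * a * 4 ^ j <= l)%N.
  by rewrite mulnC -leq_divRL //; exact: trunc_logP.
have lj : (l < 2 * a * 4 ^ j.+1)%N.
  by rewrite mulnC -ltn_divLR //; exact: trunc_log_ltn.
have jn : (j < n)%N.
  apply: leq_trans ln; apply: leq_trans (ltn_expl j (isT : 1 < 4)%N) _.
  by apply: leq_trans jl; rewrite leq_pmull.
have term0 i : 0 <= 2 * (8 * (a * 4 ^ i)%N%:R) `^ (q - 1) * (l - a * 4 ^ i)%N%:R.
  by rewrite mulr_ge0 // mulr_ge0 // powR_ge0.
rewrite (big_cat_nat Jj (ltnW jn)) /= -[leLHS]add0r lerD //.
  by apply: sumr_ge0.
rewrite big_ltn // -[leLHS]addr0 lerD //; last by apply: sumr_ge0.
have lR : 0 <= l%:R :> R by [].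
rewrite -(mulr_powRB1 lR); last by have := q1; lra.
rewrite mulrC [2 * _]mulrC -mulrA; apply: ler_pM; rewrite ?powR_ge0 //.
  apply: ge0_ler_powR; rewrite ?nnegrE ?mulr_ge0 //; first by have := q1; lra.
  rewrite -natrM ler_nat; apply: leq_trans (ltnW lj) _.
  by rewrite expnS; move: (4 ^ j)%N => k; nia.
by rewrite -natrM ler_nat; move: jl; rewrite -mulnA; move: (a * 4 ^ j)%N; clear; lia.
Qed.

Lemma sum_geometric (r : R) J n : 0 < r < 1 ->
  \sum_(J <= j < n) r ^+ j <= r ^+ J / (1 - r).
Proof.
move=> /andP[r0 r1]; have r1' : 0 < 1 - r by rewrite subr_gt0.
rewrite ler_pdivlMr //; case: (leqP J n) => [Jn|nJ]; last first.
  by rewrite big_geq ?(ltnW nJ) // mul0r exprn_ge0 // ltW.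
rewrite mulr_suml (eq_bigr (fun j => - (r ^+ j.+1 - r ^+ j))); last first.
  by move=> j _; rewrite exprS; ring.
rewrite sumrN telescope_sumr // opprB gerBl; exact: exprn_ge0 (ltW r0).
Qed.

(** Level [j] contributes [(4^j)^(q-1) (4^j)^(-gam) = ratio^j], up to constants; starting at [J]
    leaves the factor [ratio^J], which a large cut makes small. *)
Lemma nofail_qhigh (a n J : nat) (w : word) : (0 < a)%N -> size w = n ->
  ~~ has (fail gam a n w) (iota 0 n) ->
  qhigh (2 * a * 4 ^ J)%N%:R (trail 0 w) <=
  level_const * a%:R `^ (q - 1) * ratio ^+ J * n%:R.
Proof.
move=> a0 sw /hasPn nf.
apply: (le_trans (y := \sum_(J <= j < n) 2 * (8 * (a * 4 ^ j)%N%:R) `^ (q - 1) *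
    excess R (a * 4 ^ j) (trail 0 w))).
  rewrite /excess /occ; under eq_bigr do rewrite mulr_sumr.
  rewrite exchange_big /= /qhigh /occ; apply: ler_sum => z _.
  set l := count_mem z _; have ln : (l <= n)%N.
    by apply: leq_trans (count_size _ _) _; rewrite size_trail sw.
  rewrite ltr_nat; case: ltnP => lt; rewrite ?mul1r ?mul0r.
    exact: pow_level.
  by apply: sumr_ge0 => j _; rewrite mulr_ge0 // mulr_ge0 // powR_ge0.
apply: (le_trans (y := \sum_(J <= j < n) 2 * 8 `^ (q - 1) * a%:R `^ (q - 1) * n%:R *
   ratio ^+ j)).
  rewrite !big_nat; apply: ler_sum => j /andP[_ jn].
  have := nf j; rewrite mem_iota add0n jn => /(_ isT); rewrite /fail -leNgt => ex.
  apply: (le_trans (ler_wpM2l _ ex)).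
    by rewrite mulr_ge0 // powR_ge0.
  rewrite natrM mulrA powRM ?mulr_ge0 // powRM // !natX_powR.
  have -> : ratio = 4 `^ (q - 1) * 4 `^ (- gam).
    by rewrite -powRD ?pnatr_eq0 ?implybT.
  by rewrite exprMn le_eqVlt; apply/orP; left; apply/eqP; ring.
rewrite -mulr_sumr; have := sum_geometric J n ratio_bounds => H.
apply: (le_trans (ler_wpM2l _ H)).
  by rewrite !mulr_ge0 // powR_ge0.
by rewrite /level_const le_eqVlt; apply/orP; left; apply/eqP; ring.
Qed.

Lemma nofail_qsum (a n : nat) (w : word) : (0 < a)%N -> size w = n ->
  ~~ has (fail gam a n w) (iota 0 n) ->
  qsum (trail 0 w) <= (2 `^ (q - 1) + level_const) * a%:R `^ (q - 1) * n%:R.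
Proof.
move=> a0 sw nf; have := @nofail_qhigh a n 0 w a0 sw nf.
rewrite expn0 muln1 expr0 mulr1 => H.
apply: (le_trans (y := (2 * a%:R) `^ (q - 1) * n%:R + qhigh (2 * a)%N%:R (trail 0 w))).
  have <- : \sum_(z <- undup (trail 0 w)) (count_mem z (trail 0 w))%:R = n%:R :> R.
    rewrite -natr_sum sum_count_size ?undup_uniq ?size_trail ?sw // => z.
    by rewrite mem_undup.
  rewrite mulr_sumr /qhigh /occ -big_split /=; apply: ler_sum => z _.
  move: (count_mem z _) => l; rewrite ltr_nat; case: ltnP => lt.
    by rewrite mul1r lerDr mulr_ge0 // powR_ge0.
  rewrite mul0r addr0 -(mulr_powRB1 (ler0n R l)); last by have := q1; lra.
  rewrite mulrC ler_wpM2r // ge0_ler_powR ?nnegrE ?mulr_ge0 //; first by have := q1; lra.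
  by rewrite -natrM ler_nat.
rewrite powRM // mulrDl mulrDl lerD //.
Qed.

End power_sums.

(** * Concentration above the mean *)

Section occupation_cat.
Variables (R : realType) (T : choiceType).
Implicit Types (s : seq T) (phi : nat -> R).

Lemma occ_map_inj (T' : choiceType) (f : T -> T') phi s : injective f ->
  occ phi (map f s) = occ phi s.
Proof.
move=> finj; rewrite /occ undup_map_inj // big_map; apply: eq_bigr => z _.
rewrite count_map; congr phi; apply: eq_count => y /=; exact: inj_eq.
Qed.

Lemma occ_cat_ge phi s1 s2 : phi 0%N = 0 ->
  (forall l m, phi l + phi m <= phi (l + m)%N) ->
  occ phi s1 + occ phi s2 <= occ phi (s1 ++ s2).
Proof.
move=> phi0 super; set Z := undup (s1 ++ s2).
have uZ : uniq Z by exact: undup_uniq.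
have s1Z : {subset s1 <= Z} by move=> z zs; rewrite mem_undup mem_cat zs.
have s2Z : {subset s2 <= Z} by move=> z zs; rewrite mem_undup mem_cat zs orbT.
rewrite (occ_wide phi0 uZ s1Z) (occ_wide phi0 uZ s2Z) -big_split /=.
by apply: ler_sum => z _; rewrite count_cat.
Qed.

Lemma occ_cat_le phi C s1 s2 : phi 0%N = 0 -> 0 <= C ->
  (forall l m, phi (l + m)%N <= phi l + phi m + C * ((0 < l) * m)%N%:R) ->
  occ phi (s1 ++ s2) <= occ phi s1 + occ phi s2 + C * (count (mem s1) s2)%:R.
Proof.
move=> phi0 C0 sub; set Z := undup (s1 ++ s2).
have uZ : uniq Z by exact: undup_uniq.
have s1Z : {subset s1 <= Z} by move=> z zs; rewrite mem_undup mem_cat zs.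
have s2Z : {subset s2 <= Z} by move=> z zs; rewrite mem_undup mem_cat zs orbT.
rewrite (occ_wide phi0 uZ s1Z) (occ_wide phi0 uZ s2Z).
have -> : (count (mem s1) s2)%:R =
    \sum_(z <- Z) ((0 < count_mem z s1) * count_mem z s2)%N%:R :> R.
  rewrite -natr_sum; congr _%:R.
  rewrite (eq_bigr (fun z => count_mem z [seq x <- s2 | x \in s1])).
    rewrite sum_count_size // ?size_filter // => z; rewrite mem_filter => /andP[_].
    exact: s2Z.
  move=> z _; rewrite -has_count has_pred1 count_filter.
  case: (boolP (z \in s1)) => zs; rewrite ?mul1n ?mul0n.
    by apply: eq_count => x /=; case: eqP => // ->; rewrite zs.
  rewrite (@eq_count _ _ pred0) ?count_pred0 // => x /=.
  by case: eqP => // ->; rewrite (negPf zs).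
rewrite mulr_sumr -!big_split /=.
by apply: ler_sum => z _; rewrite count_cat.
Qed.

Lemma occ_linear phi C s : (forall l, phi l <= C * l%:R) ->
  occ phi s <= C * (size s)%:R.
Proof.
move=> H; rewrite -(@sum_count_size _ s (undup s) (undup_uniq s)); last first.
  by move=> z; rewrite mem_undup.
by rewrite natr_sum mulr_sumr; apply: ler_sum.
Qed.

Lemma occ_blocks_le phi C N K s : phi 0%N = 0 -> 0 <= C ->
  (forall l m, phi (l + m)%N <= phi l + phi m + C * ((0 < l) * m)%N%:R) ->
  (forall l, phi l <= C * l%:R) ->
  occ phi s <= \sum_(0 <= k < K) occ phi (take N (drop (k * N) s)) +
    C * (\sum_(0 <= k < K) (count (mem (take (k * N) s)) (take N (drop (k * N) s)))%:R) +
    2 * C * (size s - K * N)%N%:R.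
Proof.
move=> phi0 C0 sub lin.
have step K' : occ phi (take (K' * N) s) <=
    \sum_(0 <= k < K') occ phi (take N (drop (k * N) s)) +
    C * (\sum_(0 <= k < K') (count (mem (take (k * N) s)) (take N (drop (k * N) s)))%:R).
  elim: K' => [|K' IH].
    by rewrite !big_geq // mul0n take0 /occ /= big_nil mulr0 addr0.
  rewrite mulSn addnC takeD !big_nat_recr //= mulrDr addrACA.
  apply: (le_trans (occ_cat_le _ _ phi0 C0 sub)).
  by rewrite -[leLHS]addrA lerD2r.
rewrite -{1}[s](cat_take_drop (K * N)).
apply: (le_trans (occ_cat_le _ _ phi0 C0 sub)); rewrite -addrA; apply: lerD => //.
have -> : 2 * C * (size s - K * N)%N%:R = C * (size s - K * N)%N%:R + C * (size s - K * N)%N%:R.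
  by ring.
rewrite -size_drop; apply: lerD; first exact: occ_linear.
by rewrite ler_wpM2l // ler_nat count_size.
Qed.

(** In each block of length [b B] the first [B] steps are counted trivially. For later ones the
    lagged cut lies beyond the start of the block, so that a visit to the past of the block is an
    old visit with [u = 1]. *)
Lemma revisits_le b B K s x0 : (0 < B)%N -> (K * (b * B) <= size s)%N ->
  \sum_(0 <= k < K)
     (count (mem (take (k * (b * B)) s)) (take (b * B) (drop (k * (b * B)) s)))%:R <=
  (K * B)%N%:R + visits_old R B 1 s x0.
Proof.
move=> B0 Ks.
pose X i := (1 <= count_mem (nth x0 s i) (take ((i %/ B).-1 * B) s))%N.
apply: (le_trans (y := \sum_(0 <= k < K) (B%:R +
    \sum_(0 <= m < b * B) (X (k * (b * B) + m)%N)%:R))); last first.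
  rewrite big_split /= big_const_nat subn0 iter_addr_0 -[B%:R *+ K]mulr_natl -natrM lerD2l.
  rewrite -(sum_nat_blocks (fun i => (X i)%:R)) /visits_old.
  rewrite [leRHS](@big_cat_nat _ _ _ (K * (b * B))) //= lerDl.
  by apply: sumr_ge0 => i _; exact: ler0n.
rewrite !big_nat; apply: ler_sum => k /andP[_ kK].
set a := (k * (b * B))%N.
have sz : size (take (b * B) (drop a s)) = (b * B)%N.
  rewrite size_takel // size_drop leq_subRL.
    by rewrite addnC -mulSn; apply: leq_trans Ks; rewrite leq_mul2r kK orbT.
  by apply: leq_trans Ks; rewrite leq_mul2r ltnW ?orbT.
rewrite (count_sum _ _ _ x0) sz.
have [bB|Bb] := leqP (b * B) B.
  apply: (le_trans (y := B%:R)); last first.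
    by rewrite lerDl sumr_ge0 // => i _; exact: ler0n.
  apply: (le_trans (y := \sum_(0 <= m < b * B) 1)).
    by apply: ler_sum => m _; rewrite lern1 leq_b1.
  by rewrite big_const_nat subn0 iter_addr_0 ler_nat.
rewrite (@big_cat_nat _ _ _ B) ?(ltnW Bb) //=; apply: lerD.
  apply: (le_trans (y := \sum_(0 <= m < B) 1)).
    by apply: ler_sum => m _; rewrite lern1 leq_b1.
  by rewrite big_const_nat subn0 iter_addr_0.
rewrite [leRHS](@big_cat_nat _ _ _ B) ?(ltnW Bb) //= -[leLHS]add0r.
apply: lerD; first by apply: sumr_ge0 => i _; exact: ler0n.
rewrite !big_nat; apply: ler_sum => m /andP[Bm mb].
rewrite nth_take // nth_drop ler_nat /X -has_count has_pred1.
set z := nth x0 s (a + m).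
case: (boolP (z \in take a s)) => // za.
suff -> : z \in take (((a + m) %/ B).-1 * B) s by [].
have le_a : (a <= ((a + m) %/ B).-1 * B)%N.
  have -> : (a + m = (k * b + 1) * B + (m - B))%N by rewrite /a; lia.
  by rewrite divnMDl // addn1 addSn /= mulnDl /a mulnA leq_addr.
by rewrite -(subnKC le_a) takeD mem_cat za.
Qed.

End occupation_cat.

Section capped_sums.
Variables (R : realType) (q : R) (L : nat).
Hypotheses (q1 : 1 < q) (L0 : (0 < L)%N).

Definition cap (l : nat) : R := (minn l L)%:R `^ q.
Definition capC : R := L%:R `^ q.

Lemma q_gt0 : 0 < q. Proof. exact: lt_trans q1. Qed.

Lemma capC_ge1 : 1 <= capC.
Proof. by rewrite /capC -[leLHS](powRr0 L%:R) ler_powR ?ler1n // ltW // q_gt0. Qed.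

Lemma cap0 : cap 0 = 0.
Proof. by rewrite /cap min0n powR0 // lt0r_neq0 // q_gt0. Qed.

Lemma cap_le l : cap l <= capC.
Proof. by rewrite /cap ge0_ler_powR ?nnegrE ?(ltW q_gt0) // ler_nat geq_minr. Qed.

Lemma cap_ge0 l : 0 <= cap l. Proof. exact: powR_ge0. Qed.

Lemma cap_sub l m : cap (l + m)%N <= cap l + cap m + capC * ((0 < l) * m)%N%:R.
Proof.
have C1 := capC_ge1.
case: l => [|l]; first by rewrite add0n cap0 add0r mul0n mulr0 addr0.
case: m => [|m]; first by rewrite addn0 cap0 !addr0 muln0 mulr0 addr0.
rewrite mul1n; apply: le_trans (cap_le _) _.
rewrite -[leLHS]add0r lerD ?addr_ge0 ?cap_ge0 // ler_peMr ?ler1n //.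
exact: le_trans C1.
Qed.

Lemma cap_linear l : cap l <= capC * l%:R.
Proof.
case: l => [|l]; first by rewrite cap0 mulr0.
apply: le_trans (cap_le _) _; rewrite ler_peMr ?ler1n //.
exact: le_trans capC_ge1.
Qed.

Lemma powR_super l m : (l%:R : R) `^ q + m%:R `^ q <= (l + m)%N%:R `^ q.
Proof.
have q0 := q_gt0; have qn : q - 1 >= 0 by rewrite subr_ge0 ltW.
rewrite -!(mulr_powRB1 (ler0n R _) q0) natrD mulrDl.
by apply: lerD; rewrite ler_wpM2l // -natrD (ge0_ler_powR qn) ?nnegrE ?ler0n //
  ler_nat ?leq_addr ?leq_addl.
Qed.

End capped_sums.

Section concentration.
Variables (R : realType) (d : nat) (q : R) (L : nat).
Hypothesis d3 : (3 <= d)%N.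
Hypotheses (q1 : 1 < q) (L0 : (0 < L)%N).
Local Notation word := (seq (step d)).
Local Notation kap := (kap R d).
Let d0 : (0 < d)%N. Proof. exact: leq_trans d3. Qed.
Let C := capC q L.
Let C1 : 1 <= C. Proof. exact: capC_ge1. Qed.
Let C0 : 0 < C. Proof. exact: lt_le_trans C1. Qed.

Lemma occ_trail (phi : nat -> R) x (w : word) :
  occ phi (trail x w) = occ phi (trail 0 w).
Proof. by rewrite trail_shift occ_map_inj //; exact: addrI. Qed.

Lemma qsum_cap (s : seq 'rV[int]_d) :
  qsum q s <= occ (cap q L) s + qhigh q L%:R s.
Proof.
rewrite /qsum /qhigh /occ -big_split /=; apply: ler_sum => z _.
move: (count_mem z s) => l; rewrite ltr_nat /cap.
by case: (leqP l L) => lL; rewrite ?mul0r ?addr0 ?mul1r ?lerDr ?powR_ge0.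
Qed.

(** Superadditivity of [l^q] compares the block means with the full mean in the direction required,
    and so replaces a law of large numbers. *)
Lemma Ex_qsum_super N K n : (K * N <= n)%N ->
  K%:R * Ex N (fun w : word => qsum q (trail 0 w)) <=
  Ex n (fun w : word => qsum q (trail 0 w)).
Proof.
have q0 : q != 0 by apply: lt0r_neq0; exact: lt_trans q1.
have super m k : Ex m (fun w : word => qsum q (trail 0 w)) +
    Ex k (fun w : word => qsum q (trail 0 w)) <=
    Ex (m + k) (fun w : word => qsum q (trail 0 w)).
  rewrite Ex_cat -[X in _ + X](@Ex_cst R d d0 m) -ExD; apply: le_Ex => u _.
  rewrite -[X in X + _](@Ex_cst R d d0 k) -ExD; apply: le_Ex => v _.
  rewrite trail_cat add0r; apply: le_trans (occ_cat_ge _ _ _ _).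
  - by rewrite /qsum [X in _ <= _ + X]occ_trail.
  - by rewrite powR0.
  - exact: powR_super.
have pos m : 0 <= Ex m (fun w : word => qsum q (trail 0 w)).
  by apply: Ex_ge0 => // w _; apply: occ_ge0 => l; exact: powR_ge0.
move=> Kn; rewrite -(subnKC Kn); apply: le_trans (super _ _).
apply: ler_wpDr => //; elim: K {Kn} => [|K IH]; first by rewrite mul0r.
rewrite -natr1 mulrDl mul1r mulSn addnC; apply: le_trans (super _ _).
exact: lerD.
Qed.

(** Shifted to the origin, the blocks are independent. A deviation of [4 sig] times the maximal size
    gains [4 sig^2 K] in the exponent, of which the second-order term of the centring takes
    [2 sig^2 K]. *)
Lemma cap_blocks_tail N K (sig : R) : (0 < N)%N -> 0 < sig <= 1 / 2 ->
  Pr R (K * N) (fun w : word =>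
    K%:R * Ex N (fun w : word => qsum q (trail 0 w)) + 4 * sig * C * (K * N)%N%:R <=
    cs N K (fun _ b => occ (cap q L) (trail 0 b)) [::] w) <=
  expR (- (2 * sig ^+ 2 * K%:R)).
Proof.
move=> N0 /andP[s0 s1]; have NR : 0 < N%:R :> R by rewrite ltr0n.
have CN : 0 < C * N%:R by rewrite mulr_gt0.
pose y (b : word) : R := if size b == N then occ (cap q L) (trail 0 b) / (C * N%:R) else 0.
have y01 b : 0 <= y b <= 1.
  rewrite /y; case: eqP => [sb|_]; last by rewrite lexx ler01.
  rewrite divr_ge0 ?(ltW CN) //=; last by apply: occ_ge0 => l; exact: cap_ge0.
  rewrite ler_pdivrMr // mul1r; apply: (le_trans (occ_linear _ (cap_linear q1 L0))).
  by rewrite size_trail sb.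
pose E := Ex N y.
have EQ : C * N%:R * E <= Ex N (fun w : word => qsum q (trail 0 w)).
  rewrite -ExZ; apply: le_Ex => b sb; rewrite /y sb eqxx mulrC divfK ?gt_eqF //.
  apply: le_occ => l; rewrite /cap ge0_ler_powR ?nnegrE ?(ltW (q_gt0 q1)) //.
  by rewrite ler_nat geq_minl.
apply: (le_trans (y := Pr R (K * N) (fun w : word => 2 * sig ^+ 2 * K%:R <=
   cs N K (fun _ b => sig * y b - (sig * E + 2 * sig ^+ 2)) [::] w))).
  apply: le_Pr => // w sw big.
  have -> : cs N K (fun _ b => sig * y b - (sig * E + 2 * sig ^+ 2)) [::] w =
     sig / (C * N%:R) * cs N K (fun _ b => occ (cap q L) (trail 0 b)) [::] w -
     (sig * E + 2 * sig ^+ 2) * K%:R.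
    rewrite !csE sumrB big_const_nat subn0 iter_addr_0 -[_ *+ K]mulr_natr.
    congr (_ - _); rewrite mulr_sumr !big_nat; apply: eq_bigr => i /andP[_ iK].
    have -> : y (take N (drop (i * N) w)) =
        occ (cap q L) (trail 0 (take N (drop (i * N) w))) / (C * N%:R).
      rewrite /y size_takel ?eqxx // size_drop sw -mulnBl leq_pmull // subn_gt0 //.
    by rewrite mulrA mulrAC.
  have := ler_wpM2l (ltW (divr_gt0 s0 CN)) big.
  have -> : sig / (C * N%:R) * (K%:R * Ex N (fun w : word => qsum q (trail 0 w)) +
      4 * sig * C * (K * N)%N%:R) =
      sig * (K%:R * (Ex N (fun w : word => qsum q (trail 0 w)) / (C * N%:R))) +
      4 * sig ^+ 2 * K%:R.
    by rewrite natrM; field; rewrite !gt_eqF.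
  have E2 : E <= Ex N (fun w : word => qsum q (trail 0 w)) / (C * N%:R).
    by rewrite ler_pdivlMr // mulrC.
  have KR : 0 <= K%:R :> R by [].
  have := ler_wpM2l (ltW s0) (ler_wpM2l KR E2).
  lra.
apply: (le_trans (Pr_expR _ _ _)) => //; rewrite ger_pMr ?expR_gt0 //.
apply: Ex_expR_cs_le1 => // _.
by apply: Ex_expR_center2 => //; rewrite (ltW s0).
Qed.

End concentration.

Section concentration_bound.
Variables (R : realType) (d : nat) (gam q : R).
Hypothesis d3 : (3 <= d)%N.
Hypotheses (gam0 : 0 < gam) (gamd : gam * (1 - 2 / d%:R) < 2 / d%:R).
Hypotheses (q1 : 1 < q) (qgam : q - 1 < gam).
Local Notation word := (seq (step d)).
Local Notation kap := (kap R d).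
Local Notation lam0 := (lam0 R d).
Local Notation meanq n := (Ex n (fun w : word => qsum q (trail 0 w))).
Let d0 : (0 < d)%N. Proof. exact: leq_trans d3. Qed.
Let k1 : 1 <= kap. Proof. exact: kap_ge1. Qed.

Lemma cs_blocks N K (phi : nat -> R) (w : word) :
  cs N K (fun _ b => occ phi (trail 0 b)) [::] w =
  \sum_(0 <= k < K) occ phi (take N (drop (k * N) (trail 0 w))).
Proof.
rewrite csE; apply: eq_bigr => i _; have [_] := trail_block 0 N (i * N) w.
by rewrite take0 drop0 add0n => <-; rewrite occ_trail.
Qed.

Lemma qsum_split (L b T K n : nat) (w : word) : (0 < L)%N -> (0 < T)%N ->
  (K * (b * T) <= n)%N -> size w = n ->
  qsum q (trail 0 w) <=
  cs (b * T) K (fun _ u => occ (cap q L) (trail 0 u)) [::] w +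
  capC q L * ((K * T)%N%:R + visits_old R T 1 (trail 0 w) 0) +
  2 * capC q L * (n - K * (b * T))%N%:R + qhigh q L%:R (trail 0 w).
Proof.
move=> L0 T0 Kn sw; have C1 := capC_ge1 q1 L0.
have C0 : 0 <= capC q L by exact: le_trans C1.
apply: (le_trans (qsum_cap q L (trail 0 w))); rewrite lerD2r.
have H := occ_blocks_le (b * T) K (trail 0 w)
  (cap0 L q1) C0 (cap_sub q1 L0) (cap_linear q1 L0).
apply: (le_trans H).
rewrite size_trail sw cs_blocks lerD2r lerD2l ler_wpM2l //.
by apply: revisits_le; rewrite ?size_trail ?sw.
Qed.

Lemma conc_fixed (L b h K n : nat) (theta sig : R) : (0 < L)%N -> (0 < h)%N ->
  (0 < b)%N -> K = (n %/ (b * h ^ 2))%N ->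
  32 * capC q L <= b%:R -> 32 * capC q L * b%:R * (h ^ 2)%N%:R <= n%:R ->
  32 * (3 + 2 * kap) * capC q L * theta <= 1 -> 16 * capC q L * sig <= 1 ->
  0 < sig <= 1 / 2 -> 0 < theta ->
  Pr R n (fun w : word => meanq n + n%:R <= qsum q (trail 0 w)) <=
  Pr R n (fun w : word => n%:R / 4 < qhigh q L%:R (trail 0 w)) +
  Pr R n (fun w : word => (size (heavy 1 (trail 0%R w)) <= n)%N &&
    ((3 * h ^ 2)%N%:R + 2 * (3 + 2 * kap) * theta * n%:R <
     visits_old R (h ^ 2) 1 (trail 0 w) 0)) +
  expR (- (2 * sig ^+ 2 * K%:R)).
Proof.
move=> L0 h0 b0 KE bC nC tC sC s12 t0.
have C1 := capC_ge1 q1 L0; set C := capC q L in C1 bC nC tC sC *.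
have C0 : 0 < C by apply: lt_le_trans C1.
set T := (h ^ 2)%N in KE nC *; have T0 : (0 < T)%N by rewrite expn_gt0 h0.
have N0 : (0 < b * T)%N by rewrite muln_gt0 b0 T0.
have KN : (K * (b * T) <= n)%N by rewrite KE leq_trunc_div.
have rem : (n - K * (b * T) <= b * T)%N.
  by rewrite KE; have := ltn_ceil n N0; rewrite mulSn; move: (n %/ (b * T) * (b * T))%N (b * T)%N; clear; lia.
pose big (w : word) := K%:R * meanq (b * T) + 4 * sig * C * (K * (b * T))%N%:R <=
    cs (b * T) K (fun _ u => occ (cap q L) (trail 0 u)) [::] w.
have bigP : Pr R n big <= expR (- (2 * sig ^+ 2 * K%:R)).
  apply: le_trans (cap_blocks_tail d3 q1 L0 K N0 s12).
  rewrite -[leRHS](@Ex_take R d d0 n _ _ KN); apply: le_Ex => w _.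
  by rewrite cs_take.
apply: (le_trans (y := Pr R n (fun w : word => (n%:R / 4 < qhigh q L%:R (trail 0 w)) ||
   ((size (heavy 1 (trail 0%R w)) <= n)%N &&
    ((3 * T)%N%:R + 2 * (3 + 2 * kap) * theta * n%:R <
     visits_old R T 1 (trail 0 w) 0)) || big w))); last first.
  apply: (le_trans (Pr_or _ _ (fun w => _ || _) big)); apply: lerD => //.
  exact: Pr_or.
apply: le_Pr => // w sw ge; rewrite -[_ || _]negbK !negb_or; apply/negP.
rewrite -leNgt => /andP[/andP[hi]]; rewrite negb_and -leNgt => /orP[|vis].
  have : (size (heavy 1 (trail 0 w)) <= n)%N.
    rewrite size_filter -sw -(size_trail 0 w).
    by apply: leq_trans (count_size _ _) _; exact: size_undup.
  by move=> ->.
rewrite /big -ltNge => lt.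
have sp := qsum_split L0 T0 KN sw; rewrite -/C in sp.
have sup := Ex_qsum_super d3 q1 KN.
have n0 : 0 <= n%:R :> R by [].
have TR : 0 < T%:R :> R by rewrite ltr0n.
have bR : 1 <= b%:R :> R by rewrite ler1n.
have B1 : 4 * sig * C * (K * (b * T))%N%:R <= n%:R / 4.
  have : 4 * sig * C * (K * (b * T))%N%:R <= 4 * sig * C * n%:R.
    rewrite ler_wpM2l ?ler_nat //; case/andP: s12 => s0 _.
    by rewrite mulr_ge0 ?(ltW C0) // mulr_ge0 // ltW.
  by have := ler_wpM2r n0 sC; lra.
have B2 : C * (K * T)%N%:R <= n%:R / 32.
  have : 32 * C * (K * T)%N%:R <= b%:R * (K * T)%N%:R by rewrite ler_wpM2r.
  have : b%:R * (K * T)%N%:R <= n%:R :> R by rewrite -natrM ler_nat mulnCA.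
  lra.
have B3 : C * (3 * T)%N%:R <= 3 / 32 * n%:R.
  have : 32 * C * T%:R <= n%:R.
    apply: le_trans nC; rewrite ler_wpM2r ?(ltW TR) // ler_peMr //.
    by rewrite mulr_ge0 // ltW.
  by rewrite natrM; lra.
have B4 : C * (2 * (3 + 2 * kap) * theta * n%:R) <= n%:R / 16.
  by have := ler_wpM2r n0 tC; lra.
have B5 : 2 * C * (n - K * (b * T))%N%:R <= n%:R / 16.
  have : C * (n - K * (b * T))%N%:R <= C * (b * T)%N%:R.
    by rewrite ler_pM2l // ler_nat.
  by move: nC; rewrite natrM; lra.
have B6 : C * visits_old R T 1 (trail 0 w) 0 <= 3 / 32 * n%:R + n%:R / 16.
  by apply: (le_trans (ler_wpM2l (ltW C0) vis)); rewrite (mulrDr C); exact: lerD.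
rewrite (mulrDr C) in sp.
have npos : 0 < n%:R :> R.
  apply: lt_le_trans nC; rewrite !mulr_gt0 //; exact: lt_le_trans bR.
move: sp sup ge hi lt B1 B2 B5 B6 npos; clear -R.
move: (meanq n) (K%:R * meanq _) (qsum q _) (qhigh _ _ _) (cs _ _ _ _ _) (C * visits_old _ _ _ _ _).
move: (C * (K * T)%N%:R) (2 * C * _) (4 * sig * C * _) => *; lra.
Qed.

End concentration_bound.

Section concentration_rate.
Variables (R : realType) (d : nat) (gam q : R).
Hypothesis d3 : (3 <= d)%N.
Hypotheses (gam0 : 0 < gam) (gamd : gam * (1 - 2 / d%:R) < 2 / d%:R).
Hypotheses (q1 : 1 < q) (qgam : q - 1 < gam).
Local Notation word := (seq (step d)).
Local Notation kap := (kap R d).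
Local Notation lam0 := (lam0 R d).
Local Notation meanq n := (Ex n (fun w : word => qsum q (trail 0 w))).
Let d0 : (0 < d)%N. Proof. exact: leq_trans d3. Qed.
Let k1 : 1 <= kap. Proof. exact: kap_ge1. Qed.
Let l0 : 0 < lam0. Proof. exact: lam0_gt0. Qed.
Let dR : 0 < d%:R :> R. Proof. by rewrite ltr0n. Qed.

Lemma tail_choice (theta : R) : 0 < theta ->
  exists2 rho : nat, (0 < rho)%N & 2 * d%:R * expR (1 - rho%:R / 2) <= theta.
Proof.
move=> t0; exists (Num.truncn (2 * (1 + ln (2 * d%:R / theta)))).+1 => //.
have c0 : 0 < 2 * d%:R / theta by apply: divr_gt0 t0; exact: mulr_gt0.
rewrite -ler_pdivlMl ?mulr_gt0 //.
have -> : (2 * d%:R)^-1 * theta = expR (- ln (2 * d%:R / theta)).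
  by rewrite expRN lnK ?posrE // invf_div mulrC.
rewrite ler_expR.
have := truncnS_gt (2 * (1 + ln (2 * d%:R / theta))).
set y := ln _; move: ((Num.truncn _).+1%:R : R) => k; lra.
Qed.

Lemma conc_entropy (theta W h2 p P Q : R) (n : nat) : 0 < theta -> 0 < W ->
  1 <= p -> n%:R = p ^+ 36 -> P * Q = n%:R -> 0 < Q -> 0 < h2 -> h2 <= W * Q ->
  p ^+ 12 <= P -> 3 + 74 * d%:R / theta <= lam0 * theta / (16 * W) * p ->
  3 + d%:R / theta * ln (2 * n).+1%:R - lam0 * theta * n%:R / (8 * h2) <=
  - (lam0 * theta / (16 * W) * P).
Proof.
move=> t0 W0 p1 nE PQ Q0 h0 hW pP pc; set c := lam0 * theta / (16 * W).
have c0 : 0 < c by rewrite divr_gt0 ?mulr_gt0.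
have p0 : 0 < p by lra.
have P0 : 0 < P by apply: lt_le_trans pP; rewrite exprn_gt0.
have sp : Num.sqrt p <= p.
  rewrite -[leRHS](ger0_norm (ltW p0)) -sqrtr_sqr ler_wsqrtr //.
  by rewrite expr2 ler_peMr // ltW.
have rate : 2 * (c * P) <= lam0 * theta * n%:R / (8 * h2).
  rewrite ler_pdivlMr ?mulr_gt0 //; apply: (le_trans (y := 2 * (c * P) * (8 * (W * Q)))).
    by rewrite ler_wpM2l ?ler_pM2l // mulr_ge0 // mulr_ge0 // ltW.
  rewrite -PQ /c le_eqVlt; apply/orP; left; apply/eqP; field; exact: lt0r_neq0.
have ent : 3 + d%:R / theta * ln (2 * n).+1%:R <= c * P.
  apply: (le_trans (y := (3 + 74 * d%:R / theta) * p)).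
    rewrite mulrDl; apply: lerD; first by rewrite ler_peMr.
    apply: (le_trans (y := d%:R / theta * (74 * p))); last first.
      by rewrite le_eqVlt; apply/orP; left; apply/eqP; ring.
    rewrite ler_wpM2l ?divr_ge0 ?(ltW t0) //.
    by apply: (le_trans (ln_steps_sqrt p1 nE)); rewrite ler_wpM2l.
  apply: (le_trans (ler_wpM2r (ltW p0) pc)); rewrite -/c -mulrA ler_wpM2l ?(ltW c0) //.
  by apply: le_trans pP; rewrite -expr2 ler_weXn2l.
lra.
Qed.

Lemma three_expR (x : R) : 4 <= x ->
  expR (- x) + expR (- x) + expR (- x) <= expR (- (x / 2)).
Proof.
move=> x4.
have -> : expR (- x) = expR (- (x / 2)) * expR (- (x / 2)).
  by rewrite -expRD; congr expR; lra.
have y3 : expR (- (x / 2)) <= 1 / 3.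
  apply: (le_trans (y := expR (- 2))); first by rewrite ler_expR; lra.
  rewrite expRN -div1r ler_pdivrMr ?expR_gt0 //.
  by have := expR_ge1Dx (2 : R); lra.
have := expR_ge0 (- (x / 2)); move: (expR _) y3 => y; nra.
Qed.

Lemma level_choice (a : nat) : exists J,
  level_const gam q * a%:R `^ (q - 1) * ratio gam q ^+ J <= 1 / 4.
Proof.
have /andP[r0 r1] := ratio_bounds qgam.
set C := level_const gam q * a%:R `^ (q - 1).
have C0 : 0 <= C by rewrite mulr_ge0 ?powR_ge0 // ltW // level_const_gt0.
have : (fun J => C * ratio gam q ^+ J) @ \oo --> C * 0.
  apply: cvgMr; apply: cvg_expr; by rewrite gtr0_norm.
rewrite mulr0 => /cvgrPdist_le /(_ (1 / 4) ltac:(lra)) [J _ HJ].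
exists J; have := HJ J (leqnn J); rewrite sub0r normrN ger0_norm //.
by rewrite mulr_ge0 // exprn_ge0 // ltW.
Qed.

(** At most [n] sites are visited, so [scale_choice] is used with [x = n] and gives [h^2] at most of
    order [n^(2/d)]. There are then at least of order [n^(1-2/d)] blocks of length [b h^2], which is
    the Chernoff rate. *)
Lemma qsum_concentration : exists c : R, 0 < c /\ exists n0 : nat,
  forall n, (n0 <= n)%N ->
  Pr R n (fun w : word => meanq n + n%:R <= qsum q (trail 0 w)) <=
  expR (- (c * n%:R `^ (1 - 2 / d%:R))).
Proof.
have [cf [cf0 [a [a0 /(_ a (leqnn a))[nf Hf]]]]] := level_tails d3 gam0 gamd.
have [J HJ] := level_choice a.
pose L := (2 * a * 4 ^ J)%N.
have L0 : (0 < L)%N by rewrite !muln_gt0 a0 expn_gt0.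
pose C := capC q L; have C1 : 1 <= C by exact: capC_ge1.
have C0 : 0 < C by apply: lt_le_trans C1.
pose b := (Num.truncn (32 * C)).+1.
have bC : 32 * C <= b%:R by apply/ltW/truncnS_gt.
have b0 : (0 < b)%N by [].
have bR : 0 < b%:R :> R by rewrite ltr0n.
have k3 : 1 <= 3 + 2 * kap by have := k1; lra.
have k30 : 0 < 3 + 2 * kap by apply: lt_le_trans k3.
pose theta := (32 * (3 + 2 * kap) * C)^-1.
have tC : 32 * (3 + 2 * kap) * C * theta <= 1.
  by rewrite /theta mulfV // lt0r_neq0 // mulr_gt0 // mulr_gt0.
have t0 : 0 < theta by rewrite invr_gt0 mulr_gt0 // mulr_gt0.
have t1 : theta <= 1.
  by rewrite invf_le1 ?mulr_gt0 // mulr_ege1 // mulr_ege1 // ler1n.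
pose sig := (16 * C)^-1.
have s0 : 0 < sig by rewrite invr_gt0 mulr_gt0.
have sC : 16 * C * sig <= 1 by rewrite /sig mulfV // lt0r_neq0 // mulr_gt0.
have s12 : 0 < sig <= 1 / 2.
  by rewrite s0 /= /sig -div1r ler_pdivrMr ?mulr_gt0 //; move: C1; lra.
clearbody theta sig.
have [rho rho0 tl] := tail_choice t0.
pose W := (28 * kap * rho%:R) ^+ 2.
have W0 : 0 < W.
  rewrite exprn_gt0 // mulr_gt0 ?ltr0n // mulr_gt0 //; exact: lt_le_trans k1.
pose c1 := lam0 * theta / (16 * W).
have c10 : 0 < c1 by apply: divr_gt0; [exact: mulr_gt0|rewrite mulr_gt0].
pose c2 := sig ^+ 2 / (b%:R * W).
have c20 : 0 < c2 by rewrite divr_gt0 ?exprn_gt0 // mulr_gt0.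
pose c := Num.min cf (Num.min c1 c2).
have c0 : 0 < c by rewrite !lt_min cf0 c10 c20.
exists (c / 2); split; first by rewrite divr_gt0.
have [n1 Hn] := large_root36 (1 + theta^-1 + 32 * C * b%:R * W +
  (3 + 74 * d%:R / theta) / c1 + 4 / c).
exists (maxn nf n1) => n; rewrite geq_max => /andP[nnf /Hn[p nE up]].
have e1 : 0 < theta^-1 by rewrite invr_gt0.
have e2 : 0 < 32 * C * b%:R * W by rewrite mulr_gt0 // mulr_gt0 // mulr_gt0.
have e3 : 0 <= (3 + 74 * d%:R / theta) / c1.
  by rewrite divr_ge0 ?(ltW c10) // addr_ge0 // divr_ge0 ?(ltW t0) // mulr_ge0.
have e4 : 0 < 4 / c by rewrite divr_gt0.
have [p1 up1 up2 [up3 up4]] : [/\ 1 <= p, theta^-1 <= p, 32 * C * b%:R * W <= p &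
    (3 + 74 * d%:R / theta) / c1 <= p /\ 4 / c <= p].
  move: e1 e2 e3 e4 up; move: (theta^-1) (32 * C * _ * _) (_ / c1) (4 / c).
  by move=> x y z t *; do !split; lra.
have p0 : 0 < p by apply: lt_le_trans p1.
have div_le (x y : R) : 0 < y -> x / y <= p -> x <= y * p.
  by move=> y0; rewrite ler_pdivrMr // mulrC.
have {}up3 := div_le _ _ c10 up3; have {}up4 := div_le _ _ c0 up4.
have {}up1 : 1 <= theta * p by apply: div_le => //; rewrite div1r.
pose P : R := n%:R `^ (1 - 2 / d%:R); pose Q : R := n%:R `^ (2 / d%:R).
have n0 : 0 < n%:R :> R by rewrite nE exprn_gt0.
have n1' : 1 <= n%:R :> R by rewrite nE exprn_ege1.
have Q0 : 0 < Q by apply: powR_gt0.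
have P0 : 0 < P by apply: powR_gt0.
have PQ : P * Q = n%:R.
  by rewrite -powRD ?subrK ?powRr1 // implybE (gt_eqF n0) orbT.
have /andP[D0 D1] := two_div_d R d3.
have P12 : p ^+ 12 <= P.
  have -> : p ^+ 12 = n%:R `^ (1 / 3).
    by rewrite nE -!powR_mulrn ?(ltW p0) // -powRrM; congr (p `^ _); lra.
  by rewrite ler_powR //; lra.
have pP : p <= P by apply: le_trans P12; rewrite ler_eXnr.
have tn : 1 <= theta * n%:R.
  by apply: (le_trans up1); rewrite ler_pM2l // nE ler_eXnr.
have t01 : 0 < theta <= 1 by rewrite t0.
have [h [r [g [M [h0 g0 tail gle [VM mass tM h2]]]]]] := scale_choice d3 t01 tn rho0 tl.
rewrite -/Q -/W in h2.
have hR2 : 0 < h%:R ^+ 2 :> R by rewrite exprn_gt0 // ltr0n.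
have nC : 32 * C * b%:R * (h ^ 2)%N%:R <= n%:R.
  rewrite natrX; apply: (le_trans (y := 32 * C * b%:R * (W * Q))).
    by rewrite ler_wpM2l // mulr_ge0 // mulr_ge0 // ltW.
  by rewrite -PQ mulrA ler_wpM2r ?(ltW Q0) //; exact: le_trans pP.
have hn : (32 * b * h ^ 2 <= n)%N.
  rewrite -(ler_nat R) natrM [(32 * b)%:R]natrM; apply: le_trans nC; rewrite ler_wpM2r ?ler0n //.
  by rewrite ler_wpM2r ?(ltW bR) // ler_peMr.
pose K := (n %/ (b * h ^ 2))%N.
have trn : Num.truncn (n%:R : R) = n.
  by apply: truncn_def; rewrite lexx ltr_nat ltnSn.
rewrite trn in VM.
have hn4 : (4 * h ^ 2 <= n)%N.
  apply: leq_trans hn; rewrite leq_mul2r; apply/orP; right.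
  by rewrite (leq_trans _ (leq_pmulr _ b0)).
have Bn : (h ^ 2 <= n)%N by apply: leq_trans hn4; rewrite leq_pmull.
apply: (le_trans (conc_fixed d3 q1 L0 h0 b0 erefl bC nC tC sC s12 t0)).
rewrite -/K -/P.
have E1 : Pr R n (fun w : word => n%:R / 4 < qhigh q L%:R (trail 0 w)) <= expR (- (c * P)).
  apply: (le_trans (y := Pr R n (fun w : word => has (fail gam a n w) (iota 0 n)))).
    apply: le_Pr => // w sw; apply: contraTT => nofail; rewrite -leNgt.
    apply: (le_trans (nofail_qhigh d3 gam0 gamd q1 qgam J a0 sw nofail)).
    by have := ler_wpM2r (ltW n0) HJ; lra.
  apply: (le_trans (Hf n nnf)); rewrite -/P ler_expR lerN2.
  apply: ler_pM; rewrite ?(ltW c0) ?(ltW P0) //; first by rewrite ge_min lexx.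
  by rewrite ler_peMl ?(ltW P0) // -[leLHS](powRr0 a%:R) ler_powR ?ler1n // ltW.
have E2 : Pr R n (fun w : word => (size (heavy 1 (trail 0%R w)) <= n)%N &&
    ((3 * h ^ 2)%N%:R + 2 * (3 + 2 * kap) * theta * n%:R <
     visits_old R (h ^ 2) 1 (trail 0 w) 0)) <= expR (- (c * P)).
  apply: (le_trans (visits_old_tail d3 t0 h0 (isT : 0 < 1)%N Bn g0 tail gle VM mass)).
  apply: (le_trans (y := 8 * (((2 * n).+1 ^ (d * M))%:R *
    expR (- (lam0 * theta * ((n - h ^ 2) %/ (2 * h ^ 2))%N%:R))))).
    have P1 : 1 <= ((2 * n).+1 ^ (d * M))%:R :> R by rewrite ler1n expn_gt0.
    have l1 : lam0 <= 1 by have := @lam0_le R d d3; lra.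
    set k := (_ %/ _)%N%:R.
    have e1' : expR (- (theta * k)) <= expR (- (lam0 * theta * k)).
      by rewrite ler_expR lerN2 -mulrA ler_piMl // mulr_ge0 // ltW.
    have e0 := expR_ge0 (- (lam0 * theta * k)).
    have e2' : expR (- (lam0 * theta * k)) <=
        ((2 * n).+1 ^ (d * M))%:R * expR (- (lam0 * theta * k)) by rewrite ler_peMl.
    move: e1' e0 e2'; move: (expR (- (lam0 * theta * k))) => y; move: (expR _) => x.
    rewrite [_ * (2 * y)]mulrCA; move: (_%:R * y) => z; lra.
  apply: (le_trans (entropy_rate d3 t0 h0 hn4 tM)); rewrite ler_expR.
  apply: (le_trans (conc_entropy t0 W0 p1 nE PQ Q0 hR2 h2 P12 up3)).
  by rewrite lerN2 ler_wpM2r ?(ltW P0) // !ge_min lexx orbT.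
have E3 : expR (- (2 * sig ^+ 2 * K%:R)) <= expR (- (c * P)).
  rewrite ler_expR lerN2.
  have nK : n%:R <= 2 * (b%:R * h%:R ^+ 2) * K%:R :> R.
    have N0 : (0 < b * h ^ 2)%N by rewrite muln_gt0 b0 expn_gt0 h0.
    rewrite -natrX -!natrM ler_nat.
    have K0 : (0 < K)%N.
      rewrite divn_gt0 //; apply: leq_trans hn; rewrite -mulnA.
      by rewrite leq_pmull.
    have := ltnW (ltn_ceil n N0); rewrite -/K => /leq_trans; apply.
    rewrite [(2 * _ * _)%N]mulnAC leq_mul2r; apply/orP; right.
    by case: (K) K0 => // k _; clear; lia.
  have sgK : c2 * P <= 2 * sig ^+ 2 * K%:R.
    have PK : P <= 2 * (b%:R * W) * K%:R.
      rewrite -(ler_pM2r Q0) PQ; apply: (le_trans nK).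
      have -> : 2 * (b%:R * W) * K%:R * Q = 2 * (b%:R * (W * Q)) * K%:R by ring.
      by rewrite ler_wpM2r // ler_wpM2l // ler_wpM2l // ltW.
    rewrite /c2 mulrAC ler_pdivrMr ?(mulr_gt0 bR W0) //.
    have -> : 2 * sig ^+ 2 * K%:R * (b%:R * W) = sig ^+ 2 * (2 * (b%:R * W) * K%:R) by ring.
    by rewrite ler_wpM2l // sqr_ge0.
  apply: le_trans sgK; rewrite ler_wpM2r ?(ltW P0) // !ge_min lexx !orbT //.
have cP : 4 <= c * P by apply: (le_trans up4); rewrite ler_pM2l.
apply: (le_trans (lerD (lerD E1 E2) E3)).
by rewrite mulrAC; exact: three_expR.
Qed.

End concentration_rate.

(** * Confinement *)

Section confinement.
Variables (R : realType) (d : nat) (q : R).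
Hypotheses (d3 : (3 <= d)%N) (q1 : 1 < q).
Local Notation word := (seq (step d)).
Local Notation point := 'rV[int]_d.
Local Notation lam0 := (lam0 R d).
Let d0 : (0 < d)%N. Proof. exact: leq_trans d3. Qed.

Lemma sin_le (x : R) : 0 <= x -> sin x <= x.
Proof.
move=> x0; have [c _] := MVT_segment x0 (fun y _ => is_derive_sin y)
  (continuous_subspaceT (@continuous_sin R)).
by rewrite sin0 !subr0 => ->; rewrite ler_piMl // cos_le1.
Qed.

Lemma expR_le_cos (x : R) : 0 <= x <= 1 -> expR (- x ^+ 2) <= cos x.
Proof.
move=> /andP[x0 x1]; have -> : cos x = 1 - 2 * sin (x / 2) ^+ 2.
  have -> : x = (x / 2) *+ 2 by rewrite mulr2n; lra.
  rewrite cos_mulr2n cos2sin2; have -> : (x / 2) *+ 2 / 2 = x / 2.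
    by rewrite mulr2n; lra.
  by rewrite mulr2n; lra.
have s1 : sin (x / 2) ^+ 2 <= (x / 2) ^+ 2.
  rewrite ler_sqr ?nnegrE; first by apply: sin_le; lra.
    by apply: sin_ge0_pi; have := pi_ge2 R; lra.
  by lra.
apply: (le_trans (y := (1 + x ^+ 2)^-1)).
  by rewrite expRN lef_pV2 ?posrE ?expR_gt0 ?expR_ge1Dx //; nra.
have y0 : 0 <= x ^+ 2 by rewrite sqr_ge0.
have y1 : x ^+ 2 <= 1 by rewrite exprn_ile1.
have x2 : 0 < 1 + x ^+ 2 by rewrite ltr_pwDl.
rewrite -div1r ler_pdivrMr //; apply: (le_trans (y := (1 - x ^+ 2 / 2) * (1 + x ^+ 2))).
  by move: y0 y1; move: (x ^+ 2) => y; nra.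
by rewrite ler_pM2r //; move: s1; rewrite exprMn; move: (sin _ ^+ 2) (x ^+ 2) => u v; lra.
Qed.

Definition tone (om : R) (x : point) : R := \prod_i cos (om * (x ord0 i)%:~R).

Lemma avg_tone om x : avg (fun s => tone om (x + vec s)) = cos om * tone om x.
Proof.
rewrite avg_coord; apply: (mulfI (x := d%:R)); first by rewrite pnatr_eq0 -lt0n.
rewrite mulrA mulfV ?mul1r ?pnatr_eq0 -?lt0n //.
rewrite (eq_bigr (fun _ => cos om * tone om x)).
  by rewrite sumr_const card_ord mulr_natl.
move=> i _; rewrite /tone (bigD1 i) //= [\prod_(_ < _) _ in X in _ + X](bigD1 i) //=.
rewrite [RHS]mulrC [X in _ = X * _](bigD1 i) //=.
have E b : \prod_(j < d | j != i) cos (om * ((x + vec (i, b)) ord0 j)%:~R) =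
    \prod_(j < d | j != i) cos (om * (x ord0 j)%:~R).
  apply: eq_bigr => j ji; rewrite !mxE /= [i == j]eq_sym (negbTE ji) addr0 //.
rewrite !E !mxE /= eqxx expr0 expr1 !intrD mulrN1z mulr1z.
rewrite !mulrDr mulr1 mulrN1 !cosD sinN cosN; lra.
Qed.

(** As [om (r+1) = pi/2], the function [tone] vanishes on the outer faces and is at most 1, hence is
    a lower barrier for the survival probability. The induction runs over the closed larger box,
    where it is nonnegative and which a step from the inner box cannot leave. *)
Lemma confined r n (y : point) : inbox r.+1 y ->
  cos (pi / (2 * r.+1%:R)) ^+ n * tone (pi / (2 * r.+1%:R)) y <=
  Pr R n (fun w : word => all (inbox r) (trail y w)).
Proof.
set om := pi / _; have r0 : 0 < 2 * r.+1%:R :> R by rewrite mulr_gt0.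
have om0 : 0 < om by rewrite divr_gt0 // pi_gt0.
have omr : om * r.+1%:R = pi / 2 by rewrite /om; field; rewrite ?nat1r ?natr1 pnatr_eq0.
have co (k : int) : (`|k| <= r.+1)%N -> 0 <= cos (om * k%:~R).
  move=> kr; rewrite -cos_norm normrM (gtr0_norm om0) -intr_norm -abszE.
  apply: cos_ge0_pihalf; rewrite -omr -pmulrn.
  have k0 : 0 <= om * `|k|%N%:R by rewrite mulr_ge0 ?(ltW om0).
  have := pi_ge0 R; rewrite ler_pM2l // ler_nat kr andbT => p0.
  by apply: le_trans k0; rewrite oppr_le0 mulr_ge0 // ltW.
have c0 : 0 <= cos om by have := co 1; rewrite mulr1; apply.
elim: n y => [|n IH] y yr.
  rewrite expr0 mul1r /Pr /= /tone; apply: prodr_ile1 => i _.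
  by rewrite co ?(forallP yr) //= cos_le1.
have [yr'|] := boolP (inbox r y); last first.
  rewrite negb_forall => /existsP[i]; rewrite -ltnNge => ri.
  have yi0 : cos (om * (y ord0 i)%:~R) = 0.
    rewrite -cos_norm normrM (gtr0_norm om0) -intr_norm -abszE.
    have -> : (`|y ord0 i| = r.+1)%N by apply/eqP; rewrite eqn_leq (forallP yr) ri.
    by rewrite -pmulrn omr cos_pihalf.
  by rewrite /tone (bigD1 i) //= yi0 mul0r mulr0 Pr_ge0.
rewrite exprS -mulrA mulrCA -avg_tone -avgZ /Pr /=; apply: le_avg => s.
apply: (le_trans (IH _ _)); last first.
  by apply: le_Ex => w _; rewrite yr'.
apply/forallP => i; have := forallP yr' i; rewrite !mxE.
case: (s.1 == i); last by rewrite addr0 => /leqW.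
by case: s.2; rewrite /= ?expr1 ?expr0; lia.
Qed.

Lemma confined0 r n : (0 < r)%N ->
  expR (- (4 * n%:R / r.+1%:R ^+ 2)) <=
  Pr R n (fun w : word => all (inbox r) (trail 0 w)).
Proof.
move=> r0; have b0 : inbox r.+1 (0 : point) by apply/forallP => i; rewrite mxE.
apply: le_trans (confined n b0).
rewrite [tone _ _]big1 ?mulr1; last by move=> i _; rewrite mxE mulr0 cos0.
set om := pi / _.
have r2 : 2 <= r.+1%:R :> R by rewrite ler_nat.
have rp : 0 < r.+1%:R :> R by rewrite ltr0n.
have om0 : 0 <= om by rewrite divr_ge0 ?pi_ge0 // mulr_ge0.
have omr : om <= 2 / r.+1%:R.
  rewrite /om ler_pdivrMr ?mulr_gt0 // mulrCA mulfVK ?lt0r_neq0 //.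
  by have := pihalf_lt2 R; lra.
have om1 : om <= 1 by apply: (le_trans omr); rewrite ler_pdivrMr // mul1r.
apply: (le_trans (y := expR (- om ^+ 2) ^+ n)).
  rewrite -expRM_natl ler_expR mulrN lerN2 mulrC.
  have -> : 4 * n%:R / r.+1%:R ^+ 2 = (2 / r.+1%:R) ^+ 2 * n%:R :> R.
    by field; rewrite ?nat1r ?natr1 pnatr_eq0.
  by rewrite ler_wpM2r // ler_sqr ?nnegrE // divr_ge0 // ltW.
by rewrite lerXn2r ?nnegrE ?expR_ge0 ?(le_trans (expR_ge0 _) (expR_le_cos _)) ?expR_le_cos ?om0.
Qed.

(** Convexity in the form [l^q >= m^(q-1) (l - m)], trivial for [l <= m]. The level [m] is free; in
    the application it is at most half of the average occupation of the box. *)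
Lemma qsum_box r (m : R) (s : seq point) : 0 <= m -> all (inbox r) s ->
  m `^ (q - 1) * ((size s)%:R - m * ((2 * r).+1 ^ d)%:R) <= qsum q s.
Proof.
move=> m0 /allP sr.
have sub : {subset s <= undup (box d r)} by move=> z /sr zr; rewrite mem_undup mem_box.
have q0 : 0 < q by apply: lt_trans q1.
rewrite /qsum (occ_wide _ (undup_uniq _) sub) ?powR0 ?lt0r_neq0 //.
apply: (le_trans (y := \sum_(z <- undup (box d r))
    m `^ (q - 1) * ((count_mem z s)%:R - m))).
  rewrite -mulr_sumr ler_wpM2l ?powR_ge0 // sumrB -natr_sum sum_count_size ?undup_uniq //.
  have -> : \sum_(i <- undup (box d r)) m = m * (size (undup (box d r)))%:R.
    by rewrite big_const_seq count_predT iter_addr_0 mulr_natr.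
  rewrite lerD2l lerN2 ler_wpM2l //.
  by rewrite -(size_box d r) ler_nat size_undup.
apply: ler_sum => z _; move: (count_mem z s)%:R (ler0n R (count_mem z s)) => l l0.
have [lm|ml] := leP l m.
  apply: (le_trans (y := 0)); last exact: powR_ge0.
  by rewrite mulr_ge0_le0 ?powR_ge0 // subr_le0.
rewrite -(mulr_powRB1 l0 q0) mulrC; apply: ler_pM; rewrite ?powR_ge0 ?subr_ge0 ?(ltW ml) //.
  by rewrite gerBl.
by rewrite ge0_ler_powR ?nnegrE // ?subr_ge0 ltW.
Qed.

(** With [a = lam0 / q <= 1], the bound [c + 1 <= expR (a c) / a] puts [(c+1)^q] below a multiple of
    [expR (lam0 c)], as [Ex_occ] demands. *)
Lemma mean_qsum_linear : exists2 C : R, 0 < C & forall n,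
  Ex n (fun w : word => qsum q (trail 0 w)) <= C * n%:R.
Proof.
have l0 : 0 < lam0 by exact: lam0_gt0.
have l1 : lam0 <= 1 by have := @lam0_le R d d3; lra.
have q0 : 0 < q by apply: lt_trans q1.
pose a := lam0 / q; have a0 : 0 < a by rewrite divr_gt0.
have a1 : a <= 1 by rewrite ler_pdivrMr //; have := q1; lra.
have aE : lam0 = q * a by rewrite /a mulrCA mulfV ?mulr1 ?lt0r_neq0.
clearbody a; have ai : 0 < a^-1 by rewrite invr_gt0.
exists (2 * (a^-1) `^ q); first by rewrite mulr_gt0 // powR_gt0.
move=> n; rewrite mulrC; apply: Ex_occ; rewrite ?powR_ge0 ?powR0 ?lt0r_neq0 // => c.
apply: (le_trans (y := c.+1%:R `^ q)); first by rewrite gerBl powR_ge0.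
rewrite aE -mulrA [q * _]mulrC expRM -powRM ?(ltW ai) ?expR_ge0 //.
rewrite ge0_ler_powR ?nnegrE ?(ltW q0) ?mulr_ge0 ?(ltW ai) ?expR_ge0 //.
rewrite ler_pdivlMl //; apply: le_trans (expR_ge1Dx _).
by rewrite -natr1 mulrDr mulr1 addrC lerD2r.
Qed.

(** Here [rho = (n / 2t)^(1/d)] is the side at which the average occupation is [2 t]. The radius
    satisfies [2 r + 1 <= rho] and [r + 1 >= rho / 3], whence [36 = 4 * 9]. *)
Lemma box_choice (t : R) : 0 < t -> exists n0, forall n, (n0 <= n)%N ->
  exists r, [/\ (0 < r)%N, 2 * t * ((2 * r).+1 ^ d)%:R <= n%:R &
    4 * n%:R / r.+1%:R ^+ 2 <= 36 * ((2 * t) `^ (2 / d%:R) * n%:R `^ (1 - 2 / d%:R))].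
Proof.
move=> t0; have t2 : 0 < 2 * t by rewrite mulr_gt0.
exists (Num.truncn (2 * t * 3 ^+ d)).+1 => n.
rewrite -(ler_nat R) => /(lt_le_trans (truncnS_gt _)) nt.
have n0 : 0 < n%:R :> R by apply: lt_trans nt; rewrite mulr_gt0 // exprn_gt0.
have nd : 0 < n%:R / (2 * t) by rewrite divr_gt0.
have dR : d%:R != 0 :> R by rewrite pnatr_eq0 -lt0n.
pose rho := (n%:R / (2 * t)) `^ d%:R^-1.
have rho0 : 0 < rho by apply: powR_gt0.
have rhod : rho ^+ d = n%:R / (2 * t).
  by rewrite -powR_mulrn ?(ltW rho0) // -powRrM mulVf // powRr1 // ltW.
have rho3 : 3 <= rho.
  have : 3 ^+ d <= rho ^+ d by rewrite rhod ler_pdivlMr // mulrC ltW.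
  by rewrite ler_pXn2r ?nnegrE ?(ltW rho0).
have rho2 : rho ^+ 2 = (2 * t) `^ (- (2 / d%:R)) * n%:R `^ (2 / d%:R).
  rewrite -powR_mulrn ?(ltW rho0) // -powRrM [_^-1 * _]mulrC [in LHS]powRM ?invr_ge0 ?(ltW t2) ?ler0n //.
  by rewrite -(powR_inv1 (ltW t2)) -[((2 * t) `^ -1) `^ _]powRrM mulN1r; exact: mulrC.
exists (Num.truncn ((rho - 1) / 2)).
have r1 : 0 <= (rho - 1) / 2 by lra.
have /andP[lo up] := truncn_itv r1; set r := Num.truncn _ in lo up *.
have rg : (0 < r)%N by rewrite -(ltr_nat R); move: up; rewrite -[r.+1%:R]natr1; lra.
split => //.
  rewrite mulrC -ler_pdivlMr // -rhod natrX lerXn2r ?nnegrE ?(ltW rho0) //.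
  by rewrite -[(2 * r).+1%:R]natr1 natrM; lra.
have rr : rho / 3 <= r.+1%:R by lra.
have rp : 0 < rho / 3 by rewrite divr_gt0.
rewrite ler_pdivrMr ?exprn_gt0 ?ltr0n //.
apply: (le_trans (y := 36 * ((2 * t) `^ (2 / d%:R) * n%:R `^ (1 - 2 / d%:R)) * (rho / 3) ^+ 2)).
  rewrite exprMn rho2.
  have nn : n%:R `^ (1 - 2 / d%:R) * n%:R `^ (2 / d%:R) = n%:R :> R.
    by rewrite -powRD ?subrK ?powRr1 ?(ltW n0) // implybE (gt_eqF n0) orbT.
  have tt : (2 * t) `^ (2 / d%:R) * (2 * t) `^ (- (2 / d%:R)) = 1.
    by rewrite powRN mulfV // gt_eqF // powR_gt0.
  rewrite -[X in 4 * X]nn; move: tt.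
  move: ((2 * t) `^ _) ((2 * t) `^ _) (n%:R `^ _) (n%:R `^ _) => u z y x uz.
  have -> : 36 * (z * x) * (u * y * 3^-1 ^+ 2) = z * u * (4 * (x * y)) by field.
  by rewrite uz mul1r.
rewrite ler_wpM2l //; first by rewrite !mulr_ge0 // powR_ge0.
by rewrite ler_sqr ?nnegrE ?(ltW rp) // ler0n.
Qed.

(** The density [t] solves [t^(q-1) = 2 (xi + C)]. At least half of the [n] visits survive the
    subtraction in [qsum_box], so confinement forces [(xi + C) n], which exceeds the mean by [xi n].
    The power of [xi] is that of [t^(2/d)]. *)
Lemma qsum_lower_tail : exists2 c : R, 0 < c & forall xi : R, 1 <= xi ->
  exists n0, forall n, (n0 <= n)%N ->
  expR (- (c * (xi `^ (2 / d%:R * (1 / (q - 1))) * n%:R `^ (1 - 2 / d%:R)))) <=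
  Pr R n (fun w : word => Ex n (fun w' : word => qsum q (trail 0 w')) + xi * n%:R <=
    qsum q (trail 0 w)).
Proof.
have lin (x y : R) : 0 < x -> 1 <= y -> 2 * (y + x) <= 2 * (1 + x) * y by nra.
have [C C0 EC] := mean_qsum_linear.
have q10 : 0 < q - 1 by rewrite subr_gt0.
have dR : 0 < d%:R :> R by rewrite ltr0n.
have C2 : 0 < 2 * (1 + C) by rewrite mulr_gt0 // addr_gt0.
pose e : R := 2 / d%:R * (1 / (q - 1)).
have e0 : 0 <= e by rewrite mulr_ge0 // divr_ge0 // ltW.
pose K := 2 `^ (2 / d%:R) * (2 * (1 + C)) `^ e.
exists (36 * K); first by rewrite /K !mulr_gt0 // powR_gt0.
move=> xi xi1; have xi0 : 0 < xi by apply: lt_le_trans xi1.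
have y0 : 0 < 2 * (xi + C) by rewrite mulr_gt0 // addr_gt0.
pose t := (2 * (xi + C)) `^ (1 / (q - 1)).
have t0 : 0 < t by apply: powR_gt0.
have tq : t `^ (q - 1) = 2 * (xi + C).
  by rewrite -powRrM div1r mulVf ?lt0r_neq0 // powRr1 // ltW.
have tK : (2 * t) `^ (2 / d%:R) <= K * xi `^ e.
  rewrite powRM ?(ltW t0) // /t -powRrM [1 / _ * _]mulrC -/e /K -mulrA.
  rewrite ler_wpM2l ?powR_ge0 // -powRM ?(ltW C2) ?(ltW xi0) //.
  apply: (ge0_ler_powR e0); rewrite ?nnegrE ?(ltW y0) //.
    by rewrite mulr_ge0 ?(ltW C2) ?(ltW xi0).
  exact: lin.
have [n0 Hn] := box_choice t0; exists n0 => n /Hn[r [r0 rn cost]].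
apply: (le_trans (y := expR (- (4 * n%:R / r.+1%:R ^+ 2)))).
  rewrite ler_expR lerN2; apply: (le_trans cost).
  by rewrite -[36 * K * _]mulrA ler_wpM2l // mulrA ler_wpM2r ?powR_ge0.
apply: (le_trans (confined0 n r0)); apply: le_Pr => // w sw conf.
have H := qsum_box (ltW t0) conf; rewrite size_trail sw tq in H.
apply: le_trans H; apply: (le_trans (y := (xi + C) * n%:R)).
  by rewrite addrC mulrDl lerD2l EC.
rewrite [2 * _]mulrC -mulrA ler_wpM2l //; first by rewrite addr_ge0 // ltW.
by move: rn; move: (_ ^ d)%:R (n%:R : R) => x y; lra.
Qed.

End confinement.

(** * Upper bounds for the power sum and its truncation *)

Section upper_tails.
Variables (R : realType) (d : nat) (gam q : R).
Hypothesis d3 : (3 <= d)%N.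
Hypotheses (gam0 : 0 < gam) (gamd : gam * (1 - 2 / d%:R) < 2 / d%:R).
Hypotheses (q1 : 1 < q) (qgam : q - 1 < gam).
Local Notation word := (seq (step d)).
Let d0 : (0 < d)%N. Proof. exact: leq_trans d3. Qed.

(** The starting level [a] is the integer part of [(xi / Cq)^(1/(q-1))]: without failures the sum is
    then below [xi n]. If this is under [a0], then [xi] is bounded, and concentration at deviation
    [n] suffices once [c] is reduced. *)
Lemma qsum_upper_tail : exists2 c : R, 0 < c & forall xi : R, 1 <= xi ->
  exists n0, forall n, (n0 <= n)%N ->
  Pr R n (fun w : word => Ex n (fun w' : word => qsum q (trail 0 w')) + xi * n%:R <=
    qsum q (trail 0 w)) <=
  expR (- (c * (xi `^ (2 / d%:R * (1 / (q - 1))) * n%:R `^ (1 - 2 / d%:R)))).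
Proof.
have [c1 [c10 [a0 [a00 Ha]]]] := level_tails d3 gam0 gamd.
have [c2 [c20 [n2 H2]]] := qsum_concentration d3 gam0 gamd q1 qgam.
have q10 : 0 < q - 1 by rewrite subr_gt0.
have /andP[D0 D1] := two_div_d R d3; set del : R := 2 / d%:R in D0 D1 *.
pose Cq := 2 * (2 `^ (q - 1) + level_const gam q).
have Cq0 : 0 < Cq by rewrite mulr_gt0 // addr_gt0 ?powR_gt0 // level_const_gt0.
pose e : R := del * (1 / (q - 1)).
pose D := Cq `^ e; have D00 : 0 < D by apply: powR_gt0.
have aR : 0 < a0%:R :> R by rewrite ltr0n.
pose c := Num.min (c1 / (2 * D)) (c2 / (D * a0%:R)).
have c0 : 0 < c.
  by rewrite lt_min; apply/andP; split; apply: divr_gt0 => //; apply: mulr_gt0.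
have cc1 : c <= c1 / (2 * D) by rewrite ge_min lexx.
have cc2 : c <= c2 / (D * a0%:R) by rewrite ge_min lexx orbT.
exists c => // xi xi1; have xi0 : 0 < xi by apply: lt_le_trans xi1.
rewrite -/e; pose y := (xi / Cq) `^ (1 / (q - 1)).
have y0 : 0 <= y by apply: powR_ge0.
have xiE : xi `^ e = D * y `^ del.
  rewrite /y -powRrM [1 / _ * _]mulrC -/e /D -powRM ?(ltW Cq0) ?divr_ge0 ?(ltW xi0) ?(ltW Cq0) //.
  by rewrite mulrC mulfVK ?lt0r_neq0.
have [ay|ya] := leP a0%:R y.
  pose a := Num.truncn y; have a0a : (a0 <= a)%N by rewrite /a truncn_ge_nat.
  have [n1 H1] := Ha a a0a; exists (maxn n1 1) => n; rewrite geq_max => /andP[/H1 {}H1 n0].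
  have nR : 0 < n%:R :> R by rewrite ltr0n.
  have /andP[ya ya1] := truncn_itv y0; rewrite -/a in ya ya1.
  have a1 : 1 <= a%:R :> R by rewrite ler1n (leq_trans a00).
  have yd : y `^ del <= 2 * a%:R `^ del.
    apply: (le_trans (y := (2 * a%:R) `^ del)).
      rewrite ge0_ler_powR ?nnegrE ?mulr_ge0 ?(ltW D0) //.
      by apply: (le_trans (ltW ya1)); rewrite -[a.+1%:R]natr1; lra.
    rewrite powRM // ler_wpM2r ?powR_ge0 // -[leRHS](powRr1 (ler0n R 2)).
    by rewrite ler_powR ?ler1n //; lra.
  apply: (le_trans (y := Pr R n (fun w : word => has (fail gam a n w) (iota 0 n)))); last first.
    apply: (le_trans H1); rewrite ler_expR lerN2 mulrA [c1 * _]mulrA.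
    rewrite ler_wpM2r ?powR_ge0 // xiE.
    apply: (le_trans (y := c1 / (2 * D) * (D * (2 * a%:R `^ del)))).
      apply: ler_pM => //; rewrite ?(ltW c0) ?mulr_ge0 ?(ltW D00) ?powR_ge0 //.
      by rewrite ler_wpM2l // ltW.
    rewrite le_eqVlt; apply/orP; left; apply/eqP; field; exact: lt0r_neq0.
  apply: le_Pr => // w sw; apply: contraTT => nofail; rewrite -ltNge.
  have a_pos : (0 < a)%N by apply: leq_trans a0a.
  apply: (le_lt_trans (nofail_qsum d3 gam0 gamd q1 qgam a_pos sw nofail)).
  have M0 : 0 <= Ex n (fun w' : word => qsum q (trail 0 w')).
    by apply: Ex_ge0 => // w' _; apply: occ_ge0 => l; exact: powR_ge0.
  apply: (lt_le_trans (y := xi * n%:R)); last by rewrite lerDr.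
  rewrite ltr_pM2r //.
  have aq : a%:R `^ (q - 1) <= xi / Cq.
    apply: (le_trans (y := y `^ (q - 1))).
      by rewrite ge0_ler_powR ?nnegrE ?(ltW q10).
    rewrite /y -powRrM div1r mulVf ?lt0r_neq0 // powRr1 // divr_ge0 ?(ltW Cq0) ?(ltW xi0) //.
  move: aq; rewrite ler_pdivlMr // /Cq.
  by move: (_ `^ _ + _) (a%:R `^ _) => x z; lra.
exists n2 => n /H2 {}H2.
apply: (le_trans (y := Pr R n (fun w : word =>
    Ex n (fun w' : word => qsum q (trail 0 w')) + n%:R <= qsum q (trail 0 w)))).
  apply: le_Pr => // w _; apply: le_trans; rewrite lerD2l ler_peMl //.
apply: (le_trans H2); rewrite ler_expR lerN2 mulrA ler_wpM2r ?powR_ge0 //.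
rewrite xiE; apply: (le_trans (y := c2 / (D * a0%:R) * (D * a0%:R))).
  apply: ler_pM => //; rewrite ?(ltW c0) ?mulr_ge0 ?(ltW D00) ?powR_ge0 //.
  rewrite ler_wpM2l ?(ltW D00) //; apply: (le_trans (y := a0%:R `^ del)).
    by rewrite ge0_ler_powR ?nnegrE ?(ltW D0) ?(ltW ya).
  rewrite -[leRHS](powRr1 (ltW aR)) ler_powR ?ler1n //; lra.
by rewrite mulfVK // lt0r_neq0 // mulr_gt0.
Qed.

Lemma le_qhigh (A B : R) (s : seq 'rV[int]_d) : A <= B -> qhigh q B s <= qhigh q A s.
Proof.
move=> AB; apply: le_occ => l; rewrite ler_wpM2r ?powR_ge0 // ler_nat.
by case: (ltP B) => // /(le_lt_trans AB) ->.
Qed.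

(** First [a] is raised until [c1 a^(2/d) >= M], then [J] until the sites above the cut carry at
    most [n / 4 < xi n] in the absence of failures. *)
Lemma qhigh_tail (M xi : R) : 0 < M -> 1 <= xi -> exists A0 : R, forall A, A0 <= A ->
  exists n0, forall n, (n0 <= n)%N ->
  Pr R n (fun w : word => xi * n%:R <= qhigh q A (trail 0 w)) <=
  expR (- (M * n%:R `^ (1 - 2 / d%:R))).
Proof.
move=> M0 xi1.
have [c1 [c10 [a0 [a00 Ha]]]] := level_tails d3 gam0 gamd.
have dR : 0 < d%:R :> R by rewrite ltr0n.
have Mc : 0 < M / c1 by rewrite divr_gt0.
pose y := (M / c1) `^ (d%:R / 2); have y0 : 0 <= y by exact: powR_ge0.
pose a := maxn a0 (Num.truncn y).+1.
have ya : y <= a%:R.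
  by apply: (le_trans (ltW (truncnS_gt y))); rewrite ler_nat leq_maxr.
have aM : M <= c1 * a%:R `^ (2 / d%:R).
  rewrite -ler_pdivrMl // mulrC; apply: (le_trans (y := y `^ (2 / d%:R))).
    rewrite /y -powRrM; have -> : d%:R / 2 * (2 / d%:R) = 1 :> R by field; exact: lt0r_neq0.
    by rewrite powRr1 // ltW.
  by rewrite ge0_ler_powR ?nnegrE // divr_ge0 // ltW.
have [n1 H1] := Ha a (leq_maxl _ _); have [J HJ] := level_choice qgam a.
have a_pos : (0 < a)%N by rewrite (leq_trans a00) // leq_maxl.
exists (2 * a * 4 ^ J)%N%:R => A AJ; exists (maxn n1 1) => n.
rewrite geq_max => /andP[/H1 {}H1 n0]; have nR : 0 < n%:R :> R by rewrite ltr0n.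
apply: (le_trans (y := Pr R n (fun w : word => has (fail gam a n w) (iota 0 n)))); last first.
  by apply: (le_trans H1); rewrite ler_expR lerN2 mulrA ler_wpM2r ?powR_ge0.
apply: le_Pr => // w sw; apply: contraTT => nofail; rewrite -ltNge.
apply: (le_lt_trans (le_qhigh _ AJ)).
apply: (le_lt_trans (nofail_qhigh d3 gam0 gamd q1 qgam J a_pos sw nofail)).
by rewrite ltr_pM2r //; lra.
Qed.

End upper_tails.

(** * From words to the random walk *)

Section word_sums.
Variables (R : realType) (d : nat).
Local Notation word := (seq (step d)).

Fixpoint words (n : nat) : seq word :=
  if n is m.+1 then [seq s :: v | s <- enum {: step d}, v <- words m] else [:: [::]].

Lemma mem_words n v : (v \in words n) = (size v == n).
Proof.
elim: n v => [|n IH] [|s v] //=.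
  by apply/allpairsP => -[[s v]] /= [_ _].
rewrite eqSS -IH; apply/allpairsP/idP => [[[s' v'] /= [_ v'n [_ ->]]] //|vn].
by exists (s, v); rewrite mem_enum.
Qed.

Lemma uniq_words n : uniq (words n).
Proof.
elim: n => [//|n IH] /=; apply: allpairs_uniq => //; first exact: enum_uniq.
by move=> [s v] [s' v'] _ _ /= [-> ->].
Qed.

Lemma Ex_words n (f : word -> R) :
  Ex n f = (2 * d%:R)^-1 ^+ n * \sum_(v <- words n) f v.
Proof.
elim: n f => [|n IH] f /=; first by rewrite expr0 mul1r big_seq1.
rewrite big_allpairs_dep exprS -mulrA mulr_sumr /avg; congr *%R.
rewrite big_enum; apply: eq_bigr => s _; exact: IH.
Qed.

Lemma vec_inj : injective (@vec d).
Proof.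
move=> [i b] [j c] /matrixP E; have := E ord0 i; have := E ord0 j.
rewrite !mxE /= !eqxx [j == i]eq_sym; case: eqP => [->|_]; last first.
  by move=> /eqP; rewrite eq_sym signr_eq0.
by case: b c {E} => -[].
Qed.

Lemma nearest_neighbour_vec (s : step d) : nearest_neighbour (vec s).
Proof.
rewrite /nearest_neighbour (bigD1 s.1) //= big1 => [|i si].
  by rewrite !mxE eqxx normr_sign addr0.
by rewrite mxE eq_sym (negbTE si) normr0.
Qed.

End word_sums.

Section transfer.
Context {R : realType} {disp : measure_display} {T : measurableType disp}.
Variables (P : probability T R) (d : nat) (S : nat -> T -> 'rV[int]_d).
Hypothesis d0 : (0 < d)%N.
Hypothesis SRW : simple_random_walk P S.
Local Notation word := (seq (step d)).
Local Notation point := 'rV[int]_d.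

Definition steps (n : nat) (w : T) : seq point := [seq increment S k w | k <- iota 0 n].
Definition positions (n : nat) (w : T) : seq point := [seq S k w | k <- iota 0 n].

Lemma walk_sum k w : S k w = \sum_(0 <= j < k) increment S j w.
Proof.
have [S0 _ _ _] := SRW.
by rewrite telescope_sumr // S0 subr0.
Qed.

Lemma positions_steps n w : positions n w =
  [seq \sum_(0 <= j < k) nth 0 (steps n w) j | k <- iota 0 n].
Proof.
apply/eq_in_map => k; rewrite mem_iota add0n => /= kn; rewrite walk_sum !big_nat.
apply: eq_bigr => j /= jk; have jn := ltn_trans jk kn.
by rewrite (nth_map 0%N) ?size_iota // nth_iota.
Qed.

(** Finite sequences of lattice points are countable, so it suffices to treat a single sequence, by
    intersecting events on the increments. *)
Lemma measurable_steps n (B : set (seq point)) : measurable [set w | B (steps n w)].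
Proof.
have [_ mX _ _] := SRW.
have atom (l : seq nat) (s : seq point) :
    measurable [set w | [seq increment S k w | k <- l] = s].
  elim: l s => [|a l IH] [|b s] /=.
  - by have -> : [set w : T | [::] = [::] :> seq point] = setT by apply/seteqP.
  - by rewrite (_ : mkset _ = set0) //; apply/seteqP; split.
  - by rewrite (_ : mkset _ = set0) //; apply/seteqP; split.
  rewrite (_ : mkset _ = increment S a @^-1` [set b] `&`
    [set w | [seq increment S k w | k <- l] = s]).
    by apply: measurableI; [exact: mX|exact: IH].
  by apply/seteqP; split => w /= [-> ->].
rewrite (_ : mkset _ = \bigcup_s [set w | steps n w = s /\ B s]).
  apply: countable_bigcupT_measurable; first exact: countableP.
  move=> s; have [Bs|nBs] := pselect (B s).
    rewrite (_ : mkset _ = [set w | steps n w = s]) ?/steps //.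
    by apply/seteqP; split => [w []|w].
  by rewrite (_ : mkset _ = set0) //; apply/seteqP; split => w // [].
by apply/seteqP; split => [w Bw|w [s _ [<-]]] //=; exists (steps n w).
Qed.

Lemma measurable_positions n (B : set (seq point)) : measurable [set w | B (positions n w)].
Proof.
rewrite (_ : mkset _ = [set w | B [seq \sum_(0 <= j < k) nth 0 (steps n w) j | k <- iota 0 n]]).
  exact: (measurable_steps n (fun s => B [seq \sum_(0 <= j < k) nth 0 s j | k <- iota 0 n])).
by apply/seteqP; split => w /=; rewrite positions_steps.
Qed.

Definition follows (v : word) : set T := [set w | steps (size v) w = map (@vec d) v].

Lemma P_follows v : P (follows v) = ((2 * d%:R)^-1 ^+ size v)%:E.
Proof.
have [_ mX ind nn] := SRW.
pose J := [fset k in iota 0 (size v)]%fset.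
have -> : follows v = \bigcap_(k in [set` J])
    (increment S k @^-1` [set nth 0 (map (@vec d) v) k]).
  apply/seteqP; split => [w E k /=|w E].
    rewrite in_fset /= mem_iota add0n => /= kv.
    by rewrite -E (nth_map 0%N) ?size_iota // nth_iota.
  apply: (@eq_from_nth _ 0); rewrite ?size_map ?size_iota // => k kv.
  rewrite (nth_map 0%N) ?size_iota // nth_iota // add0n; apply: E => /=.
  by rewrite in_fset /= mem_iota.
rewrite ind (perm_big (iota 0 (size v))); last first.
  by apply: uniq_perm; rewrite ?fset_uniq ?iota_uniq // => k; rewrite in_fset.
rewrite big_seq (eq_bigr (fun _ => ((2 * d%:R)^-1)%:E)); last first.
  move=> k; rewrite mem_iota add0n => /= kv.
  have s0 : step d by exact: (nth (Ordinal d0, true) v 0).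
  by rewrite (nth_map s0) // nn //; exact: nearest_neighbour_vec.
rewrite -big_seq prodEFin; congr EFin.
by rewrite big_const_seq count_predT size_iota iter_mulr_1.
Qed.

Lemma positions_follows v w : follows v w -> positions (size v) w = trail 0 v.
Proof.
move=> E; apply: (@eq_from_nth _ 0); rewrite ?size_map size_iota ?size_trail // => k kv.
rewrite positions_steps E nth_trail // add0r (nth_map 0%N) ?size_iota // nth_iota // add0n.
rewrite /pos -(big_map (@vec d) predT id) [RHS](big_nth 0) size_map size_takel ?(ltnW kv) //.
rewrite !big_nat; apply: eq_bigr => j /= jk.
by rewrite map_take nth_take.
Qed.

(** The events [follows v] over words of length [n] are disjoint, and integrating the constant 1
    shows that they exhaust the mass; the complement, where some increment is not a unit step, is
    negligible. *)
Lemma walk_integral n (f : seq point -> R) : (forall s, 0 <= f s) ->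
  (\int[P]_w (f (positions n w))%:E)%E = (Ex n (fun v => f (trail 0 v)))%:E.
Proof.
move=> f0; pose U := \big[setU/set0]_(v <- words d n) follows v.
have mF v : measurable (follows v) by exact: (measurable_steps (size v) (fun s => s = map (@vec d) v)).
have mU : measurable U by apply: bigsetU_measurable.
have tF : trivIset [set` words d n] follows.
  move=> v v' /=; rewrite !mem_words => /eqP sv /eqP sv' [w [/= E E']].
  by apply: (inj_map (@vec_inj d)); rewrite -E -E' sv sv'.
have mf : measurable_fun [set: T] (EFin \o (f \o positions n)).
  apply/measurable_EFinP => _ Y mY; rewrite setTI.
  exact: (measurable_positions n (fun s => Y (f s))).
have intU (g : seq point -> R) : (forall s, 0 <= g s) ->
    measurable_fun U (EFin \o (g \o positions n)) ->
    (\int[P]_(w in U) (g (positions n w))%:E)%E = (Ex n (fun v => g (trail 0 v)))%:E.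
  move=> g0 mg; rewrite ge0_integral_bigsetU ?uniq_words //; last first.
    by move=> w _; rewrite lee_fin.
  rewrite Ex_words mulr_sumr -sumEFin !big_seq; apply: eq_bigr => v.
  rewrite mem_words => /eqP sv.
  rewrite (eq_integral (fun _ => (g (trail 0 v))%:E)); last first.
    by move=> w /[!inE] E; rewrite -(positions_follows E) sv.
  by rewrite integral_cst // [X in (_ * X)%E](P_follows v) sv -EFinM mulrC.
have PU : P U = 1%E.
  have := intU (fun _ => 1) (fun _ => ler01) (measurable_cst (1%E : \bar R)).
  by rewrite integral_cst // mul1e Ex_cst.
rewrite (ge0_negligible_integral (measurableC mU)) ?setDE ?setTI ?setCK //.
- by apply: intU => //; exact: measurable_funTS.
- by move=> w _; rewrite lee_fin.
- by apply: (eq_trans (probability_setC P mU)); rewrite PU subee.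
Qed.

Lemma walk_probability n (A : pred (seq point)) :
  P [set w | A (positions n w)] = (Pr R n (fun v => A (trail 0 v)))%:E.
Proof.
have mA := measurable_positions n A.
rewrite /Pr -(walk_integral n (f := fun s => (A s)%:R)) //.
transitivity (\int[P]_w (\1_[set w | A (positions n w)] w)%:E)%E.
  by rewrite integral_indic // setIT.
apply: eq_integral => w _.
by rewrite indicE; congr (nat_of_bool _)%:R%:E; apply/idP/idP => [/set_mem|/mem_set].
Qed.

Lemma local_time_positions n z w : local_time S n z w = count_mem z (positions n w).
Proof.
rewrite /local_time /positions -sum1_count big_map -(big_mkord xpredT (fun k => (S k w == z) : nat)).
by rewrite [RHS]big_mkcond /index_iota subn0; apply: eq_bigr => k _ /=; case: (_ == z).
Qed.

Lemma sum_lattice_occ (phi : nat -> R) n w : phi 0%N = 0 ->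
  \sum_(z \in [set: point]) phi (local_time S n z w) = occ phi (positions n w).
Proof.
move=> phi0; rewrite (@fsbigE _ _ _ _ _ (undup (positions n w))) ?undup_uniq //.
  rewrite /occ; apply: eq_big => [z|z _]; first by rewrite in_setT.
  by rewrite local_time_positions.
move=> z _; rewrite mem_undup => zp; rewrite local_time_positions.
by rewrite (count_memPn zp).
Qed.

Variable q : R.
Hypothesis q0 : 0 < q.

Lemma local_time_norm_positions n w : local_time_norm S q n w = qsum q (positions n w).
Proof. by rewrite /local_time_norm (@sum_lattice_occ (fun l => l%:R `^ q)) // powR0 ?gt_eqF. Qed.

Lemma high_local_time_norm_positions A n w :
  high_local_time_norm S q A n w = qhigh q A (positions n w).
Proof.
rewrite /high_local_time_norm
  (@sum_lattice_occ (fun l => (A < l%:R)%R%:R * l%:R `^ q)) //.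
by rewrite powR0 ?gt_eqF // mulr0.
Qed.

Lemma expectation_local_time_norm n :
  ('E_P[local_time_norm S q n] = (Ex n (fun v : word => qsum q (trail 0 v)))%:E)%E.
Proof.
rewrite unlock -walk_integral; last by move=> s; apply: occ_ge0 => l; exact: powR_ge0.
by apply: eq_integral => w _; rewrite local_time_norm_positions.
Qed.

End transfer.

Lemma limf_esup_le (R : realType) (U : choiceType) (X : filteredType U) (F : set_system X) (f : X -> \bar R)
    (V : set X) (c : \bar R) :
  F V -> (forall x, V x -> (f x <= c)%E) -> (limf_esup f F <= c)%E.
Proof.
move=> FV fc; apply: ge_ereal_inf; exists (ereal_sup (f @` V)); first by exists V.
by apply: ge_ereal_sup => _ [x Vx <-]; exact: fc.
Qed.

(** The case [p = 0] is the convention [log 0 = -oo]: a positive multiple of [-oo] lies below any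
    bound. *)
Lemma scaled_lne_le (R : realType) (p a M : R) : 0 < a -> 0 <= p ->
  p <= expR (- (M * a)) -> ((1 / a)%:E * lne p%:E <= (- M)%:E)%E.
Proof.
move=> a0; rewrite le_eqVlt => /predU1P[<- _|p0 pa].
  by rewrite /= lexx gt0_muleNy ?leNye // lte_fin divr_gt0.
rewrite lne_EFin // -EFinM lee_fin mulrC mulrA mulr1 ler_pdivrMr // mulNr.
by rewrite -[leRHS]expRK ler_ln ?posrE ?expR_gt0.
Qed.

(** The midpoint of [q - 1] and [2/(d-2)], the latter being [2/d] divided by [1 - 2/d]. *)
Lemma exponent_choice (R : realType) (d : nat) (q : R) : (3 <= d)%N -> 1 < q ->
  q < d%:R / (d%:R - 2) ->
  exists gam, [/\ 0 < gam, gam * (1 - 2 / d%:R) < 2 / d%:R & q - 1 < gam].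
Proof.
move=> d3 q1; have : 3 <= d%:R :> R by rewrite ler_nat.
move: d%:R => D D3; have D2 : 0 < D - 2 by lra.
have D0 : 0 < D by lra.
have -> : D / (D - 2) = 1 + 2 / (D - 2) by field; exact: lt0r_neq0.
set b := 2 / (D - 2) => qb; exists ((q - 1 + b) / 2); split; try lra.
have {2}-> : 2 / D = b * (1 - 2 / D) by rewrite /b; field; rewrite !lt0r_neq0.
rewrite ltr_pM2r; first by lra.
by rewrite subr_gt0 ltr_pdivrMr // mul1r; lra.
Qed.

Theorem theorem1p1 (R : realType) (d : nat) (q : R) (hd : (3 <= d)%N)
    (hq1 : 1 < q) (hq2 : q < d%:R / (d%:R - 2)) :
  (exists cm cp : R, [/\ 0 < cm, 0 < cp &
    forall (disp : measure_display) (T : measurableType disp)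
      (P : probability T R) (S : nat -> T -> 'rV[int]_d),
      simple_random_walk P S ->
      forall xi : R, 1 <= xi ->
      \forall n \near \oo,
        let p := P [set w | ((xi * n%:R)%:E <=
          (local_time_norm S q n w)%:E - 'E_P[local_time_norm S q n])%E] in
        let rate :=
          xi `^ ((2 / d%:R) * (1 / (q - 1))) * n%:R `^ (1 - 2 / d%:R) in
        ((expR (- (cm * rate)))%:E <= p)%E /\
        (p <= (expR (- (cp * rate)))%:E)%E]) /\
  (forall (disp : measure_display) (T : measurableType disp)
     (P : probability T R) (S : nat -> T -> 'rV[int]_d),
     simple_random_walk P S ->
     forall xi : R, 1 <= xi ->
     limf_esup (fun A : R =>
       limn_esup (fun n : nat =>
         ((1 / n%:R `^ (1 - 2 / d%:R))%:E *
          lne (P [set w | (xi * n%:R <= high_local_time_norm S q A n w)%R]))%E))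
       (pinfty_nbhs R) = -oo%E).
Proof.
have d0 : (0 < d)%N by exact: leq_trans hd.
have q0 : 0 < q by exact: lt_trans hq1.
have [gam [gam0 gamd qgam]] := exponent_choice hd hq1 hq2.
have [cm cm0 lower] := qsum_lower_tail hd hq1.
have [cp cp0 upper] := qsum_upper_tail hd gam0 gamd hq1 qgam.
split.
  exists cm, cp; split => // disp T P S SRW xi xi1.
  have [n1 lo] := lower xi xi1; have [n2 up] := upper xi xi1.
  exists (maxn n1 n2) => // n /=; rewrite geq_max => /andP[/lo {}lo /up {}up].
  have -> : [set w | ((xi * n%:R)%:E <=
      (local_time_norm S q n w)%:E - 'E_P[local_time_norm S q n])%E] =
      [set w | Ex n (fun v : seq (step d) => qsum q (trail 0 v)) + xi * n%:R <= qsum q (positions S n w)].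
    apply/seteqP; split => w /=; rewrite (expectation_local_time_norm d0 SRW q0);
      by rewrite local_time_norm_positions // -EFinB lee_fin lerBrDl.
  rewrite (walk_probability d0 SRW n
    (fun s => Ex n (fun v : seq (step d) => qsum q (trail 0 v)) + xi * n%:R <= qsum q s)).
  by rewrite !lee_fin.
move=> disp T P S SRW xi xi1; apply: eq_ninfty => r.
pose M := `|r| + 1; have M0 : 0 < M by rewrite ltr_pwDr.
have Mr : - M <= r by have := ler_norm (- r); rewrite normrN /M; lra.
apply: (le_trans (y := (- M)%:E)); last by rewrite lee_fin.
(* For the rate [M] all large [A] work, and for each of them all large [n], so that both upper
   limits are bounded by [- M]. *)
have [A0 HA] := qhigh_tail hd gam0 gamd hq1 qgam M0 xi1.
apply: (limf_esup_le (V := [set A | A0 < A])).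
  by exists A0; split => //; exact: num_real.
move=> A /= /ltW /HA[n0 Hn]; apply: (limf_esup_le (V := [set n | (maxn n0 1 <= n)%N])).
  by exists (maxn n0 1).
move=> n /=; rewrite geq_max => /andP[/Hn {}Hn n1].
have -> : [set w | xi * n%:R <= high_local_time_norm S q A n w] =
    [set w | xi * n%:R <= qhigh q A (positions S n w)].
  by apply/seteqP; split => w /=; rewrite high_local_time_norm_positions.
rewrite (walk_probability d0 SRW n (fun s => xi * n%:R <= qhigh q A s)).
by apply: scaled_lne_le; rewrite ?powR_gt0 ?ltr0n ?Pr_ge0.
Qed.
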